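(* Let $\alpha\in\mathbb R$, $1\le p<\infty$, $1<q<\infty$, $\gamma\in\mathbb R$, $\omega(x)=|x|_h^{\gamma}$ on $\mathbb H^n$, and $\Omega\in L^{q'}(S_{Q-1})$. Then $\mathcal H_{\Phi,\Omega}$ is bounded from $K^{\alpha,p}_{q,\omega}(\mathbb H^n)$ to itself if and only if $$\mathcal C_3=\int_0^\infty\frac{\Phi(t)}{t^{1-\alpha-\frac{Q+\gamma}{q}}}\,dt<+\infty .$$ Moreover, $$\|\mathcal H_{\Phi,\Omega}\|_{K^{\alpha,p}_{q,\omega}(\mathbb H^n)\to K^{\alpha,p}_{q,\omega}(\mathbb H^n)}\simeq\mathcal C_3\,\|\Omega\|_{L^{q'}(S_{Q-1})}.$$
   Context: Heisenberg group. $\mathbb H^n$ is $\mathbb R^{2n}\times\mathbb R$ with Lebesgue measure and group law $x\cdot y=\big(x_1+y_1,\dots,x_{2n}+y_{2n},\,x_{2n+1}+y_{2n+1}+2\sum_{j=1}^n(y_jx_{n+j}-x_jy_{n+j})\big)$; the identity is $0$ and $x^{-1}=-x$. Dilations: $\delta_rx=(rx_1,\dots,rx_{2n},r^2x_{2n+1})$, $r>0$. $Q=2n+2$. Norm: $|x|_h=\big((\sum_{i=1}^{2n}x_i^2)^2+x_{2n+1}^2\big)^{1/4}$. $S_{Q-1}=\{x:|x|_h=1\}$ carries the measure $dy'$ for which $\int_{\mathbb H^n}f(x)dx=\int_0^\infty\int_{S_{Q-1}}f(\delta_ry')r^{Q-1}dy'dr$. $U_k=\{x\in\mathbb H^n:|x|_h\le2^k\}$,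 $C_k=U_k\setminus U_{k-1}$, $\chi_k=\chi_{C_k}$ for $k\in\mathbb Z$. Operator. $\Phi:\mathbb H^n\to[0,\infty)$ is a radial measurable function (so $\Phi(x)$ depends only on $|x|_h$, and one writes $\Phi(t)$ for its value when $|x|_h=t$); $\Omega:S_{Q-1}\to\mathbb C$ is measurable with $\Omega(y)\ne0$ for almost every $y$. The rough Hausdorff operator is $$\mathcal H_{\Phi,\Omega}(f)(x)=\int_{\mathbb H^n}\frac{\Phi(\delta_{|y|_h^{-1}}x)}{|y|_h^{Q}}\Omega(\delta_{|y|_h^{-1}}y)f(y)\,dy=\int_0^\infty\int_{S_{Q-1}}\frac{\Phi(t)}{t}\Omega(y')f(\delta_{t^{-1}|x|_h}y')\,dy'dt .$$ Spaces. For a weight (non-negative measurable function) $\omega$, $\|f\|_{L^q_\omega(\mathbb H^n)}=\big(\int_{\mathbb H^n}|f|^q\omega\,dx\big)^{1/q}$, and $L^q_{\omega,\mathrm{loc}}(\mathbb H^n\setminus\{0\})$ is the set of measurable $f$ with $\int_K|f|^q\omega\,dx<\infty$ for every compact $K\subset\mathbb H^n\setminus\{0\}$. For $\alpha\in\mathbb R$, $0<p,q<\infty$, the weighted Herz space $K^{\alpha,p}_{q,\omega}(\mathbb H^n)$ consists of $f\in L^q_{\omega,\mathrm{loc}}(\mathbb H^n\setminus\{0\})$ with $$\|f\|_{K^{\alpha,p}_{q,\omega}(\mathbb H^n)}=\Big(\sum_{k=-\infty}^\infty2^{k\alpha p}\|f\chi_k\|^p_{L^q_\omega(\mathbb H^n)}\Big)^{1/p}<\infty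 .$$ Conventions. $q'$ is the conjugate exponent of $q$. An operator $T$ is bounded from $X$ to $Y$ if for every $f\in X$ the integral defining $Tf(x)$ converges absolutely for a.e. $x$ and $\|Tf\|_Y\le C\|f\|_X$ with $C$ independent of $f$; $\|T\|_{X\to Y}$ is the least such $C$. $a\simeq b$ means $C^{-1}a\le b\le Ca$ with a constant $C>0$ independent of $\Phi$ and $\Omega$. *)

(* Defs.v *)
From HB Require Import structures.
From mathcomp Require Import all_boot all_order all_algebra.
From mathcomp Require Import all_classical all_reals all_analysis.
From mathcomp Require Import measurable_realfun.
From mathcomp Require Import complex.

Set Implicit Arguments.
Unset Strict Implicit.
Unset Printing Implicit Defensive.

Import Order.TTheory GRing.Theory Num.Theory.
Import numFieldNormedType.Exports.

Local Open Scope classical_set_scope.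
Local Open Scope ring_scope.

Definition measure_rV_display : measure_display -> measure_display.
Proof. exact. Qed.

Section measurable_rV.
Context {d} {T : sigmaRingType d} (m : nat).

Let coors : 'I_m -> 'rV[T]_m -> T := fun i x => x ord0 i.

Let rV_set0 : g_sigma_preimage coors set0.
Proof. exact: sigma_algebra0. Qed.

Let rV_setC A : g_sigma_preimage coors A -> g_sigma_preimage coors (~` A).
Proof. exact: sigma_algebraC. Qed.

Let rV_bigcup (F : _^nat) : (forall i, g_sigma_preimage coors (F i)) ->
  g_sigma_preimage coors (\bigcup_i (F i)).
Proof. exact: sigma_algebra_bigcup. Qed.

HB.instance Definition _ := @isMeasurable.Build (measure_rV_display d)
  'rV[T]_m (g_sigma_preimage coors) rV_set0 rV_setC rV_bigcup.

End measurable_rV.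

Lemma measurable_coord d (T : sigmaRingType d) m (i : 'I_m) :
  measurable_fun [set: 'rV[T]_m] (fun x : 'rV[T]_m => x ord0 i).
Proof.
move=> _ Y mY; rewrite setTI; apply: sub_sigma_algebra => /=.
rewrite -bigcup_seq/=; exists i => /=; first by rewrite mem_index_enum.
by exists Y => //; rewrite setTI.
Qed.

Lemma measurable_fun_rVP d1 d2 (T1 : measurableType d1) (T2 : measurableType d2)
    m (f : T1 -> 'rV[T2]_m) :
  measurable_fun [set: T1] f <->
  forall i, measurable_fun [set: T1] (fun x => f x ord0 i).
Proof.
split=> [mf i|mf].
  exact: (measurableT_comp (@measurable_coord _ _ _ i) mf).
apply: (@measurability _ _ _ _ [set: T1] f) => //.
move=> _ [B + <-]; rewrite -bigcup_seq => -[i _ [A mA <-]].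
by rewrite setTI; exact: mf.
Qed.

Lemma sigma_finite_product d1 d2 (T1 : measurableType d1)
    (T2 : measurableType d2) (R : realType)
    (m1 : {sigma_finite_measure set T1 -> \bar R})
    (m2 : {sigma_finite_measure set T2 -> \bar R}) :
  sigma_finite setT (m1 \x m2)%E.
Proof.
have /sigma_finiteP[F [TF ndF Foo]] := sigma_finiteT m1.
have /sigma_finiteP[G [TG ndG Goo]] := sigma_finiteT m2.
exists (fun n => F n `*` G n).
  rewrite -setXTT TF TG predeqE => -[x y]; split.
    move=> [/= [n _ Fnx] [k _ Gky]]; exists (maxn n k) => //; split.
    - by move: x Fnx; exact/subsetPset/ndF/leq_maxl.
    - by move: y Gky; exact/subsetPset/ndG/leq_maxr.
  by move=> [n _ []/= ? ?]; split; exists n.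
move=> k; have [? ?] := Foo k; have [? ?] := Goo k.
split; first exact: measurableX.
by rewrite product_measure1E// lte_mul_pinfty// ge0_fin_numE.
Qed.

Section lebesgue_rV.
Context {R : realType}.

(* The library attaches lebesgue_measure to the alias measurableTypeR R, whose
   display differs from that of R itself; this is the same measure on R. *)
Definition lebesgue_R : set R -> \bar R := @lebesgue_measure R.

HB.instance Definition _ := isMeasure.Build _ R R lebesgue_R
  (measure0 (@lebesgue_measure R)) (measure_ge0 (@lebesgue_measure R))
  (@measure_semi_sigma_additive _ _ _ (@lebesgue_measure R)).
HB.instance Definition _ := @Measure_isSigmaFinite.Build _ R R lebesgue_R
  (sigma_finiteT (@lebesgue_measure R)).

Lemma ge0_integral_lebesgue_R (D : set R) (f : R -> \bar R) :
  measurable D -> measurable_fun D f -> (forall x, D x -> 0 <= f x)%E ->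
  (\int[lebesgue_R]_(x in D) f x = \int[@lebesgue_measure R]_(x in D) f x)%E.
Proof.
move=> mD mf f0.
have mid : measurable_fun setT (idfun : measurableTypeR R -> R).
  by move=> _ Y mY; rewrite setTI.
rewrite (eq_measure_integral (pushforward (@lebesgue_measure R)
  (idfun : measurableTypeR R -> R))) //.
by rewrite ge0_integral_pushforward => // y /[!inE] /f0.
Qed.

Definition rV_cons m (p : R * 'rV[R]_m) : 'rV[R]_m.+1 := row_mx p.1%:M p.2.

Lemma rV_cons0 m (p : R * 'rV[R]_m) : rV_cons p ord0 ord0 = p.1.
Proof.
by rewrite /rV_cons mxE; case: splitP => // j _; rewrite mxE !ord1 eqxx mulr1n.
Qed.

Lemma rV_consS m (p : R * 'rV[R]_m) (i : 'I_m) :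
  rV_cons p ord0 (lift ord0 i) = p.2 ord0 i.
Proof.
rewrite /rV_cons mxE; case: splitP => [j|j].
  by rewrite ord1.
by rewrite /= /bump /= => -[] /val_inj ->.
Qed.

Lemma measurable_rV_cons m : measurable_fun setT (@rV_cons m).
Proof.
apply/measurable_fun_rVP => i; have [<-|i0] := eqVneq ord0 i.
  by under eq_fun do rewrite rV_cons0; exact: measurable_fst.
have [j -> _] := unlift_some i0.
under eq_fun do rewrite rV_consS.
exact: (measurableT_comp (@measurable_coord _ _ _ j) measurable_snd).
Qed.

Definition rV_head m (x : 'rV[R]_m.+1) : R * 'rV[R]_m :=
  (x ord0 ord0, \row_j x ord0 (lift ord0 j)).

Lemma measurable_rV_head m : measurable_fun setT (@rV_head m).
Proof.
apply/measurable_fun_pairP; split; first exact: measurable_coord.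
apply/measurable_fun_rVP => i.
by rewrite (_ : (fun _ => _) = fun x : 'rV[R]_m.+1 => x ord0 (lift ord0 i));
  [exact: measurable_coord | apply/funext => x; rewrite /= mxE].
Qed.

Lemma rV_consK m : cancel (@rV_cons m) (@rV_head m).
Proof.
move=> [t v]; rewrite /rV_head rV_cons0; congr pair.
by apply/rowP => j; rewrite mxE rV_consS.
Qed.

Section rV_prod.
Variables (m : nat) (mu : {sigma_finite_measure set 'rV[R]_m -> \bar R}).
Local Open Scope ereal_scope.

Definition rV_prod : set 'rV[R]_m.+1 -> \bar R :=
  pushforward (lebesgue_R \x mu) (@rV_cons m).

Let rV_prod0 : rV_prod set0 = 0.
Proof. by rewrite /rV_prod /pushforward preimage_set0 measure0. Qed.

Let rV_prod_ge0 A : 0 <= rV_prod A.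
Proof. by rewrite /rV_prod /pushforward measure_ge0. Qed.

Let rV_prod_sigma_additive : semi_sigma_additive rV_prod.
Proof.
have mc := @measurable_rV_cons m.
move=> F mF tF mUF; rewrite /rV_prod /pushforward preimage_bigcup.
apply: measure_semi_sigma_additive.
- by move=> n; rewrite -[X in measurable X]setTI; exact: mc.
- apply/trivIsetP => /= i j _ _ ij; rewrite -preimage_setI.
  by move/trivIsetP : tF => /(_ _ _ _ _ ij) ->//; rewrite preimage_set0.
- by rewrite -preimage_bigcup -[X in measurable X]setTI; exact: mc.
Qed.

HB.instance Definition _ :=
  isMeasure.Build _ _ _ rV_prod rV_prod0 rV_prod_ge0 rV_prod_sigma_additive.

Let rV_prod_sigma_finite : sigma_finite setT rV_prod.
Proof.
have [F FT mF] := sigma_finite_product lebesgue_R mu.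
exists (fun k => @rV_head m @^-1` F k).
  by rewrite -preimage_bigcup -FT preimage_setT.
move=> k; have [mFk Fk] := mF k; split.
  by rewrite -[X in measurable X]setTI; exact: measurable_rV_head.
rewrite /rV_prod /pushforward -comp_preimage.
by rewrite (_ : _ \o _ = id) // ; apply/funext => x /=; rewrite rV_consK.
Qed.

HB.instance Definition _ := @Measure_isSigmaFinite.Build _ _ _
  rV_prod rV_prod_sigma_finite.

End rV_prod.

Fixpoint lebesgue_rV m : {sigma_finite_measure set 'rV[R]_m -> \bar R} :=
  match m with
  | 0 => \d_(0 : 'rV[R]_0)
  | m.+1 => rV_prod (lebesgue_rV m)
  end.

Lemma lebesgue_rV_box m (A : 'I_m -> set R) : (forall i, measurable (A i)) ->
  lebesgue_rV m [set x : 'rV[R]_m | forall i, A i (x ord0 i)] =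
  (\prod_(i < m) lebesgue_measure (A i))%E.
Proof.
elim: m A => [|m IH] A mA.
  by rewrite big_ord0 /= diracE mem_set// => -[].
rewrite big_ord_recl -IH; last by move=> i; exact: mA.
pose B := [set x : 'rV[R]_m | forall i, A (lift ord0 i) (x ord0 i)].
transitivity ((lebesgue_R \x lebesgue_rV m)%E (A ord0 `*` B)).
  rewrite [LHS]/= /rV_prod /pushforward; congr (_ _).
  apply/seteqP; split=> -[t v] /=.
    move=> Av; split=> [|i]; first by have := Av ord0; rewrite rV_cons0.
    by have := Av (lift ord0 i); rewrite rV_consS.
  move=> [At Bv] i; have [<-|i0] := eqVneq ord0 i; first by rewrite rV_cons0.
  by have [j -> _] := unlift_some i0; rewrite rV_consS; exact: Bv.
have mB : measurable B.
  rewrite (_ : B = \bigcap_(i in [set: 'I_m])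
      ((fun x : 'rV[R]_m => x ord0 i) @^-1` A (lift ord0 i))).
    apply: fin_bigcap_measurable => // i _.
    by rewrite -[X in measurable X]setTI; exact: measurable_coord.
  by apply/seteqP; split=> x Bx i => [_|]; exact: Bx.
exact: product_measure1E.
Qed.

End lebesgue_rV.

Section complex_valued.
Context d (T : measurableType d) (R : realType).
Implicit Types (D : set T) (f : T -> R[i]).

Definition cmeasurable_fun D f :=
  measurable_fun D (fun x => complex.Re (f x)) /\
  measurable_fun D (fun x => complex.Im (f x)).

Definition cintegral (mu : {measure set T -> \bar R}) D f : R[i] :=
  Complex (\int[mu]_(x in D) complex.Re (f x))
          (\int[mu]_(x in D) complex.Im (f x)).

Definition abs_integrable (mu : {measure set T -> \bar R}) D f :=
  cmeasurable_fun D f /\ (\int[mu]_(x in D) (Normc.normc (f x))%:E < +oo)%E.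

Definition cLnorm (mu : {measure set T -> \bar R}) D (w : T -> R) (q : R) f :
    \bar R :=
  ((\int[mu]_(x in D) (Normc.normc (f x) `^ q * w x)%:E) `^ q^-1)%E.

End complex_valued.

(* Only the underlying measure space, norm and dilations of H^n are needed:
   the group law does not enter the definition of the operator or the spaces. *)
Notation heis R n := ('rV[R]_(2 * n) * R)%type.

Definition hdim (n : nat) : nat := (2 * n + 2)%N.

Section heisenberg.
Context {R : realType} {n : nat}.
Local Notation H := (heis R n).
Implicit Types (x y : H) (r t : R).

Definition dil r x : H := (r *: x.1, r ^+ 2 * x.2).

Definition hnorm x : R :=
  ((\sum_(i < 2 * n) x.1 ord0 i ^+ 2) ^+ 2 + x.2 ^+ 2) `^ 4^-1.

Definition lebesgue_heis : set H -> \bar R :=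
  (lebesgue_rV (2 * n) \x @lebesgue_R R)%E.

HB.instance Definition _ := Measure.on lebesgue_heis.
HB.instance Definition _ := @Measure_isSigmaFinite.Build _ _ _ lebesgue_heis
  (sigma_finite_product (lebesgue_rV (2 * n)) (@lebesgue_R R)).

Definition hsphere : set H := [set x | hnorm x = 1].

(* sigma is carried by the ambient space; only its restriction to hsphere is
   constrained (and determined) by the polar coordinates formula, and only that
   restriction is ever used. *)
Definition polar_measure (sigma : {measure set H -> \bar R}) :=
  forall f : H -> \bar R, measurable_fun setT f -> (forall x, 0 <= f x)%E ->
  (\int[lebesgue_heis]_x f x =
   \int[@lebesgue_measure R]_(r in `]0%R, +oo[)
     \int[sigma]_(y in hsphere) (f (dil r y) * (r ^+ (hdim n).-1)%:E))%E.

Definition sphere_Lnorm (sigma : {measure set H -> \bar R}) (q : R)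
    (Omega : H -> R[i]) : \bar R :=
  cLnorm sigma hsphere (cst 1) q Omega.

Definition hball (k : int) : set H := [set x | hnorm x <= 2 ^ k].
Definition hshell (k : int) : set H := hball k `\` hball (k - 1).

Definition radial (Phi : H -> R) :=
  forall x y, hnorm x = hnorm y -> Phi x = Phi y.

Lemma hnorm_vert t : 0 <= t -> hnorm (0, t ^+ 2) = t.
Proof.
move=> t0; rewrite /hnorm /= big1; last by move=> i _; rewrite mxE expr0n.
by rewrite expr0n add0r -exprM -powR_mulrn// -powRrM mulfV ?powRr1//.
Qed.

(* Phi(t): the value of a radial function on the sphere of radius t >= 0, where
   (0, t^2) lies by hnorm_vert *)
Definition profile (Phi : H -> R) t : R := Phi (0, t ^+ 2).

Definition Lq_loc (w : H -> R) (q : R) (f : H -> R[i]) :=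
  cmeasurable_fun setT f /\
  forall K : set H, compact K -> ~ K 0 ->
    (\int[lebesgue_heis]_(x in K) (Normc.normc (f x) `^ q * w x)%:E < +oo)%E.

Definition shell_part (k : int) (f : H -> R[i]) x : R[i] :=
  f x * (\1_(hshell k) x)%:C%C.

Definition herz_norm (alpha p q : R) (w : H -> R) (f : H -> R[i]) : \bar R :=
  ((\esum_(k in [set: int])
     ((2 `^ (k%:~R * alpha * p))%:E *
      cLnorm lebesgue_heis setT w q (shell_part k f) `^ p)) `^ p^-1)%E.

Definition herz_space (alpha p q : R) (w : H -> R) (f : H -> R[i]) :=
  Lq_loc w q f /\ (herz_norm alpha p q w f < +oo)%E.

Section hausdorff.
Variables (Phi : H -> R) (Omega : H -> R[i]).

(* The origin y = 0, where the inverse powers take the conventional value 0, is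
   a null set. *)
Definition hausdorff_integrand (f : H -> R[i]) x y : R[i] :=
  (Phi (dil (hnorm y)^-1 x) / hnorm y ^+ hdim n)%:C%C
  * Omega (dil (hnorm y)^-1 y) * f y.

(* meaningful only at the points x where hausdorff_integrand f x is absolutely
   integrable, which hausdorff_bound requires to be almost every x *)
Definition hausdorff (f : H -> R[i]) x : R[i] :=
  cintegral lebesgue_heis setT (hausdorff_integrand f x).

Definition hausdorff_bound (alpha p q : R) (w : H -> R) (C : R) :=
  0 <= C /\
  forall f, herz_space alpha p q w f ->
    [/\ {ae lebesgue_heis, forall x,
          abs_integrable lebesgue_heis setT (hausdorff_integrand f x)},
        herz_space alpha p q w (hausdorff f) &
        (herz_norm alpha p q w (hausdorff f)
          <= C%:E * herz_norm alpha p q w f)%E].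

Definition hausdorff_bounded (alpha p q : R) (w : H -> R) :=
  exists C, hausdorff_bound alpha p q w C.

(* the least bound; hausdorff_bound is empty, and the infimum +oo, if the
   operator is unbounded *)
Definition hausdorff_opnorm (alpha p q : R) (w : H -> R) : \bar R :=
  ereal_inf [set C%:E | C in hausdorff_bound alpha p q w].

End hausdorff.

Definition C3 (alpha q gamma : R) (Phi : H -> R) : \bar R :=
  \int[@lebesgue_measure R]_(t in `]0%R, +oo[)
    (profile Phi t / t `^ (1 - alpha - ((hdim n)%:R + gamma) / q))%:E.

(* 0 `^ gamma is 0 unless gamma = 0; this only affects the origin, a null set *)
Definition power_weight (gamma : R) x : R := hnorm x `^ gamma.

End heisenberg.

(* Main.v *)
Require Import Defs.
From HB Require Import structures.
From mathcomp Require Import all_boot all_order all_algebra.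
From mathcomp Require Import all_classical all_reals all_analysis.
From mathcomp Require Import measurable_realfun.
From mathcomp Require Import complex.
From mathcomp Require Import ring lra zify.

Set Implicit Arguments.
Unset Strict Implicit.

Import Order.TTheory GRing.Theory Num.Theory.
Import numFieldNormedType.Exports.

Local Open Scope classical_set_scope.
Local Open Scope ring_scope.

(** The operator becomes a convolution on the line in the coordinates
    x = delta_{e^s} y', with s real and y' on the unit sphere: dilations turn
    into translations of s, and the shell C_k into an interval J_k of length
    ln 2. Put beta = alpha + (Q + gamma) / q.

    On C_k the factor 2^k and |x|_h agree up to a factor 2. Hence the Herz norm
    of f is comparable, with constants depending on alpha only, to the amalgam
    norm (sum_k (int_(J_k) D)^(p/q))^(1/p) of the radial density
    D(s) = e^(beta q s) int |f(delta_{e^s} y')|^q dy' (herz_sum_amalgam). Let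
    Af be the operator with absolute values inside the integral. It is a radial
    function, and e^(beta s) Af(delta_{e^s} y') is the convolution of
    kappa(s) = Phi(e^s) e^(beta s), whose integral is C_3 (C3_log_kernel), with
    e^(beta t) int |Omega(y')| |f(delta_{e^t} y')| dy' (abs_hausdorff_polar).

    Sufficiency. By Hoelder's inequality on the sphere the latter function is at
    most |Omega|_(q') D(t)^(1/q). It remains that convolution with kappa acts on
    the amalgam space with norm at most a multiple of int kappa
    (amalgam_young). By the inequalities of Minkowski and Jensen
    this reduces to translations, and a translate of J_k is covered
    by two neighbouring intervals.

    Necessity. Let f be conj(Omega) |Omega|^(q'-2) |x|_h^(-beta), which is
    extremal for Hoelder's inequality on each sphere, restricted to the 4M
    shells around the unit sphere. Its radial density is constant there, so its
    norm is a multiple of (4M)^(1/p). On the 2M shells in the middle its image is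
    at least a multiple of |x|_h^(-beta) times the integral of kappa over
    [-M ln 2, M ln 2] (annular_le_abs_hausdorff), so the norm of the image is at
    least a multiple of (2M)^(1/p) times that integral. The ratio of the two
    norms is bounded below independently of M, and M tends to infinity
    (C3_le_of_hausdorff_bound). *)

(** * Jensen's and Minkowski's inequalities *)

(** The graph of the convex function x^p lies above its tangent at c; this is
    Young's inequality for x and c^(p-1). *)
Lemma powR_tangent (R : realType) (p c : R) (x : \bar R) :
  1 <= p -> 0 < c -> (0 <= x)%E ->
  ((p * c `^ (p - 1))%:E * x <= x `^ p + ((p - 1) * c `^ p)%:E)%E.
Proof.
move=> p1 c0 x0; have p0 : 0 < p by exact: lt_le_trans p1.
case: x x0 => [x||//].
  rewrite lee_fin => x0; rewrite poweR_EFin -EFinM -EFinD lee_fin.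
  move: p1; rewrite le_eqVlt => /predU1P[<-|p1].
    by rewrite subrr powRr0 mul0r addr0 powRr1// !mul1r.
  have p10 : 0 < p - 1 by rewrite subr_gt0.
  have pq : p^-1 + (p / (p - 1))^-1 = 1.
    by rewrite invf_div -{1}(mul1r p^-1) -mulrDl addrC subrK divff// gt_eqF.
  have := conjugate_powR x0 (powR_ge0 c (p - 1)) p0 (divr_gt0 p0 p10) pq.
  rewrite -powRrM mulrCA divff ?gt_eqF// mulr1 invf_div.
  move=> le_conj; rewrite -(ler_pM2l p0) in le_conj.
  move: le_conj; have -> : p * (x `^ p / p + c `^ p * ((p - 1) / p)) =
            x `^ p + (p - 1) * c `^ p by field; rewrite gt_eqF.
  by rewrite mulrAC -mulrA.
by move=> _; rewrite poweRyr ?gt_eqF// addye// leey.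
Qed.

(** Jensen's inequality for the measure k dmu of mass at most K: integrate the
    tangent inequality, the tangent being taken at the mean value of a. *)
Lemma weighted_jensen d (T : measurableType d) (R : realType)
    (mu : {measure set T -> \bar R}) (k a : T -> \bar R) (K p : R) :
  1 <= p -> 0 < K ->
  measurable_fun setT k -> (forall t, 0 <= k t)%E ->
  measurable_fun setT a -> (forall t, 0 <= a t)%E ->
  (\int[mu]_t k t <= K%:E)%E ->
  ((\int[mu]_t (k t * a t)) `^ p <=
   (K `^ (p - 1))%:E * \int[mu]_t (k t * a t `^ p))%E.
Proof.
move=> p1 K0 mk k0 ma a0 kK; have p0 : 0 < p by exact: lt_le_trans p1.
have map : measurable_fun setT (fun t => a t `^ p)%E.
  exact: measurableT_comp (measurable_poweR _) ma.
set I := (\int[mu]_t (k t * a t))%E; set J := (\int[mu]_t (k t * a t `^ p))%E.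
have I0 : (0 <= I)%E by apply: integral_ge0 => t _; exact: mule_ge0.
have J0 : (0 <= J)%E.
  by apply: integral_ge0 => t _; rewrite mule_ge0// poweR_ge0.
have tangent (c : R) : 0 < c ->
    ((p * c `^ (p - 1))%:E * I <= J + ((p - 1) * c `^ p)%:E * K%:E)%E.
  move=> c0.
  have pc0 : (0 <= (p * c `^ (p - 1))%:E)%E.
    by rewrite lee_fin mulr_ge0 ?powR_ge0// ltW.
  have pc1 : (0 <= ((p - 1) * c `^ p)%:E)%E.
    by rewrite lee_fin mulr_ge0 ?powR_ge0// subr_ge0.
  rewrite -ge0_integralZl//; last 2 first.
    exact: emeasurable_funM.
    by move=> t _; exact: mule_ge0.
  apply: (@le_trans _ _
      (\int[mu]_t (k t * a t `^ p + ((p - 1) * c `^ p)%:E * k t))%E).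
    apply: ge0_le_integral => //.
    - by move=> t _; rewrite mule_ge0// mule_ge0.
    - by apply: emeasurable_funM => //; exact: emeasurable_funM.
    - apply: emeasurable_funD; first exact: emeasurable_funM.
      exact: emeasurable_funM.
    - move=> t _; rewrite muleCA [X in (_ + X)%E]muleC -ge0_muleDr//.
        by apply: lee_wpmul2l => //; exact: powR_tangent.
      exact: poweR_ge0.
  rewrite ge0_integralD//; last 4 first.
  - by move=> t _; rewrite mule_ge0// poweR_ge0.
  - exact: emeasurable_funM.
  - by move=> t _; rewrite mule_ge0.
  - exact: emeasurable_funM.
  by rewrite leeD2l// ge0_integralZl// lee_wpmul2l.
have K1 : 0 < K `^ (p - 1) by rewrite powR_gt0.
move: J0 tangent; case: J => [j||//] J0 tangent; last first.
  by rewrite gt0_muley ?lte_fin// leey.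
have [i Ii] : exists i, I = i%:E.
  move: I0 tangent; case: I => [i _ _|_ /(_ 1 ltr01)|//]; first by exists i.
  by rewrite powR1 mulr1 gt0_muley ?lte_fin// leNgt ltry.
move: I0 tangent; rewrite Ii lee_fin poweR_EFin -EFinM lee_fin => i0 tangent.
move: i0; rewrite le_eqVlt => /predU1P[<-|i0].
  by rewrite powR0 ?gt_eqF// mulr_ge0// ltW.
(* the tangent at the mean value I / K of a is the optimal one *)
have := tangent _ (divr_gt0 i0 K0).
rewrite -!EFinM -EFinD lee_fin.
have cp : (i / K) `^ (p - 1) * i = (i / K) `^ p * K.
  rewrite -(mulr_powRB1 (ltW (divr_gt0 i0 K0)) p0) mulrAC mulrC.
  by rewrite divfK ?gt_eqF.
rewrite -mulrA cp => le_pj.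
have le_j : (i / K) `^ p * K <= j by lra.
have -> : i `^ p = K `^ (p - 1) * ((i / K) `^ p * K).
  rewrite mulrCA mulrC [_ * K]mulrC (mulr_powRB1 (ltW K0) p0).
  by rewrite -powRM ?divr_ge0 ?(ltW K0) ?(ltW i0)// mulrC divfK ?gt_eqF.
by rewrite ler_pM2l.
Qed.

(** Writing k u as (k h) (u / h), Jensen's inequality for the measure k h of
    mass at most K and Tonelli's theorem leave only the integrals of (u / h)^q
    over the slices, which are at most 1. Minkowski's inequality is the case
    where h is the norm of the slice. *)
Lemma weighted_minkowski d1 d2 (T1 : measurableType d1)
    (T2 : measurableType d2) (R : realType)
    (m1 : {sigma_finite_measure set T1 -> \bar R})
    (m2 : {sigma_finite_measure set T2 -> \bar R})
    (k : T1 -> \bar R) (u : T1 * T2 -> \bar R) (h : T1 -> R) (K q : R) :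
  1 <= q -> 0 < K ->
  measurable_fun setT k -> (forall t, 0 <= k t)%E ->
  measurable_fun setT u -> (forall z, 0 <= u z)%E ->
  measurable_fun setT h -> (forall t, 0 < h t) ->
  (forall t, \int[m2]_s (u (t, s) `^ q) <= (h t `^ q)%:E)%E ->
  (\int[m1]_t (k t * (h t)%:E) <= K%:E)%E ->
  (\int[m2]_s ((\int[m1]_t (k t * u (t, s))) `^ q) <= (K `^ q)%:E)%E.
Proof.
move=> q1 K0 mk k0 mu u0 mh h0 uh khK; have q0 : 0 < q by exact: lt_le_trans q1.
pose w t := (k t * (h t)%:E)%E.
have mhE : measurable_fun setT (EFin \o h) by exact/measurable_EFinP.
have mw : measurable_fun setT w by exact: emeasurable_funM.
have w0 t : (0 <= w t)%E by rewrite mule_ge0// lee_fin ltW.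
have mhV : measurable_fun setT (fun t => ((h t)^-1)%:E).
  apply/measurable_EFinP.
  under eq_fun do rewrite -powR_inv1 ?ltW//.
  exact: (measurableT_comp (measurable_powR _) mh).
pose v (z : T1 * T2) := ((h z.1)^-1%:E * u z)%E.
have mv : measurable_fun setT v.
  apply: emeasurable_funM => //.
  exact: (measurableT_comp mhV measurable_fst).
have v0 z : (0 <= v z)%E by rewrite mule_ge0// lee_fin invr_ge0 ltW.
have wv t s : (w t * v (t, s) = k t * u (t, s))%E.
  rewrite /w /v /= -muleA; congr (_ * _)%E.
  by rewrite muleA -EFinM divff ?gt_eqF// mul1e.
have mvq : measurable_fun setT (fun z => v z `^ q)%E.
  exact: measurableT_comp (measurable_poweR _) mv.
pose F (z : T2 * T1) := (w z.2 * v (z.2, z.1) `^ q)%E.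
have msw : measurable_fun setT (fun z : T2 * T1 => (z.2, z.1)).
  by apply/measurable_fun_pairP; split; [exact: measurable_snd|exact: measurable_fst].
have mF : measurable_fun setT F.
  apply: emeasurable_funM; first exact: (measurableT_comp mw measurable_snd).
  exact: (measurableT_comp mvq msw).
have F0 z : (0 <= F z)%E by rewrite mule_ge0// poweR_ge0.
have mF1 := measurable_fun_fubini_tonelli_F (m2 := m1) F mF F0.
have mu1 : measurable_fun setT (fun s => \int[m1]_t (k t * u (t, s)))%E.
  have mku : measurable_fun setT (fun z : T1 * T2 => k z.1 * u z)%E.
    apply: emeasurable_funM => //; exact: (measurableT_comp mk measurable_fst).
  apply: (measurable_fun_fubini_tonelli_G (m1 := m1) (fun z => k z.1 * u z)%E) => //.
  by move=> z; rewrite mule_ge0.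
apply: (@le_trans _ _
    (\int[m2]_s ((K `^ (q - 1))%:E * \int[m1]_t F (s, t)))%E).
  apply: ge0_le_integral => //.
  - by move=> s _; exact: poweR_ge0.
  - exact: (measurableT_comp (measurable_poweR _) mu1).
  - exact: emeasurable_funM.
  - move=> s _; under eq_integral do rewrite -wv.
    apply: weighted_jensen => //.
    by apply: (measurableT_comp mv) => //; exact: measurable_pair2.
rewrite ge0_integralZl ?lee_fin ?powR_ge0//; last first.
  by move=> s _; apply: integral_ge0 => t _; exact: F0.
rewrite (fubini_tonelli F)//.
apply: (@le_trans _ _ ((K `^ (q - 1))%:E * \int[m1]_t w t)%E); last first.
  apply: (@le_trans _ _ ((K `^ (q - 1))%:E * K%:E)%E).
    by apply: lee_wpmul2l => //; rewrite lee_fin powR_ge0.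
  by rewrite -EFinM mulrC (mulr_powRB1 (ltW K0) q0).
apply: lee_wpmul2l; first by rewrite lee_fin powR_ge0.
apply: ge0_le_integral => //.
- by move=> t _; apply: integral_ge0 => s _; exact: F0.
- exact: (measurable_fun_fubini_tonelli_G (m1 := m2) F mF F0).
move=> t _; rewrite /F /=.
under eq_integral => s _ do
  rewrite /v /= poweRM ?lee_fin ?invr_ge0 ?(ltW (h0 _))// poweR_EFin.
have muq : measurable_fun setT (fun s => u (t, s) `^ q)%E.
  apply: (measurableT_comp (measurable_poweR _)).
  by apply: (measurableT_comp mu) => //; exact: measurable_pair1.
rewrite ge0_integralZl//; last 2 first.
- apply: emeasurable_funM => //.
- by move=> s _; rewrite mule_ge0 ?lee_fin ?powR_ge0 ?poweR_ge0.
rewrite ge0_integralZl ?lee_fin ?powR_ge0//; last first.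
  by move=> s _; exact: poweR_ge0.
rewrite -[leRHS]mule1; apply: lee_wpmul2l => //.
apply: (@le_trans _ _ (((h t)^-1 `^ q)%:E * (h t `^ q)%:E)%E).
  by apply: lee_wpmul2l => //; rewrite lee_fin powR_ge0.
rewrite -EFinM -powRM ?invr_ge0 ?(ltW (h0 t))//.
by rewrite mulVf ?powR1// gt_eqF.
Qed.

Lemma le_poweR (R : realType) (r : R) (x y : \bar R) :
  0 <= r -> (0 <= x)%E -> (x <= y)%E -> (x `^ r <= y `^ r)%E.
Proof.
move=> r0 x0 xy; apply: gt0_ler_poweR => //; rewrite in_itv/= leey andbT//.
exact: le_trans xy.
Qed.

(** The bound M makes the slice norms real numbers, as the weight h of
    weighted_minkowski has to be. *)
Lemma minkowski_integral d1 d2 (T1 : measurableType d1)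
    (T2 : measurableType d2) (R : realType)
    (m1 : {sigma_finite_measure set T1 -> \bar R})
    (m2 : {sigma_finite_measure set T2 -> \bar R})
    (k : T1 -> \bar R) (u : T1 * T2 -> \bar R) (K M q : R) :
  1 <= q -> 0 < K ->
  measurable_fun setT k -> (forall t, 0 <= k t)%E ->
  measurable_fun setT u -> (forall z, 0 <= u z)%E ->
  (\int[m1]_t k t <= K%:E)%E ->
  (forall t, \int[m2]_s (u (t, s) `^ q) <= M%:E)%E ->
  ((\int[m2]_s ((\int[m1]_t (k t * u (t, s))) `^ q)) `^ q^-1 <=
   \int[m1]_t (k t * (\int[m2]_s (u (t, s) `^ q)) `^ q^-1))%E.
Proof.
move=> q1 K0 mk k0 mu u0 kK uM; have q0 : 0 < q by exact: lt_le_trans q1.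
have qV0 : 0 <= q^-1 by rewrite invr_ge0 ltW.
pose a (t : T1) : \bar R := (\int[m2]_s (u (t, s) `^ q))%E.
have a0 t : (0 <= a t)%E by apply: integral_ge0 => s _; exact: poweR_ge0.
have muq : measurable_fun setT (fun z => u z `^ q)%E.
  exact: measurableT_comp (measurable_poweR _) mu.
have uq0 z : (0 <= u z `^ q)%E by exact: poweR_ge0.
have ma : measurable_fun setT a.
  exact: (measurable_fun_fubini_tonelli_F (m2 := m2) _ muq uq0).
have afin t : a t \is a fin_num.
  by rewrite ge0_fin_numE ?a0// (le_lt_trans (uM t))// ltry.
have maq : measurable_fun setT (fun t => a t `^ q^-1)%E.
  exact: measurableT_comp (measurable_poweR _) ma.
set I := (\int[m1]_t (k t * a t `^ q^-1))%E.
have I0 : (0 <= I)%E.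
  by apply: integral_ge0 => t _; rewrite mule_ge0// poweR_ge0.
have Ifin : I \is a fin_num.
  rewrite ge0_fin_numE//.
  apply: (@le_lt_trans _ _ (\int[m1]_t (k t * (M `^ q^-1)%:E))%E).
    apply: ge0_le_integral => //.
    - by move=> t _; rewrite mule_ge0// poweR_ge0.
    - exact: emeasurable_funM.
    - exact: emeasurable_funM.
    - move=> t _; apply: lee_wpmul2l => //.
      by rewrite -poweR_EFin; apply: le_poweR => //; exact: uM.
  rewrite ge0_integralZr// ?lee_fin ?powR_ge0//.
  apply: lte_mul_pinfty; rewrite ?lee_fin ?powR_ge0// ?ltry//.
    exact: integral_ge0.
  rewrite ge0_fin_numE; first by rewrite (le_lt_trans kK)// ltry.
  exact: integral_ge0.
apply/lee_addgt0Pr => e e0.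
rewrite -(fineK Ifin) -EFinD; have fI0 : 0 <= fine I by exact: fine_ge0.
set C := fine I + e; have C0 : 0 < C by rewrite ltr_wpDl.
(* h must not vanish where the slice norm does; the extra e / K costs at most e
   after integration against k *)
have eK0 : 0 < e / K by exact: divr_gt0.
pose h t := fine (a t) `^ q^-1 + e / K.
have mh : measurable_fun setT h.
  apply: measurable_funD => //; apply: (measurableT_comp (measurable_powR _)).
  exact: (measurableT_comp (@fine_measurable R setT measurableT) ma).
have h0 t : 0 < h t by rewrite ltr_wpDl// powR_ge0.
have -> : C%:E = ((C `^ q)%:E `^ q^-1)%E.
  by rewrite poweR_EFin -powRrM divff ?gt_eqF// powRr1// ltW.
apply: le_poweR => //.
  by apply: integral_ge0 => s _; exact: poweR_ge0.
apply: (weighted_minkowski q1 C0 mk k0 mu u0 mh h0) => [t|].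
  rewrite -/(a t) -(fineK (afin t)) lee_fin.
  have fa0 : 0 <= fine (a t) by exact: fine_ge0.
  apply: (@le_trans _ _ ((fine (a t) `^ q^-1) `^ q)).
    by rewrite -powRrM mulVf ?gt_eqF// powRr1.
  apply: ge0_ler_powR; rewrite ?nnegrE ?powR_ge0 ?(ltW q0) ?(ltW (h0 t))//.
  by rewrite /h lerDl ltW.
under eq_integral => t _.
  rewrite /h EFinD ge0_muleDr ?lee_fin ?powR_ge0 ?(ltW eK0)//.
  rewrite -poweR_EFin (fineK (afin t)); over.
rewrite ge0_integralD//; last 4 first.
- by move=> t _; rewrite mule_ge0// poweR_ge0.
- exact: emeasurable_funM.
- by move=> t _; rewrite mule_ge0// lee_fin ltW.
- exact: emeasurable_funM.
rewrite -/I -(fineK Ifin) /C EFinD leeD2l//.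
rewrite ge0_integralZr ?lee_fin ?(ltW eK0)//.
apply: (@le_trans _ _ (K%:E * (e / K)%:E)%E).
  by apply: lee_wpmul2r => //; rewrite lee_fin ltW.
by rewrite -EFinM mulrC divfK ?gt_eqF.
Qed.

(** * Lebesgue measure on the line *)

Local Notation leb := (@lebesgue_R _).

Lemma ge0_integral_mrestr d (T : measurableType d) (R : realType)
    (mu : {measure set T -> \bar R}) (D : set T) (mD : measurable D)
    (f : T -> \bar R) : measurable_fun setT f -> (forall x, 0 <= f x)%E ->
  (\int[mrestr mu mD]_x f x = \int[mu]_(x in D) f x)%E.
Proof.
move=> mf f0; have mDC : measurable (~` D) by exact: measurableC.
have DC0 : mrestr mu mD (~` D) = 0%E by rewrite /mrestr setICl measure0.
rewrite (ge0_negligible_integral mDC measurableT mf _ DC0)// setTD setCK.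
by apply: eq_measure_integral => A mA AD; rewrite /= /mrestr setIidl.
Qed.

(** An integral over D is one over the whole space for a finite measure, so that
    Tonelli's theorem applies to it even if mu is not sigma-finite. *)
Lemma ge0_integral_mfrestr d (T : measurableType d) (R : realType)
    (mu : {measure set T -> \bar R}) (D : set T) (mD : measurable D)
    (Dfin : (mu D < +oo)%E) (f : T -> \bar R) :
  measurable_fun setT f -> (forall x, 0 <= f x)%E ->
  (\int[mfrestr mD Dfin]_x f x = \int[mu]_(x in D) f x)%E.
Proof.
move=> mf f0; rewrite -(ge0_integral_mrestr mu mD mf f0).
exact: eq_measure_integral.
Qed.

Lemma lebesgue_R_itv (R : realType) (i : interval R) :
  lebesgue_R [set` i] = (if i.1 < i.2 then (i.2 : \bar R) - i.1 else 0)%E.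
Proof. exact: lebesgue_measure_itv. Qed.

(** The way changes of variable are proved: a push-forward with the right mass
    on half-open intervals is Lebesgue measure. *)
Lemma lebesgue_R_unique (R : realType) (mu : {measure set R -> \bar R}) :
  (forall a b : R, a < b -> mu `]a, b]%classic = (b - a)%:E) ->
  forall f : R -> \bar R, measurable_fun setT f -> (forall x, 0 <= f x)%E ->
  (\int[leb]_x f x = \int[mu]_x f x)%E.
Proof.
move=> muE f mf f0.
have mid : measurable_fun setT (idfun : R -> measurableTypeR R).
  by move=> _ Y mY; rewrite setTI.
apply: eq_measure_integral => A mA _.
apply: (lebesgue_measure_unique (mu := pushforward mu (idfun : R -> measurableTypeR R))) => // _ [[a b]] _ <-.
rewrite lebesgue_measure_itv/= lte_fin /pushforward preimage_id.
case: ltP => [/muE -> //|ba]; rewrite set_itv_ge ?measure0//.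
by rewrite bnd_simp -leNgt.
Qed.

Lemma integral_reflect (R : realType) (c : R) (f : R -> \bar R) :
  measurable_fun setT f -> (forall x, 0 <= f x)%E ->
  (\int[leb]_x f (c - x)%R = \int[leb]_x f x)%E.
Proof.
move=> mf f0; have mc : measurable_fun setT (fun x : R => c - x).
  exact: measurable_funB.
rewrite [RHS](lebesgue_R_unique (mu := pushforward leb (fun x : R => c - x)))//.
  by rewrite ge0_integral_pushforward.
move=> a b ab; transitivity (leb `[c - b, c - a[%classic).
  congr (lebesgue_R _); apply/seteqP.
  by split => x /=; rewrite !in_itv/= => /andP[? ?]; apply/andP; split; lra.
by rewrite lebesgue_R_itv/= lte_fin ltrD2l ltrN2 ab -EFinD; congr EFin; lra.
Qed.

Lemma integral_translate (R : realType) (c : R) (f : R -> \bar R) :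
  measurable_fun setT f -> (forall x, 0 <= f x)%E ->
  (\int[leb]_x f (x - c)%R = \int[leb]_x f x)%E.
Proof.
move=> mf f0; have mc : measurable_fun setT (fun x : R => x - c).
  exact: measurable_funB.
rewrite -(integral_reflect 0)//; last exact: measurableT_comp mf mc.
under eq_integral do rewrite add0r -opprD addrC opprD.
by rewrite (integral_reflect (- c)).
Qed.

Section logarithmic_substitution.
Context {R : realType}.

(** The region below the graph of 1/x over the positive reals: integrating a
    function of the first coordinate over it is integrating against dx/x. *)
Let subgraph : set (R * R) :=
  [set z | [&& 0 < z.1, 0 < z.2 & z.2 * z.1 < 1]].

Let measurable_subgraph : measurable subgraph.
Proof.
have m0 : measurable_fun setT (fun z : R * R => [&& 0 < z.1, 0 < z.2 & z.2 * z.1 < 1]).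
  by repeat apply: measurable_and; apply: measurable_fun_ltr => //;
    apply: measurable_funM.
by rewrite -[subgraph]setTI; exact: m0.
Qed.

Let integral_subgraph (v : R -> \bar R) :
  measurable_fun setT v -> (forall x, 0 <= v x)%E ->
  (\int[leb \x leb]_(z in subgraph) v z.1 =
   \int[leb]_(x in `]0%R, +oo[) (v x * (x^-1)%:E))%E.
Proof.
move=> mv v0.
have mvp : measurable_fun setT ((v \o fst) \_ subgraph).
  apply/(measurable_restrictT _ measurable_subgraph)/measurable_funTS.
  exact: (measurableT_comp mv measurable_fst).
rewrite integral_mkcond (fubini_tonelli1 ((v \o fst) \_ subgraph)) //; last first.
  by move=> z; rewrite patchE; case: ifP => //= _; exact: v0.
rewrite [RHS]integral_mkcond; apply: eq_integral => x _.
rewrite /fubini_F [RHS]patchE; case: ifPn => [|]; rewrite ?notin_setE ?inE/= in_itv/= andbT.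
  move=> x0; transitivity (\int[leb]_y ((v x * (\1_`]0%R, x^-1[ y)%:E)))%E.
    apply: eq_integral => y _; rewrite patchE indicE /subgraph; case: ifPn => [|].
      rewrite inE/= => /and3P[_ y0 yx]; rewrite mem_set ?mule1//=.
      by rewrite in_itv/= y0/= -[X in _ < X]mul1r ltr_pdivlMr.
    rewrite notin_setE/= x0/= => yx; rewrite memNset ?mule0//= => /=.
    rewrite in_itv/= => /andP[y0 yx']; apply: yx; rewrite y0/=.
    by rewrite -ltr_pdivlMr// mul1r.
  rewrite ge0_integralZl//; last exact/measurable_EFinP.
  congr (_ * _)%E; rewrite integral_indic// setIT.
  apply: etrans (lebesgue_R_itv `]0, x^-1[) _.
  by rewrite /= lte_fin invr_gt0 x0 oppr0 adde0.
move=> x0; rewrite integral0_eq// => y _; rewrite patchE memNset//.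
by rewrite /subgraph/= => /and3P[].
Qed.

(** Substitution r = e^s. With dx/x presented as an area below 1/x, it says that
    the push-forward of this area by ln is Lebesgue measure, that is, that
    ln is a primitive of 1/x. *)
Lemma integral_expR (u : R -> \bar R) :
  measurable_fun setT u -> (forall x, 0 <= u x)%E ->
  (\int[@lebesgue_measure R]_(r in `]0%R, +oo[) u r =
   \int[leb]_s (u (expR s) * (expR s)%:E))%E.
Proof.
move=> mu u0; pose w s := (u (expR s) * (expR s)%:E)%E.
have mw : measurable_fun setT w.
  apply: emeasurable_funM; last by apply/measurable_EFinP; exact: measurable_expR.
  exact: (measurableT_comp mu (@measurable_expR R)).
have w0 s : (0 <= w s)%E by rewrite mule_ge0// lee_fin expR_ge0.
have mln : measurable_fun setT (fun z : R * R => ln z.1).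
  exact: (measurableT_comp (@measurable_ln R) measurable_fst).
pose tau := pushforward (mrestr (leb \x leb)%E measurable_subgraph) (fun z : R * R => ln z.1).
rewrite [RHS](lebesgue_R_unique (mu := tau)) => //.
  transitivity (\int[leb \x leb]_(z in subgraph) w (ln z.1))%E; last first.
    have mwln : measurable_fun setT (w \o (fun z : R * R => ln z.1)).
      exact: (measurableT_comp mw mln).
    have wln0 z : (0 <= (w \o (fun z : R * R => ln z.1)) z)%E by exact: w0.
    rewrite -(ge0_integral_mrestr _ measurable_subgraph mwln wln0).
    by rewrite (ge0_integral_pushforward mln _ measurableT mw).
  rewrite (@integral_subgraph (fun x => w (ln x)))//; last first.
    exact: (measurableT_comp mw (@measurable_ln R)).
  rewrite -ge0_integral_lebesgue_R//; last exact: measurable_funTS.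
  apply: eq_integral => x; rewrite inE/= in_itv/= andbT => x0.
  by rewrite /w lnK// -muleA -EFinM divff ?gt_eqF// mule1.
move=> a b ab.
set D := @ln R @^-1` `]a, b]%classic.
have mD : measurable D.
  by rewrite /D -[X in measurable X]setTI; exact: measurable_ln.
transitivity (\int[leb \x leb]_(z in subgraph) (\1_D z.1)%:E)%E.
  have mfD : measurable ((fst : R * R -> R) @^-1` D).
    by rewrite -[X in measurable X]setTI; exact: measurable_fst.
  have := integral_indic (lebesgue_R \x lebesgue_R)%E measurable_subgraph mfD.
  by move=> /esym; exact.
rewrite (@integral_subgraph (EFin \o \1_D)) => [||x]; last 2 first.
- exact/measurable_EFinP.
- by rewrite /= lee_fin.
have eab : expR a < expR b by rewrite ltr_expR.
have mV : measurable_fun `]expR a, expR b] (fun x : R => (x^-1)%:E).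
  apply/measurable_EFinP; apply: (eq_measurable_fun (fun x : R => x `^ (-1))).
    move=> x; rewrite inE/= in_itv/= => /andP[ax _].
    by rewrite powR_inv1// ltW// (lt_trans (expR_gt0 _) ax).
  by apply: measurable_funTS; exact: measurable_powR.
transitivity (\int[leb]_(x in `]expR a, expR b]) (x^-1)%:E)%E.
  rewrite integral_mkcond [RHS]integral_mkcond; apply: eq_integral => x _.
  rewrite !patchE; case: ifPn; rewrite ?inE ?notin_setE/= in_itv/= andbT => x0.
    rewrite indicE; case: ifPn; rewrite ?inE ?notin_setE/= in_itv/= => xab.
      rewrite mem_set ?mul1e// /D/= in_itv/=.
      by move: xab; rewrite -{1 2}(@lnK _ x)// ltr_expR ler_expR.
    rewrite memNset ?mul0e// /D/= in_itv/=.
    by rewrite -ltr_expR -(ler_expR _ b) lnK.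
  case: ifPn => //; rewrite inE/= in_itv/= => /andP[ax _].
  by exfalso; apply: x0; rewrite (lt_trans (expR_gt0 _) ax).
rewrite ge0_integral_lebesgue_R//; last first.
  move=> x /=; rewrite in_itv/= lee_fin invr_ge0 => /andP[ax _].
  by rewrite ltW// (lt_trans (expR_gt0 _) ax).
rewrite integral_itv_obnd_cbnd//.
have pos x : x \in `[expR a, expR b] -> 0 < x.
  by rewrite in_itv/= => /andP[ax _]; rewrite (lt_le_trans (expR_gt0 _) ax).
rewrite (@continuous_FTC2 _ GRing.inv (@ln R))//.
- by rewrite !expRK.
- apply: continuous_in_subspaceT => x; rewrite inE/= => /pos x0.
  by apply: inv_continuous; rewrite gt_eqF.
- split.
  + move=> x /subset_itv_oo_cc/pos x0.
    by have [] := is_derive1_ln x0.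
  + by apply: cvg_at_right_filter; apply: continuous_ln; exact: expR_gt0.
  + by apply: cvg_at_left_filter; apply: continuous_ln; exact: expR_gt0.
- move=> x /subset_itv_oo_cc/pos x0; rewrite derive1E.
  by have [_ ->] := is_derive1_ln x0.
Qed.

End logarithmic_substitution.

(** * Amalgam norms on the line *)

Section esum_facts.
Context {R : realType}.

Lemma esumZl (T : choiceType) (a : T -> \bar R) (c : R) :
  0 <= c -> (forall i, 0 <= a i)%E ->
  (\esum_(i in [set: T]) (c%:E * a i) = c%:E * \esum_(i in [set: T]) a i)%E.
Proof.
move=> c0 a0; rewrite /esum -ereal_supZl//; last first.
  by apply/set0P; exists (\sum_(i \in set0) a i)%E, set0 => //; exact: fsets_set0.
rewrite image_comp; congr ereal_sup; apply: eq_imagel => A _ /=.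
by rewrite ge0_mule_fsumr.
Qed.

(** The exponent p / q can be on either side of 1, whence a constant that serves
    for both. *)
Lemma poweRD_le (x y : \bar R) (r : R) : 0 < r ->
  (0 <= x)%E -> (0 <= y)%E ->
  ((x + y) `^ r <= (2 `^ r)%:E * (x `^ r + y `^ r))%E.
Proof.
move=> r0; wlog xy : x y / (x <= y)%E.
  move=> H x0 y0; have [xy|yx] := leP x y; first exact: H.
  by rewrite addeC [X in (_ * X)%E]addeC; apply: H => //; exact: ltW.
move=> x0 y0; apply: (@le_trans _ _ ((2%:E * y) `^ r)%E).
  apply: le_poweR; [exact: ltW|exact: adde_ge0|].
  by rewrite mule_natl mule2n leeD2r.
rewrite poweRM// poweR_EFin lee_wpmul2l ?lee_fin ?powR_ge0//.
by rewrite leeDr// poweR_ge0.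
Qed.
End esum_facts.

Section amalgam.
Context {R : realType}.

(** The shell C_k in the coordinate ln |x|. *)
Definition log_shell (k : int) : set R := `](k%:~R - 1) * ln 2, k%:~R * ln 2]%classic.

Lemma ln2_gt0 : 0 < ln 2 :> R.
Proof. by apply: ln_gt0; rewrite ltr1n. Qed.

Lemma measurable_log_shell k : measurable (log_shell k).
Proof. exact: measurable_itv. Qed.

Lemma lebesgue_log_shell k : lebesgue_R (log_shell k) = (ln 2)%:E.
Proof.
have L0 := ln2_gt0; rewrite /log_shell lebesgue_R_itv/= lte_fin.
by rewrite ltr_pM2r// ltrBlDr ltrDl ltr01 -EFinD; congr EFin; lra.
Qed.

Local Notation L := (ln 2 : R).

(** All the intervals have length ln 2, so a translate of one of them is covered
    by two consecutive ones. *)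
Lemma log_shell_translate (g : R -> \bar R) (k m : int) (t : R) :
  measurable_fun setT g -> (forall s, 0 <= g s)%E ->
  m%:~R * L <= t -> t < (m%:~R + 1) * L ->
  (\int[leb]_(s in log_shell k) g (s - t)%R <=
   \int[leb]_(s in log_shell (k - (m + 1))) g s +
   \int[leb]_(s in log_shell (k - m)) g s)%E.
Proof.
move=> mg g0 mt tm; have L0 := ln2_gt0.
have mS := measurable_log_shell.
rewrite (integral_mkcond (log_shell k)).
have mU : measurable (log_shell (k - (m + 1)) `|` log_shell (k - m)).
  exact: measurableU.
pose f : R -> \bar R := g \_ (log_shell (k - (m + 1)) `|` log_shell (k - m)).
have mf : measurable_fun setT f.
  exact/(measurable_restrictT _ mU)/measurable_funTS.
have f0 s : (0 <= f s)%E by rewrite /f patchE; case: ifP.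
have mft : measurable_fun setT (fun s : R => f (s - t)).
  by apply: (measurableT_comp mf); exact: measurable_funB.
apply: (@le_trans _ _ (\int[leb]_s f (s - t)%R)%E).
  apply: ge0_le_integral => //.
  - by move=> s _; rewrite patchE; case: ifP.
  - apply/(measurable_restrictT _ (mS k))/measurable_funTS.
    by apply: (measurableT_comp mg); exact: measurable_funB.
  move=> s _; rewrite patchE; case: ifPn => // sk.
  rewrite /f patchE mem_set//; move: sk; rewrite inE /log_shell/= !in_itv/=.
  move=> /andP[ks sk]; rewrite !intrB intrD.
  have [h|h] := leP (s - t) ((k%:~R - (m%:~R + 1)) * L); [left|right].
    by apply/andP; split; lra.
  by apply/andP; split; lra.
rewrite integral_translate// -integral_mkcond ge0_integral_setU//.
- exact: measurable_funTS.
- apply/disj_setPS => s; rewrite /log_shell/= !in_itv/=.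
  move=> [/andP[_ h1] /andP[h2 _]]; move: h1 h2; rewrite !intrB intrD.
  by move=> h1 h2; lra.
Qed.

(** Each interval is used twice to cover translates, whence the factor 2; the
    factor 2^r comes from the power of a sum of two integrals. *)
Lemma amalgam_translate (g : R -> \bar R) (r t : R) : 0 < r ->
  measurable_fun setT g -> (forall s, 0 <= g s)%E ->
  (\esum_(k in [set: int]) ((\int[leb]_(s in log_shell k) g (s - t)%R) `^ r) <=
   (2 * 2 `^ r)%:E *
   \esum_(k in [set: int]) ((\int[leb]_(s in log_shell k) g s) `^ r))%E.
Proof.
move=> r0 mg g0; have L0 := ln2_gt0.
have c0 : 0 < 2 `^ r :> R by rewrite powR_gt0.
pose b (k : int) : \bar R := (\int[leb]_(s in log_shell k) g s)%E.
have b0 k : (0 <= b k)%E by apply: integral_ge0.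
have br0 k : (0 <= b k `^ r)%E by exact: poweR_ge0.
have shift (j : int) : (\esum_(k in [set: int]) (b (k - j)%R `^ r) =
    \esum_(k in [set: int]) (b k `^ r))%E.
  rewrite [RHS](@reindex_esum _ _ _ [set: int] _ (fun k => k - j))//.
  by rewrite setTT_bijective; exists (fun k => k + j) => k; rewrite ?subrK ?addrK.
pose m := Num.floor (t / L).
have mt : m%:~R * L <= t by rewrite -ler_pdivlMr// floor_le.
have tm : t < (m%:~R + 1) * L.
  by rewrite -ltr_pdivrMr// -(intrD _ m 1) floorD1_gt.
apply: (@le_trans _ _ (\esum_(k in [set: int])
    ((2 `^ r)%:E * (b (k - (m + 1))%R `^ r + b (k - m)%R `^ r)))%E).
  apply: le_esum => k _; apply: le_trans; last exact: poweRD_le.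
  apply: le_poweR; [exact: ltW|by apply: integral_ge0|].
  exact: log_shell_translate.
rewrite esumZl; [|exact: ltW|by move=> k; exact: adde_ge0].
rewrite esumD => [|k _|k _]; [|exact: br0|exact: br0].
rewrite (shift (m + 1)) (shift m) -/b mulrC EFinM -muleA.
apply: lee_wpmul2l; first by rewrite lee_fin ltW.
by rewrite mule_natl mule2n.
Qed.

Lemma measurable_convolution (kappa g : R -> \bar R) :
  measurable_fun setT kappa -> (forall t, 0 <= kappa t)%E ->
  measurable_fun setT g -> (forall s, 0 <= g s)%E ->
  measurable_fun setT (fun s : R => \int[leb]_t (kappa t * g (s - t)%R))%E.
Proof.
move=> mk k0 mg g0.
have := @measurable_fun_fubini_tonelli_G _ _ _ _ _ leb
  (fun z : R * R => kappa z.1 * g (z.2 - z.1)%R)%E.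
apply; last by move=> z; exact: mule_ge0.
apply: emeasurable_funM; first exact: (measurableT_comp mk measurable_fst).
apply: (measurableT_comp mg).
by apply: measurable_funB; [exact: measurable_snd|exact: measurable_fst].
Qed.

(** Young's inequality with an integrable kernel. On each interval Minkowski's
    inequality bounds the L^q norm of the convolution by the mean, for the
    measure kappa, of the norms of the translates of g; Jensen's
    inequality moves the power p inside the mean, and the sum over the intervals
    is then the amalgam norm of a translate. *)
Lemma amalgam_young (kappa g : R -> \bar R) (K p q : R) :
  1 <= p -> 1 <= q -> 0 < K ->
  measurable_fun setT kappa -> (forall t, 0 <= kappa t)%E ->
  measurable_fun setT g -> (forall s, 0 <= g s)%E ->
  (\int[leb]_t kappa t <= K%:E)%E ->
  (\esum_(k in [set: int])
     ((\int[leb]_(s in log_shell k)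
         ((\int[leb]_t (kappa t * g (s - t)%R)) `^ q)) `^ (p / q)) <=
   (2 * 2 `^ (p / q) * K `^ p)%:E *
   \esum_(k in [set: int])
     ((\int[leb]_(s in log_shell k) (g s `^ q)) `^ (p / q)))%E.
Proof.
move=> p1 q1 K0 mk k0 mg g0 kK.
have p0 : 0 < p by exact: lt_le_trans p1.
have q0 : 0 < q by exact: lt_le_trans q1.
have pq0 : 0 < p / q by exact: divr_gt0.
have c0 : 0 < 2 * 2 `^ (p / q) :> R by rewrite mulr_gt0// powR_gt0.
have Kp0 : 0 < K `^ p by rewrite powR_gt0.
have mgq : measurable_fun setT (fun s => g s `^ q)%E.
  exact: measurableT_comp (measurable_poweR _) mg.
have gq0 s : (0 <= g s `^ q)%E by exact: poweR_ge0.
pose W := (\esum_(k in [set: int])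
  ((\int[leb]_(s in log_shell k) (g s `^ q)) `^ (p / q)))%E; rewrite -/W.
have W0 : (0 <= W)%E by apply: esum_ge0 => k _; exact: poweR_ge0.
have [Wy|Wfin] := eqVneq W +oo%E.
  by rewrite Wy gt0_muley ?leey// lte_fin mulr_gt0.
have [w We] : exists w, W = w%:E.
  by case: W W0 Wfin => [w|//|//] _ _; exists w.
have w0 : 0 <= w by rewrite -lee_fin -We.
pose a (k : int) (t : R) : \bar R := (\int[leb]_(s in log_shell k) (g (s - t)%R `^ q))%E.
have a0 k t : (0 <= a k t)%E by apply: integral_ge0.
pose w' := 2 * 2 `^ (p / q) * w.
have w'0 : 0 <= w' by rewrite mulr_ge0// ltW.
have suma t : (\esum_(k in [set: int]) (a k t `^ (p / q)) <= w'%:E)%E.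
  by rewrite /w' EFinM -We; exact: (@amalgam_translate (fun s => g s `^ q)%E).
have aw k t : (a k t `^ (p / q) <= w'%:E)%E.
  apply: le_trans (suma t); apply: esum_ge; exists [set k].
    by split => //; exact: finite_set1.
  by rewrite fsbig_set1.
(* Minkowski's inequality asks for slices of uniformly bounded norm *)
have aM k t : (a k t <= (w' `^ (q / p))%:E)%E.
  have -> : a k t = ((a k t `^ (p / q)) `^ (q / p))%E.
    by rewrite -poweRrM mulrA divfK ?gt_eqF// divff ?gt_eqF// poweRe1.
  rewrite -poweR_EFin; apply: le_poweR => //; last exact: poweR_ge0.
  by rewrite divr_ge0 ?(ltW p0) ?(ltW q0).
pose u (z : R * R) : \bar R := g (z.2 - z.1).
have mu : measurable_fun setT u.
  apply: (measurableT_comp mg).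
  by apply: measurable_funB; [exact: measurable_snd|exact: measurable_fst].
have muq : measurable_fun setT (fun z => u z `^ q)%E.
  exact: measurableT_comp (measurable_poweR _) mu.
have mgt t : measurable_fun setT (fun s : R => g (s - t)%R `^ q)%E.
  by apply: (measurableT_comp mgq); exact: measurable_funB.
pose A (s : R) : \bar R := (\int[leb]_t (kappa t * g (s - t)%R))%E.
have mA : measurable_fun setT A by exact: measurable_convolution.
have A0 s : (0 <= A s)%E by apply: integral_ge0 => t _; rewrite mule_ge0.
have mAq : measurable_fun setT (fun s => A s `^ q)%E.
  exact: measurableT_comp (measurable_poweR _) mA.
have Aq0 s : (0 <= A s `^ q)%E by exact: poweR_ge0.
have ma k : measurable_fun setT (a k).
  have mS := measurable_log_shell k.
  have Sfin : (lebesgue_R (log_shell k) < +oo)%E.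
    by rewrite lebesgue_log_shell ltry.
  apply: (eq_measurable_fun (fun t => \int[mfrestr mS Sfin]_s (u (t, s) `^ q))%E).
    by move=> t _; rewrite (ge0_integral_mfrestr mS Sfin (mgt t) (fun s => gq0 _)).
  have := @measurable_fun_fubini_tonelli_F _ _ _ _ _ (mfrestr mS Sfin) (fun z => u z `^ q)%E muq.
  by apply => z; exact: poweR_ge0.
have map k : measurable_fun setT (fun t => a k t `^ (p / q))%E.
  exact: measurableT_comp (measurable_poweR _) (ma k).
have shell k : ((\int[leb]_(s in log_shell k) (A s `^ q)) `^ (p / q) <=
    (K `^ (p - 1))%:E * \int[leb]_t (kappa t * a k t `^ (p / q)))%E.
  have mS := measurable_log_shell k.
  have Sfin : (lebesgue_R (log_shell k) < +oo)%E.
    by rewrite lebesgue_log_shell ltry.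
  have aE t : (\int[mfrestr mS Sfin]_s (u (t, s) `^ q) = a k t)%E.
    by rewrite (ge0_integral_mfrestr mS Sfin (mgt t) (fun s => gq0 _)).
  have uM t : (\int[mfrestr mS Sfin]_s (u (t, s) `^ q) <= (w' `^ (q / p))%:E)%E.
    by rewrite aE.
  have u0 z : (0 <= u z)%E by exact: g0.
  have mink : ((\int[leb]_(s in log_shell k) (A s `^ q)) `^ q^-1 <=
      \int[leb]_t (kappa t * a k t `^ q^-1))%E.
    rewrite -(ge0_integral_mfrestr mS Sfin mAq)//.
    apply: le_trans (minkowski_integral q1 K0 mk k0 mu u0 kK uM) _.
    rewrite le_eqVlt; apply/orP; left; apply/eqP/eq_integral => t _.
    by congr (_ * _ `^ _)%E; exact: aE.
  have q1p : q^-1 * p = p / q by rewrite mulrC.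
  rewrite -q1p poweRrM; apply: le_trans (le_poweR (ltW p0) (poweR_ge0 _ _) mink) _.
  under [in leRHS]eq_integral do rewrite poweRrM.
  apply: weighted_jensen => // [|t]; last exact: poweR_ge0.
  exact: measurableT_comp (measurable_poweR _) (ma k).
apply: ge_ereal_sup => _ [X [finX _] <-].
apply: (@le_trans _ _
    (\sum_(k \in X) ((K `^ (p - 1))%:E * \int[leb]_t (kappa t * a k t `^ (p / q))))%E).
  by apply: lee_fsum => // k _; exact: shell.
have mka k : measurable_fun setT (fun t => kappa t * a k t `^ (p / q))%E.
  exact: emeasurable_funM.
have ka0 k t : (0 <= kappa t * a k t `^ (p / q))%E.
  by rewrite mule_ge0// poweR_ge0.
rewrite -ge0_mule_fsumr; last by move=> k; apply: integral_ge0.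
rewrite -ge0_integral_fsum//.
apply: (@le_trans _ _ ((K `^ (p - 1))%:E * \int[leb]_t (kappa t * w'%:E))%E).
  apply: lee_wpmul2l; first by rewrite lee_fin powR_ge0.
  apply: ge0_le_integral => //.
  - by move=> t _; apply: fsume_ge0.
  - exact: emeasurable_fun_fsum.
  - exact: emeasurable_funM.
  move=> t _; rewrite -ge0_mule_fsumr; last by move=> k; exact: poweR_ge0.
  apply: lee_wpmul2l => //; apply: le_trans (suma t).
  by apply: esum_ge; exists X.
rewrite ge0_integralZr ?lee_fin//.
apply: (@le_trans _ _ ((K `^ (p - 1))%:E * (K%:E * w'%:E))%E).
  apply: lee_wpmul2l; first by rewrite lee_fin powR_ge0.
  by apply: lee_wpmul2r => //; rewrite lee_fin.
rewrite We -!EFinM lee_fin -(mulr_powRB1 (ltW K0) p0) /w'.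
by rewrite le_eqVlt; apply/orP; left; apply/eqP; ring.
Qed.

End amalgam.

(** * The norm and the dilations of the Heisenberg group *)

Section heisenberg_geometry.
Context {R : realType} {n : nat}.
Local Notation H := (heis R n).
Local Notation Leb := (@lebesgue_heis R n).

(** The polynomial |x|^4. *)
Definition hnorm4 (x : H) : R := (\sum_(i < 2 * n) x.1 ord0 i ^+ 2) ^+ 2 + x.2 ^+ 2.

Lemma hnormE (x : H) : hnorm x = hnorm4 x `^ 4^-1. Proof. by []. Qed.

Lemma hnorm4_ge0 (x : H) : 0 <= hnorm4 x.
Proof. by rewrite addr_ge0 ?sqr_ge0. Qed.

Lemma hnorm_ge0 (x : H) : 0 <= hnorm x.
Proof. exact: powR_ge0. Qed.

Lemma hnorm_pow4 (x : H) : hnorm x ^+ 4 = hnorm4 x.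
Proof.
by rewrite hnormE -powR_mulrn ?powR_ge0// -powRrM mulVf// powRr1// hnorm4_ge0.
Qed.

Lemma hnorm_dil (r : R) (x : H) : 0 <= r -> hnorm (dil r x) = r * hnorm x.
Proof.
move=> r0; rewrite !hnormE.
have -> : hnorm4 (dil r x) = r ^+ 4 * hnorm4 x.
  rewrite /hnorm4 /dil /=.
  under eq_bigr do rewrite mxE exprMn.
  by rewrite -mulr_sumr; ring.
rewrite powRM ?exprn_ge0 ?hnorm4_ge0// -powR_mulrn// -powRrM mulfV//.
by rewrite powRr1.
Qed.

Lemma dilM (r s : R) (x : H) : dil r (dil s x) = dil (r * s) x.
Proof. by rewrite /dil /= scalerA mulrA exprMn. Qed.

Lemma dil1 (x : H) : dil 1 x = x.
Proof. by case: x => x1 x2; rewrite /dil /= scale1r expr1n mul1r. Qed.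

Lemma hnorm_eq0 (x : H) : hnorm x = 0 -> x = 0.
Proof.
move=> x0; have := hnorm_pow4 x; rewrite x0 expr0n /= => /esym/eqP.
rewrite /hnorm4 paddr_eq0 ?sqr_ge0// !sqrf_eq0 psumr_eq0 => [|i _]; last exact: sqr_ge0.
case: x {x0} => x1 x2 /= /andP[/allP x10 /eqP ->]; congr pair.
by apply/rowP => i; rewrite mxE; have := x10 i; rewrite mem_index_enum sqrf_eq0 => /(_ isT)/eqP.
Qed.

Lemma hnorm_gt0 (x : H) : x != 0 -> 0 < hnorm x.
Proof.
move=> x0; rewrite lt_neqAle hnorm_ge0 andbT eq_sym.
by apply/eqP => /hnorm_eq0/eqP; rewrite (negbTE x0).
Qed.

Lemma hnorm0 : hnorm (0 : H) = 0.
Proof.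
rewrite hnormE /hnorm4 big1 => [|i _]; last by rewrite mxE expr0n.
by rewrite expr0n addr0 powR0// invr_neq0.
Qed.

Lemma measurable_coord1 (i : 'I_(2 * n)) :
  measurable_fun setT (fun x : H => x.1 ord0 i).
Proof. exact: (measurableT_comp (@measurable_coord _ _ _ i) measurable_fst). Qed.

Lemma measurable_hnorm : measurable_fun setT (@hnorm R n).
Proof.
apply: (measurableT_comp (measurable_powR _)); apply: measurable_funD.
  apply: measurable_funX; apply: measurable_sum => i.
  by apply: measurable_funX; exact: measurable_coord1.
by apply: measurable_funX; exact: measurable_snd.
Qed.

Lemma measurable_dil : measurable_fun setT (fun z : R * H => dil z.1 z.2).
Proof.
apply/measurable_fun_pairP; split => /=.
  apply/measurable_fun_rVP => i; under eq_fun do rewrite mxE.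
  apply: measurable_funM; first exact: measurable_fst.
  exact: (measurableT_comp (measurable_coord1 i) measurable_snd).
apply: measurable_funM; first by apply: measurable_funX; exact: measurable_fst.
exact: (measurableT_comp measurable_snd measurable_snd).
Qed.

Lemma measurable_dilr (r : R) : measurable_fun setT (dil r : H -> H).
Proof. exact: (measurableT_comp measurable_dil (@measurable_pair1 _ _ _ _ r)). Qed.

Lemma measurable_hsphere : measurable (@hsphere R n).
Proof.
have -> : @hsphere R n = setT `&` (@hnorm R n) @^-1` [set 1].
  by rewrite setTI; apply/seteqP; split.
exact: measurable_hnorm.
Qed.

Lemma measurable_hshell k : measurable (@hshell R n k).
Proof.
have -> : @hshell R n k = setT `&` (@hnorm R n) @^-1` `]2 ^ (k - 1), 2 ^ k].
  rewrite setTI; apply/seteqP; split=> x; rewrite /hshell /hball /= in_itv /=.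
    by move=> [-> /negP]; rewrite -ltNge => ->.
  by move=> /andP[h ->]; split => //; apply/negP; rewrite -ltNge.
exact: measurable_hnorm.
Qed.

Lemma measurable_heis1 (x : H) : measurable [set x].
Proof.
have -> : [set x] = setT `&` ((fun y : H => hnorm (y.1 - x.1, y.2 - x.2)) @^-1` [set 0]).
  rewrite setTI; apply/seteqP; split => y /=.
    by move=> ->; rewrite !subrr hnorm0.
  move=> /hnorm_eq0 [] /eqP; rewrite subr_eq0 => /eqP y1 /eqP.
  by rewrite subr_eq0 => /eqP y2; rewrite (surjective_pairing y) y1 y2 -surjective_pairing.
have m : measurable_fun setT (fun y : H => hnorm (y.1 - x.1, y.2 - x.2)).
  apply: (measurableT_comp measurable_hnorm); apply/measurable_fun_pairP; split => /=.
    apply/measurable_fun_rVP => i; under eq_fun do rewrite !mxE.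
    by apply: measurable_funB => //; exact: measurable_coord1.
  by apply: measurable_funB => //; exact: measurable_snd.
exact: m.
Qed.

Lemma continuous_hnorm4 : continuous (hnorm4 : H -> R).
Proof.
have sqr (f : H -> R) : continuous f -> continuous (fun x => f x ^+ 2).
  by move=> cf x; under eq_fun do rewrite expr2; exact: continuousM (cf x) (cf x).
have coord i : continuous (fun x : H => x.1 ord0 i).
  move=> x; apply: (@continuous_comp _ _ _ fst (fun y : 'rV[R]_(2 * n) => y ord0 i)).
    exact: cvg_fst.
  exact: coord_continuous.
have csum : continuous (fun x : H => \sum_(i < 2 * n) x.1 ord0 i ^+ 2).
  elim: (index_enum _) => [|i s IH] x.
    by under eq_fun do rewrite big_nil; exact: cvg_cst.
  under eq_fun do rewrite big_cons.
  exact: (cvgD (sqr _ (coord i) x) (IH x)).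
have csnd : continuous (fun x : H => x.2) by move=> x; exact: cvg_snd.
by move=> x; exact: (cvgD (sqr _ csum x) (sqr _ csnd x)).
Qed.

Lemma compact_hnorm_bounds (K : set H) : compact K -> ~ K 0 ->
  exists m : nat, forall x, K x -> 2 ^ (- m%:Z) < hnorm x <= 2 ^ m%:Z.
Proof.
move=> cK K0; have [->|/set0P Kne] := eqVneq K set0; first by exists 0%N.
have cw : {within K, continuous (hnorm4 : H -> R)}.
  exact/continuous_subspaceT/continuous_hnorm4.
have [y yK ymax] := compact_EVT_max Kne cK cw.
have [z zK zmin] := compact_EVT_min Kne cK cw.
have z0 : 0 < hnorm4 z.
  rewrite -hnorm_pow4 exprn_gt0// hnorm_gt0//; apply/eqP => z0.
  by move: zK; rewrite inE z0.
(* 2^m exceeds both the maximum of |x|^4 and the inverse of its minimum on K *)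
pose m := (Num.bound (hnorm4 y) + Num.bound (hnorm4 z)^-1)%N.
have lt2m k : k%:R < 2 ^+ k :> R by rewrite -natrX ltr_nat ltn_expl.
have ym : hnorm4 y < 2 ^+ m.
  apply: lt_trans (archi_boundP (hnorm4_ge0 y)) (le_lt_trans _ (lt2m m)).
  by rewrite ler_nat leq_addr.
have zm : (hnorm4 z)^-1 < 2 ^+ m.
  have zV0 : 0 <= (hnorm4 z)^-1 by rewrite invr_ge0 ltW.
  apply: lt_trans (archi_boundP zV0) (le_lt_trans _ (lt2m m)).
  by rewrite ler_nat leq_addl.
have m0 : (0 < m)%N.
  by rewrite -(ltr_nat R) (le_lt_trans (hnorm4_ge0 y))// (lt_le_trans (archi_boundP (hnorm4_ge0 y)))// ler_nat leq_addr.
(* since 2^m > 1, the bounds on |x|^4 imply the same bounds on |x| *)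
have pm1 : 1 < 2 ^+ m :> R by rewrite exprn_egt1 ?ltr1n// -lt0n.
exists m => x Kx; have x0 := hnorm_ge0 x.
have xy : hnorm x ^+ 4 <= hnorm4 y by rewrite hnorm_pow4 ymax// inE.
have zx : hnorm4 z <= hnorm x ^+ 4 by rewrite hnorm_pow4 zmin// inE.
rewrite -exprnP -exprnN; apply/andP; split.
  rewrite -[ltRHS]invrK ltf_pV2 ?posrE ?invr_gt0 ?exprn_gt0//; last first.
    rewrite lt_neqAle x0 andbT eq_sym; apply/eqP => x00.
    by move: zx; rewrite x00 expr0n/= leNgt z0.
  have [x1|x1] := leP 1 (hnorm x).
    by rewrite (le_lt_trans _ pm1)// invf_le1// (lt_le_trans _ x1).
  apply: le_lt_trans zm; rewrite lef_pV2 ?posrE//.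
    apply: le_trans zx _; rewrite -[leRHS]expr1.
    by apply: ler_wiXn2l => //; exact: ltW.
  rewrite lt_neqAle x0 andbT eq_sym; apply/eqP => x00.
  by move: zx; rewrite x00 expr0n/= leNgt z0.
have [x1|x1] := leP (hnorm x) 1; first by rewrite (le_trans x1)// ltW.
apply: le_trans (le_trans xy (ltW ym)); rewrite -[leLHS]expr1.
by apply: ler_weXn2l => //; exact: ltW.
Qed.

Lemma exp2_expR (k : int) : 2 ^ k = expR (k%:~R * ln 2) :> R.
Proof. by rewrite -powR_intmul// /powR pnatr_eq0. Qed.

Lemma hshell_expR (k : int) (x : H) (s : R) : hnorm x = expR s ->
  hshell k x <-> log_shell k s.
Proof.
move=> xs; rewrite /hshell /hball /log_shell /= in_itv /= xs !exp2_expR intrB.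
rewrite ler_expR; split.
  by move=> [-> /negP]; rewrite -ltNge ltr_expR => ->.
by move=> /andP[h ->]; split => //; apply/negP; rewrite -ltNge ltr_expR.
Qed.

Lemma hshell_cover (x : H) : x != 0 -> exists k, hshell k x.
Proof.
move=> /hnorm_gt0 x0; have L0 : 0 < ln 2 :> R by exact: ln2_gt0.
pose s := ln (hnorm x).
exists (Num.ceil (s / ln 2)); apply/(@hshell_expR _ _ s); first by rewrite lnK.
rewrite /log_shell/= in_itv/= -ler_pdivrMr// -ltr_pdivlMr//.
by have := ceil_itv (s / ln 2); rewrite intrB.
Qed.

(** Sets of known measure: large ones contain the unit shell, small ones shrink
    to the origin. *)
Definition heis_box (a b : R) : set H :=
  [set x : 'rV[R]_(2 * n) | forall i, `[- a, a]%classic (x ord0 i)] `*` `[- b, b].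

Lemma measurable_cube (a : R) :
  measurable [set x : 'rV[R]_(2 * n) | forall i, `[- a, a]%classic (x ord0 i)].
Proof.
rewrite (_ : [set x | _] = \bigcap_(i in [set: 'I_(2 * n)])
    ((fun x : 'rV[R]_(2 * n) => x ord0 i) @^-1` `[- a, a]%classic)).
  apply: fin_bigcap_measurable => // i _.
  by rewrite -[X in measurable X]setTI; exact: measurable_coord.
by apply/seteqP; split=> x Bx i => [_|]; exact: Bx.
Qed.

Lemma measurable_heis_box (a b : R) : measurable (heis_box a b).
Proof. by apply: measurableX => //; exact: measurable_cube. Qed.

Lemma lebesgue_heis_box (a b : R) : 0 < a -> 0 < b ->
  Leb (heis_box a b) = ((2 * a) ^+ (2 * n) * (2 * b))%:E.
Proof.
move=> a0 b0; have itvE (c : R) : 0 < c ->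
    lebesgue_measure `[- c, c]%classic = (2 * c)%:E.
  move=> c0; rewrite lebesgue_measure_itv/= lte_fin gtrN// -EFinD.
  by congr EFin; ring.
have mC := measurable_cube a.
rewrite /lebesgue_heis /heis_box product_measure1E// EFinM.
congr (_ * _)%E; last exact: itvE.
apply: etrans (@lebesgue_rV_box R (2 * n) (fun=> `[- a, a]%classic)
  (fun=> measurable_itv _)) _.
under eq_bigr do rewrite itvE//.
by rewrite prodEFin prodr_const card_ord.
Qed.

End heisenberg_geometry.

(** * Polar coordinates in logarithmic form *)

Section polar_coordinates.
Context {R : realType} {n : nat}.
Variable sigma : {measure set (heis R n) -> \bar R}.
Hypothesis hsigma : polar_measure sigma.
Local Notation H := (heis R n).
Local Notation Leb := (@lebesgue_heis R n).

Lemma hnorm_le2_sub_box : [set x : H | hnorm x <= 2] `<=` heis_box 2 4.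
Proof.
move=> x /= x2; have x4 : hnorm4 x <= 2 ^+ 4.
  by rewrite -hnorm_pow4; apply: lerXn2r; rewrite ?nnegrE ?hnorm_ge0.
move: x4; rewrite /hnorm4; set s := \sum_(i < _) _ => x4.
have s0 : 0 <= s by apply: sumr_ge0 => i _; exact: sqr_ge0.
have s20 : 0 <= s ^+ 2 by exact: sqr_ge0.
have x20 : 0 <= x.2 ^+ 2 by exact: sqr_ge0.
have s4 : s <= 4 by nra.
split => [i|] /=; rewrite in_itv/=; last by apply/andP; split; nra.
have xis : x.1 ord0 i ^+ 2 <= s.
  by rewrite /s (bigD1 i)//= lerDl sumr_ge0// => j _; exact: sqr_ge0.
by apply/andP; split; nra.
Qed.

Lemma hshell1_dil (r : R) (y : H) : 0 < r -> hsphere y ->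
  hshell 1 (dil r y) <-> `]1, 2]%classic r.
Proof.
move=> r0 y1; rewrite /hshell /hball /= hnorm_dil ?(ltW r0)// y1 mulr1 subrr.
rewrite expr0z expr1z in_itv/=; split.
  by move=> [-> /negP]; rewrite -ltNge => ->.
by move=> /andP[h ->]; split => //; apply/negP; rewrite -ltNge.
Qed.

(** The shell C_1 is contained in a box; by polar coordinates its measure is at
    least that of the sphere, because r^(Q-1) >= 1 for r in ]1, 2]. *)
Lemma sphere_measure_lty : (sigma hsphere < +oo)%E.
Proof.
have mS := measurable_hsphere (R := R) (n := n).
have mC := measurable_hshell (R := R) (n := n) 1.
apply: (@le_lt_trans _ _ (Leb (hshell 1))); last first.
  apply: (@le_lt_trans _ _ (Leb (heis_box 2 4))); last first.
    by rewrite lebesgue_heis_box// ltry.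
  apply: le_measure; rewrite ?inE//; first exact: measurable_heis_box.
  apply: subset_trans hnorm_le2_sub_box => x [].
  by rewrite /hball /= expr1z.
pose m := (hdim n).-1.
pose v (r : R) : \bar R := (\1_`]1%R, 2%R] r * r ^+ m)%:E.
have mv : measurable_fun setT v.
  by apply/measurable_EFinP; apply: measurable_funM => //; exact: exprn_measurable.
have v0 r : 0 < r -> (0 <= v r)%E.
  by move=> r0; rewrite lee_fin mulr_ge0// exprn_ge0// ltW.
have -> : Leb (hshell 1) =
    (\int[@lebesgue_measure R]_(r in `]0%R, +oo[) (v r * sigma hsphere))%E.
  have := hsigma (f := fun x : H => (\1_(hshell 1 : set H) x)%:E).
  rewrite integral_indic// setIT => -> //; last exact/measurable_EFinP.
  apply: eq_integral => r; rewrite inE/= in_itv/= andbT => r0.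
  rewrite -(integral_cst sigma mS (v r)); apply: eq_integral => y; rewrite inE => y1.
  rewrite /v EFinM; congr (_%:E * _)%E.
  have := hshell1_dil r0 y1; rewrite !indicE => -[h1 h2].
  suff -> : (dil r y \in (hshell 1 : set H)) = ((r : R) \in `]1, 2]%classic) by [].
  by apply/idP/idP; rewrite !inE.
apply: (@le_trans _ _ (\int[@lebesgue_measure R]_(r in `]1%R, 2%R]) sigma hsphere)%E).
  have -> : (\int[@lebesgue_measure R]_(r in `]1%R, 2%R]) sigma hsphere =
      sigma hsphere * lebesgue_measure (`]1%R, 2%R]%classic : set R))%E.
    exact: integral_cst.
  rewrite lebesgue_measure_itv/= lte_fin ltr1n -EFinB.
  by rewrite (_ : 2 - 1 = 1) ?mule1//; ring.
apply: (@le_trans _ _ (\int[@lebesgue_measure R]_(r in `]1%R, 2%R]) (v r * sigma hsphere))%E).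
  apply: ge0_le_integral => //.
  - by apply: emeasurable_funM => //; exact: measurable_funTS.
  move=> r /= r12; rewrite -[leLHS]mul1e lee_wpmul2r// /v indicE mem_set//=.
  move: r12; rewrite in_itv/= lee_fin mul1r => /andP[r1 _].
  by apply: exprn_ege1; exact: ltW.
apply: ge0_subset_integral => //.
- by apply: emeasurable_funM => //; exact: measurable_funTS.
- by move=> r /=; rewrite in_itv/= andbT => /v0 ?; rewrite mule_ge0.
- by move=> r /=; rewrite !in_itv/= andbT => /andP[r1 _]; rewrite (lt_trans _ r1).
Qed.

(** Polar coordinates over a null sphere would make the whole space null. *)
Lemma sphere_measure_gt0 : (0 < sigma hsphere)%E.
Proof.
have mS := measurable_hsphere (R := R) (n := n).
rewrite lt0e measure_ge0 andbT; apply/negP => /eqP S0.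
have := hsigma (f := cst 1%E) (measurable_cst _) (fun=> lee01).
rewrite integral_cst// mul1e => LT.
have : (Leb (heis_box 2^-1 2^-1) <= Leb setT)%E.
  by apply: le_measure; rewrite ?inE//; exact: measurable_heis_box.
rewrite lebesgue_heis_box// divff ?pnatr_eq0// expr1n mul1r LT.
rewrite integral0_eq ?lee_fin ?ler10// => r _.
under eq_integral do rewrite mul1e.
by rewrite (integral_cst sigma mS) S0 mule0.
Qed.

Local Notation S := (mfrestr measurable_hsphere sphere_measure_lty).

Lemma integral_sphere (f : H -> \bar R) : measurable_fun setT f ->
  (forall x, 0 <= f x)%E ->
  (\int[S]_x f x = \int[sigma]_(x in hsphere) f x)%E.
Proof. exact: ge0_integral_mfrestr. Qed.

Lemma eq_integral_sphere (f g : H -> \bar R) :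
  measurable_fun setT f -> (forall x, 0 <= f x)%E ->
  measurable_fun setT g -> (forall x, 0 <= g x)%E ->
  (forall y, hsphere y -> f y = g y) -> (\int[S]_x f x = \int[S]_x g x)%E.
Proof.
move=> mf f0 mg g0 fg; rewrite !integral_sphere//.
by apply: eq_integral => y; rewrite inE => /fg.
Qed.

Lemma polar_log (f : H -> \bar R) : measurable_fun setT f ->
  (forall x, 0 <= f x)%E ->
  (\int[Leb]_x f x =
   \int[leb]_s ((expR ((hdim n)%:R * s))%:E * \int[S]_y f (dil (expR s) y)))%E.
Proof.
move=> mf f0; pose m := (hdim n).-1.
have mfd : measurable_fun setT (fun z : R * H => f (dil z.1 z.2)).
  exact: (measurableT_comp mf measurable_dil).
pose P r : \bar R := (\int[S]_y f (dil r y))%E.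
have mP : measurable_fun setT P.
  exact: (measurable_fun_fubini_tonelli_F (m2 := S) _ mfd (fun z => f0 _)).
have P0 r : (0 <= P r)%E by apply: integral_ge0.
(* the absolute value keeps u non-negative for r < 0, outside of the range of
   integration *)
pose u r : \bar R := ((`|r| ^+ m)%:E * P r)%E.
have mu : measurable_fun setT u.
  apply: emeasurable_funM => //; apply/measurable_EFinP.
  by apply: measurable_funX; exact: normr_measurable.
have u0 r : (0 <= u r)%E by rewrite mule_ge0// lee_fin exprn_ge0.
rewrite hsigma//; transitivity (\int[@lebesgue_measure R]_(r in `]0%R, +oo[) u r)%E.
  apply: eq_integral => r; rewrite inE/= in_itv/= andbT => r0.
  have rm0 : (0 <= (r ^+ m)%:E)%E by rewrite lee_fin exprn_ge0// ltW.
  have mfr : measurable_fun setT (fun y => f (dil r y)).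
    exact: (measurableT_comp mf (measurable_dilr r)).
  rewrite ge0_integralZr//; last 2 first.
  - exact: measurable_hsphere.
  - exact: measurable_funTS.
  by rewrite -integral_sphere// /u gtr0_norm// muleC.
rewrite integral_expR//; apply: eq_integral => s _.
rewrite /u muleAC; congr (_ * _)%E; rewrite -EFinM; congr EFin.
rewrite ger0_norm ?expR_ge0// -exprSr /m prednK; last by rewrite /hdim addn2.
by rewrite -expRM_natl.
Qed.

End polar_coordinates.

(** * The Herz norm in polar coordinates *)

Lemma expR_powR (R : realType) (a b : R) : (expR a) `^ b = expR (b * a).
Proof. by rewrite /powR gt_eqF ?expR_gt0// expRK. Qed.

Section angular_part.
Context {R : realType} {n : nat}.
Local Notation H := (heis R n).

Definition ang (x : H) : H := dil (hnorm x)^-1 x.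

Lemma hsphere_ang (x : H) : x != 0 -> hsphere (ang x).
Proof.
move=> /hnorm_gt0 x0; rewrite /hsphere /= /ang hnorm_dil ?invr_ge0 ?(ltW x0)//.
by rewrite mulVf// gt_eqF.
Qed.

Lemma ang_id (y : H) : hsphere y -> ang y = y.
Proof. by move=> y1; rewrite /ang y1 invr1 dil1. Qed.

Lemma ang_dil (r : R) (y : H) : 0 < r -> hsphere y -> ang (dil r y) = y.
Proof.
move=> r0 y1; rewrite /ang hnorm_dil ?(ltW r0)// y1 mulr1 dilM.
by rewrite mulVf ?dil1// gt_eqF.
Qed.

Lemma hnorm_dil_expR (s : R) (y : H) : hsphere y -> hnorm (dil (expR s) y) = expR s.
Proof. by move=> y1; rewrite hnorm_dil ?expR_ge0// y1 mulr1. Qed.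

Lemma dil_neq0 (s : R) (y : H) : hsphere y -> dil (expR s) y != 0.
Proof.
move=> y1; apply/eqP => y0; have := hnorm_dil_expR s y1.
by rewrite y0 hnorm0 => /esym/eqP; rewrite gt_eqF// expR_gt0.
Qed.

Lemma measurable_hnormV : measurable_fun setT (fun x : H => (hnorm x)^-1).
Proof.
under eq_fun do rewrite -powR_inv1 ?hnorm_ge0//.
exact: (measurableT_comp (measurable_powR _) measurable_hnorm).
Qed.

Lemma measurable_ang : measurable_fun setT ang.
Proof.
have m : measurable_fun setT (fun x : H => ((hnorm x)^-1, x)).
  by apply/measurable_fun_pairP; split; [exact: measurable_hnormV|exact: measurable_id].
exact: (measurableT_comp measurable_dil m).
Qed.

Lemma measurable_punctured : measurable ([set~ 0] : set H).
Proof. by apply: measurableC; exact: measurable_heis1. Qed.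

(** The angular part of the origin is not on the sphere, so that nothing is known
    about Omega there; but a single value never affects measurability. *)
Lemma measurable_fun_punctured d (U : measurableType d) (g : H -> U) :
  measurable_fun ([set~ 0] : set H) g -> measurable_fun setT g.
Proof.
move=> mg; rewrite -(setvU [set (0 : H)]).
apply/measurable_funU => //; first exact: measurable_punctured.
  exact: measurable_heis1.
by split => //; exact: measurable_fun_set1.
Qed.

Lemma measurable_comp_ang d (U : measurableType d) (g : H -> U) :
  measurable_fun hsphere g -> measurable_fun setT (g \o ang).
Proof.
move=> mg; apply: measurable_fun_punctured.
apply: (measurable_comp measurable_hsphere _ mg).
  by move=> _ [x /= /eqP x0 <-]; exact: hsphere_ang.
by apply: measurable_funTS; exact: measurable_ang.
Qed.

End angular_part.

Section herz_polar.
Context {R : realType} {n : nat}.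
Variable sigma : {measure set (heis R n) -> \bar R}.
Hypothesis hsigma : polar_measure sigma.
Variables alpha p q gamma : R.
Hypotheses (hp : 1 <= p) (hq : 1 < q).
Local Notation H := (heis R n).
Local Notation Leb := (@lebesgue_heis R n).
Local Notation S := (mfrestr measurable_hsphere (sphere_measure_lty hsigma)).
Local Notation beta := (alpha + ((hdim n)%:R + gamma) / q).

Let p0 : 0 < p. Proof. exact: lt_le_trans hp. Qed.
Let q0 : 0 < q. Proof. exact: lt_trans hq. Qed.

(** The p-th power of a Herz norm, for extended real functions: it is applied to
    the operator with absolute values before that is known to be finite. *)
Definition herz_sum (N : H -> \bar R) : \bar R :=
  (\esum_(k in [set: int]) ((2 `^ (k%:~R * alpha * p))%:E *
     (\int[Leb]_(x in hshell k) (N x `^ q * (hnorm x `^ gamma)%:E)) `^ (p / q)))%E.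

(** The exponent beta q collects Q from the volume element, gamma from the weight
    and alpha q from the factors 2^(k alpha) of the Herz norm. *)
Definition radial_density (N : H -> \bar R) (s : R) : \bar R :=
  ((expR (beta * q * s))%:E * \int[S]_y (N (dil (expR s) y) `^ q))%E.

Definition amalgam_sum (D : R -> \bar R) : \bar R :=
  (\esum_(k in [set: int]) ((\int[leb]_(s in log_shell k) D s) `^ (p / q)))%E.

Lemma herz_normE (f : H -> R[i]) :
  herz_norm alpha p q (power_weight gamma) f =
  (herz_sum (fun x => (Normc.normc (f x))%:E) `^ p^-1)%E.
Proof.
rewrite /herz_norm /herz_sum; congr (_ `^ _)%E; apply: eq_esum => k _.
congr (_ * _)%E; rewrite /cLnorm -poweRrM [q^-1 * p]mulrC; congr (_ `^ (p / q))%E.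
rewrite [RHS]integral_mkcond; apply: eq_integral => x _.
rewrite /shell_part patchE indicE; case: ifPn => xk.
  by rewrite mulr1 poweR_EFin EFinM.
by rewrite mulr0 Normc.normc0 powR0 ?gt_eqF// mul0r.
Qed.

Lemma herz_sum_ge0 (N : H -> \bar R) : (0 <= herz_sum N)%E.
Proof.
by apply: esum_ge0 => k _; rewrite mule_ge0 ?poweR_ge0// lee_fin powR_ge0.
Qed.

Lemma herz_sumZ (c : R) (N : H -> \bar R) : 0 <= c ->
  measurable_fun setT N -> (forall x, 0 <= N x)%E ->
  herz_sum (fun x => c%:E * N x)%E =
  ((c `^ p)%:E * herz_sum N)%E.
Proof.
move=> c0 mN N0; rewrite /herz_sum -esumZl ?powR_ge0//; last first.
  by move=> k; rewrite mule_ge0 ?poweR_ge0// lee_fin powR_ge0.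
apply: eq_esum => k _; rewrite muleCA; congr (_ * _)%E.
have F0 (x : H) : (0 <= N x `^ q * (hnorm x `^ gamma)%:E)%E.
  by rewrite mule_ge0 ?poweR_ge0// lee_fin powR_ge0.
have cE0 : (0 <= c%:E)%E by rewrite lee_fin.
have cq0 : (0 <= (c `^ q)%:E)%E by rewrite lee_fin powR_ge0.
rewrite (_ : \int[Leb]_(x in hshell k) _ = (c `^ q)%:E *
    \int[Leb]_(x in hshell k) (N x `^ q * (hnorm x `^ gamma)%:E))%E.
  have I0 : (0 <= \int[Leb]_(x in hshell k) (N x `^ q * (hnorm x `^ gamma)%:E))%E.
    by apply: integral_ge0 => x _; exact: F0.
  rewrite (poweRM _ cq0 I0) poweR_EFin -powRrM; congr (_%:E * _)%E.
  by congr (_ `^ _); field; rewrite gt_eqF.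
rewrite -(ge0_integralZl Leb (measurable_hshell k) _ (fun x _ => F0 x) cq0).
  by apply: eq_integral => x _; rewrite (poweRM _ cE0 (N0 x)) poweR_EFin muleA.
apply: measurable_funTS; apply: emeasurable_funM.
  exact: measurableT_comp (measurable_poweR _) mN.
apply/measurable_EFinP.
exact: (measurableT_comp (measurable_powR _) measurable_hnorm).
Qed.

Lemma herz_norm_bound_sum (f g : H -> R[i]) (C : R) : 0 <= C ->
  (herz_norm alpha p q (power_weight gamma) g <=
   C%:E * herz_norm alpha p q (power_weight gamma) f)%E ->
  (herz_sum (fun x => (Normc.normc (g x))%:E) <=
   (C `^ p)%:E * herz_sum (fun x => (Normc.normc (f x))%:E))%E.
Proof.
move=> C0; rewrite !herz_normE.
have := herz_sum_ge0 (fun x => (Normc.normc (f x))%:E).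
have := herz_sum_ge0 (fun x => (Normc.normc (g x))%:E).
move: (herz_sum _) (herz_sum _) => Sg Sf Sg0 Sf0.
have root (s : \bar R) : (0 <= s)%E -> ((s `^ p^-1) `^ p = s)%E.
  by move=> s0; rewrite -poweRrM mulVf ?gt_eqF// poweRe1.
have C0E : (0 <= C%:E)%E by rewrite lee_fin.
move=> /(le_poweR (ltW p0) (poweR_ge0 _ _)).
by rewrite (poweRM _ C0E (poweR_ge0 _ _)) poweR_EFin (root _ Sf0) (root _ Sg0).
Qed.

Lemma le_herz_sum (N1 N2 : H -> \bar R) :
  measurable_fun setT N1 -> (forall x, 0 <= N1 x)%E ->
  measurable_fun setT N2 -> (forall x, 0 <= N2 x)%E ->
  {ae Leb, forall x, N1 x <= N2 x}%E -> (herz_sum N1 <= herz_sum N2)%E.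
Proof.
move=> mN1 N10 mN2 N20 [A [mA A0 NA]].
have mk N k : measurable_fun setT N ->
    measurable_fun (hshell k) (fun x : H => N x `^ q * (hnorm x `^ gamma)%:E)%E.
  move=> mN; apply: measurable_funTS; apply: emeasurable_funM.
    exact: measurableT_comp (measurable_poweR _) mN.
  apply/measurable_EFinP.
  exact: (measurableT_comp (measurable_powR _) measurable_hnorm).
apply: le_esum => k _; apply: lee_wpmul2l; first by rewrite lee_fin powR_ge0.
have w0 x : (0 <= (hnorm (x : H) `^ gamma)%:E)%E by rewrite lee_fin powR_ge0.
apply: le_poweR; first by rewrite divr_ge0 ?(ltW p0) ?(ltW q0).
  by apply: integral_ge0 => x _; rewrite mule_ge0// poweR_ge0.
apply: ae_ge0_le_integral.
- exact: measurable_hshell.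
- by move=> x _; rewrite mule_ge0// poweR_ge0.
- exact: mk.
- by move=> x _; rewrite mule_ge0// poweR_ge0.
- exact: mk.
exists A; split => // x; apply: contra_notP => /= xA.
have N12 : (N1 x <= N2 x)%E by apply: contrapT => h; exact/xA/NA.
by move=> _; apply: lee_wpmul2r => //; apply: le_poweR => //; exact: ltW.
Qed.

Lemma measurable_dil_expR d (U : measurableType d) (N : H -> U) :
  measurable_fun setT N ->
  measurable_fun setT (fun z : R * H => N (dil (expR z.1) z.2)).
Proof.
move=> mN; apply: (measurableT_comp mN).
have m : measurable_fun setT (fun z : R * H => (expR z.1, z.2)).
  apply/measurable_fun_pairP; split => /=; last exact: measurable_snd.
  exact: (measurableT_comp (@measurable_expR R) measurable_fst).
exact: (measurableT_comp measurable_dil m).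
Qed.

Lemma measurable_sphere_mean (N : H -> \bar R) :
  measurable_fun setT N -> (forall x, 0 <= N x)%E ->
  measurable_fun setT (fun s => \int[S]_y N (dil (expR s) y))%E.
Proof.
move=> mN N0.
exact: (measurable_fun_fubini_tonelli_F (m2 := S) _ (measurable_dil_expR mN) (fun z => N0 _)).
Qed.

Lemma integral_hshell (N : H -> \bar R) (k : int) :
  measurable_fun setT N -> (forall x, 0 <= N x)%E ->
  (\int[Leb]_(x in hshell k) (N x * (hnorm x `^ gamma)%:E) =
   \int[leb]_(s in log_shell k)
     ((expR (((hdim n)%:R + gamma) * s))%:E * \int[S]_y N (dil (expR s) y)))%E.
Proof.
move=> mN N0.
have mw : measurable_fun setT (fun x : H => (hnorm x `^ gamma)%:E).
  apply/measurable_EFinP.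
  exact: (measurableT_comp (measurable_powR _) measurable_hnorm).
have w0 x : (0 <= (hnorm (x : H) `^ gamma)%:E)%E by rewrite lee_fin powR_ge0.
have mNw : measurable_fun setT (fun x : H => N x * (hnorm x `^ gamma)%:E)%E.
  exact: emeasurable_funM.
set F := (fun x : H => N x * (hnorm x `^ gamma)%:E)%E in mNw *.
have F0 x : (0 <= F x)%E by rewrite mule_ge0.
have mFk : measurable_fun setT (F \_ (hshell k)).
  exact/(measurable_restrictT _ (measurable_hshell k))/measurable_funTS.
have Fk0 x : (0 <= (F \_ (hshell k)) x)%E by rewrite patchE; case: ifP.
rewrite integral_mkcond (polar_log hsigma mFk Fk0) [RHS]integral_mkcond.
have mNs s : measurable_fun setT (fun y => N (dil (expR s) y)).
  exact: (measurableT_comp mN (measurable_dilr _)).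
apply: eq_integral => s _; rewrite [RHS]patchE; case: ifPn => sk.
  rewrite mulrDl expRD EFinM -muleA; congr (_ * _)%E.
  rewrite -ge0_integralZl ?lee_fin ?expR_ge0//.
  apply: eq_integral_sphere.
  - exact: (measurableT_comp mFk (measurable_dilr _)).
  - by move=> y; exact: Fk0.
  - exact: emeasurable_funM.
  - by move=> y; rewrite mule_ge0// lee_fin expR_ge0.
  move=> y y1; rewrite patchE mem_set; last first.
    by apply/(hshell_expR k (hnorm_dil_expR s y1)); move: sk; rewrite inE.
  by rewrite /F hnorm_dil_expR// expR_powR muleC.
rewrite -[RHS](mule0 (expR ((hdim n)%:R * s))%:E); congr (_ * _)%E.
have := eq_integral_sphere hsigma
  (measurableT_comp mFk (measurable_dilr (expR s))) (fun y => Fk0 _)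
  (measurable_cst 0%E) (fun=> lexx 0%E).
rewrite integral0; apply => y y1 /=; rewrite patchE memNset// => /(hshell_expR k (hnorm_dil_expR s y1)).
by move: sk; rewrite notin_setE.
Qed.

Lemma radial_density_ge0 (N : H -> \bar R) (s : R) :
  (0 <= radial_density N s)%E.
Proof.
rewrite mule_ge0 ?lee_fin ?expR_ge0//; apply: integral_ge0 => y _.
exact: poweR_ge0.
Qed.

Lemma measurable_radial_density (N : H -> \bar R) :
  measurable_fun setT N -> measurable_fun setT (radial_density N).
Proof.
move=> mN; apply: emeasurable_funM.
  apply/measurable_EFinP; apply: (measurableT_comp (@measurable_expR R)).
  exact: measurable_funM.
apply: (@measurable_sphere_mean (fun x => N x `^ q)%E).
  exact: measurableT_comp (measurable_poweR _) mN.
by move=> x; exact: poweR_ge0.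
Qed.

Let expR2 (a : R) : 2 `^ a = expR (a * ln 2).
Proof. by rewrite /powR pnatr_eq0. Qed.

Let shell_weight (a b : R -> R) (c : R) (N : H -> \bar R) (k : int) : 0 <= c ->
  measurable_fun setT a -> measurable_fun setT b ->
  measurable_fun setT N -> (forall x, 0 <= N x)%E ->
  (forall s, log_shell k s -> expR (a s) <= c * expR (b s)) ->
  (\int[leb]_(s in log_shell k)
     ((expR (a s))%:E * \int[S]_y N (dil (expR s) y)) <=
   c%:E * \int[leb]_(s in log_shell k)
     ((expR (b s))%:E * \int[S]_y N (dil (expR s) y)))%E.
Proof.
move=> c0 ma mb mN N0 ab; have mP := measurable_sphere_mean mN N0.
have P0 s : (0 <= \int[S]_y N (dil (expR s) y))%E by apply: integral_ge0.
have mE (g : R -> R) : measurable_fun setT g ->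
    measurable_fun (log_shell k) (fun s => (expR (g s))%:E *
      \int[S]_y N (dil (expR s) y))%E.
  move=> mg; apply: measurable_funTS; apply: emeasurable_funM => //.
  by apply/measurable_EFinP; exact: (measurableT_comp (@measurable_expR R) mg).
have E0 (g : R -> R) s : (0 <= (expR (g s))%:E * \int[S]_y N (dil (expR s) y))%E.
  by rewrite mule_ge0// lee_fin expR_ge0.
have mk := @measurable_log_shell R k.
rewrite -ge0_integralZl//; last exact: mE.
apply: ge0_le_integral => //; first exact: mE.
  by apply: emeasurable_funM => //; exact: mE.
move=> s ks; rewrite muleA -EFinM; apply: lee_wpmul2r => //.
by rewrite lee_fin ab.
Qed.

(** In J_k the coordinate s is within ln 2 of k ln 2, so e^(alpha q s) and
    2^(k alpha q) differ by at most a factor 2^(|alpha| q). *)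
Let herz_shell (N : H -> \bar R) (k : int) :
  measurable_fun setT N -> (forall x, 0 <= N x)%E ->
  let I := (\int[Leb]_(x in hshell k) (N x `^ q * (hnorm x `^ gamma)%:E))%E in
  let J := (\int[leb]_(s in log_shell k) radial_density N s)%E in
  ((2 `^ (k%:~R * alpha * q))%:E * I <= (2 `^ (`|alpha| * q))%:E * J /\
   J <= (2 `^ (`|alpha| * q))%:E * ((2 `^ (k%:~R * alpha * q))%:E * I))%E.
Proof.
move=> mN N0 I J; have mNq : measurable_fun setT (fun x => N x `^ q)%E.
  exact: measurableT_comp (measurable_poweR _) mN.
have Nq0 x : (0 <= N x `^ q)%E by exact: poweR_ge0.
have ma (c : R) : measurable_fun setT (fun s : R => c * s).
  exact: measurable_funM.
have L0 : 0 < ln 2 :> R by exact: ln2_gt0.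
have mb : measurable_fun setT (fun s : R => k%:~R * alpha * q * ln 2 + ((hdim n)%:R + gamma) * s).
  by apply: measurable_funD => //; exact: ma.
have I0 : (0 <= I)%E.
  apply: integral_ge0 => x _; rewrite mule_ge0 ?poweR_ge0// lee_fin.
  exact: powR_ge0.
have IE : ((2 `^ (k%:~R * alpha * q))%:E * I = \int[leb]_(s in log_shell k)
    ((expR (k%:~R * alpha * q * ln 2 + ((hdim n)%:R + gamma) * s))%:E *
     \int[S]_y (N (dil (expR s) y) `^ q)))%E.
  have mP := measurable_sphere_mean mNq Nq0.
  have P0 s : (0 <= \int[S]_y (N (dil (expR s) y) `^ q))%E.
    by apply: integral_ge0 => y _; exact: Nq0.
  rewrite /I integral_hshell// expR2 -ge0_integralZl ?lee_fin ?expR_ge0//.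
  - by apply: eq_integral => s _; rewrite muleA -EFinM -expRD.
  - exact: measurable_log_shell.
  - apply: measurable_funTS; apply: emeasurable_funM => //.
    by apply/measurable_EFinP; exact: (measurableT_comp (@measurable_expR R) (ma _)).
  - by move=> s _; rewrite mule_ge0// lee_fin expR_ge0.
have bound s : log_shell k s -> `|alpha * (k%:~R * ln 2 - s)| <= `|alpha| * ln 2.
  rewrite /log_shell/= in_itv/= => /andP[ks sk]; rewrite normrM ler_wpM2l//.
  by rewrite ger0_norm; lra.
have betaq : beta * q = alpha * q + ((hdim n)%:R + gamma).
  by rewrite mulrDl divfK// gt_eqF.
rewrite IE; split.
  apply: (@shell_weight _ (fun s => beta * q * s) _ (fun x => N x `^ q)%E) => //.
  move=> s /bound; rewrite ler_norml => /andP[h1 h2].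
  rewrite expR2 -expRD ler_expR betaq.
  by move: h2; rewrite -(ler_pM2r q0); lra.
apply: (@shell_weight (fun s => beta * q * s) _ _ (fun x => N x `^ q)%E) => //.
move=> s /bound; rewrite ler_norml => /andP[h1 h2].
rewrite expR2 -expRD ler_expR betaq.
by move: h1; rewrite -(ler_pM2r q0); lra.
Qed.

(** The sums agree shell by shell, up to the ratio of the factors 2^(k alpha)
    and |x|^alpha. *)
Lemma herz_sum_amalgam (N : H -> \bar R) :
  measurable_fun setT N -> (forall x, 0 <= N x)%E ->
  (herz_sum N <= (2 `^ (`|alpha| * p))%:E * amalgam_sum (radial_density N) /\
   amalgam_sum (radial_density N) <= (2 `^ (`|alpha| * p))%:E * herz_sum N)%E.
Proof.
move=> mN N0.
have D0 k : (0 <= \int[leb]_(s in log_shell k) radial_density N s)%E.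
  by apply: integral_ge0 => s _; exact: radial_density_ge0.
have I0 k : (0 <= \int[Leb]_(x in hshell k) (N x `^ q * (hnorm x `^ gamma)%:E))%E.
  by apply: integral_ge0 => x _; rewrite mule_ge0 ?poweR_ge0// lee_fin powR_ge0.
have c0 (a : R) : (0 <= (2 `^ a)%:E)%E by rewrite lee_fin powR_ge0.
have pow (a : R) : (2 `^ (a * p))%:E = ((2 `^ (a * q))%:E `^ (p / q))%E.
  rewrite poweR_EFin -powRrM; congr (_ `^ _)%:E.
  by field; rewrite gt_eqF.
have pq0 : 0 <= p / q by rewrite divr_ge0 ?(ltW p0) ?(ltW q0).
have C0 : 0 <= 2 `^ (`|alpha| * p) :> R by rewrite powR_ge0.
split; rewrite /herz_sum /amalgam_sum -(esumZl C0).
- apply: le_esum => k _; have [le1 _] := herz_shell k mN N0.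
  rewrite (pow (k%:~R * alpha)) (pow `|alpha|).
  rewrite -(poweRM _ (c0 _) (I0 k)) -(poweRM _ (c0 _) (D0 k)).
  by apply: le_poweR le1 => //; exact: mule_ge0 (c0 _) (I0 k).
- by move=> k; exact: poweR_ge0.
- apply: le_esum => k _; have [_ le2] := herz_shell k mN N0.
  rewrite (pow (k%:~R * alpha)) (pow `|alpha|).
  have cI0 := mule_ge0 (c0 (k%:~R * alpha * q)) (I0 k).
  rewrite -(poweRM _ (c0 _) (I0 k)) -(poweRM _ (c0 _) cI0).
  exact: le_poweR pq0 (D0 k) le2.
- by move=> k; apply: mule_ge0; [exact: c0|exact: poweR_ge0].
Qed.

End herz_polar.

(** * The operator in polar coordinates *)

Section complex_measurability.
Context d (T : measurableType d) (R : realType).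

Lemma normc_sqrt (z : R[i]) :
  Normc.normc z = (complex.Re z ^+ 2 + complex.Im z ^+ 2) `^ 2^-1.
Proof. by case: z => a b /=; rewrite powR12_sqrt// addr_ge0// sqr_ge0. Qed.

Lemma normc_ge0 (z : R[i]) : 0 <= Normc.normc z.
Proof. by rewrite normc_sqrt powR_ge0. Qed.

Lemma normc_le_Re_Im (z : R[i]) :
  Normc.normc z <= `|complex.Re z| + `|complex.Im z|.
Proof.
case: z => a b /=; rewrite -[leRHS]ger0_norm ?addr_ge0// -sqrtr_sqr.
rewrite ler_sqrt ?sqr_ge0// sqrrD !real_normK ?num_real//.
by rewrite lerD2r lerDl mulrn_wge0// mulr_ge0.
Qed.

Lemma Re_le_normc (z : R[i]) : `|complex.Re z| <= Normc.normc z.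
Proof.
by case: z => a b /=; rewrite -sqrtr_sqr ler_sqrt ?addr_ge0 ?sqr_ge0// lerDl sqr_ge0.
Qed.

Lemma Im_le_normc (z : R[i]) : `|complex.Im z| <= Normc.normc z.
Proof.
by case: z => a b /=; rewrite -sqrtr_sqr ler_sqrt ?addr_ge0 ?sqr_ge0// lerDr sqr_ge0.
Qed.

Lemma measurable_normc (D : set T) (f : T -> R[i]) :
  cmeasurable_fun D f -> measurable_fun D (fun x => Normc.normc (f x)).
Proof.
move=> [mRe mIm]; under eq_fun do rewrite normc_sqrt.
apply: (measurableT_comp (measurable_powR _)).
by apply: measurable_funD; apply: measurable_funX.
Qed.

(** The positive and negative parts of the integral are measurable in the
    parameter by Tonelli's theorem, and fine is measurable, so this includes the
    points where the integral is not finite. *)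
Lemma measurable_Rintegral d' (T' : measurableType d')
    (mu : {sigma_finite_measure set T' -> \bar R}) (g : T * T' -> R) :
  measurable_fun setT g ->
  measurable_fun setT (fun x => \int[mu]_y g (x, y))%R.
Proof.
move=> mg; rewrite /Rintegral.
have mgE : measurable_fun setT (EFin \o g) by exact/measurable_EFinP.
apply: (measurableT_comp (@fine_measurable R setT measurableT)).
under eq_fun do rewrite integralE.
apply: emeasurable_funB.
  have := measurable_fun_fubini_tonelli_F (m2 := mu) _ (measurable_funepos mgE)
    (fun z => funepos_ge0 _ z).
  by apply: eq_measurable_fun => x _; apply: eq_integral => y _; rewrite !funeposE.
have := measurable_fun_fubini_tonelli_F (m2 := mu) _ (measurable_funeneg mgE)
  (fun z => funeneg_ge0 _ z).
by apply: eq_measurable_fun => x _; apply: eq_integral => y _; rewrite !funenegE.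
Qed.

End complex_measurability.

Section hausdorff_polar.
Context {R : realType} {n : nat}.
Variable sigma : {measure set (heis R n) -> \bar R}.
Hypothesis hsigma : polar_measure sigma.
Local Notation H := (heis R n).
Local Notation Leb := (@lebesgue_heis R n).
Local Notation S := (mfrestr measurable_hsphere (sphere_measure_lty hsigma)).
Variables (Phi : H -> R) (Omega : H -> R[i]).
Hypotheses (mPhi : measurable_fun setT Phi) (Phi0 : forall x, 0 <= Phi x).
Hypothesis (rPhi : radial Phi).
Hypothesis (mOmega : cmeasurable_fun hsphere Omega).

Definition kernel_weight (z : H * H) : R :=
  Phi (dil (hnorm z.2)^-1 z.1) / hnorm z.2 ^+ hdim n.

Let normO (y : H) : R := Normc.normc (Omega (ang y)).

Lemma measurable_normO : measurable_fun setT normO.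
Proof. exact: (measurable_comp_ang (measurable_normc mOmega)). Qed.

Lemma measurable_kernel_weight : measurable_fun setT kernel_weight.
Proof.
apply: measurable_funM.
  apply: (measurableT_comp mPhi).
  have m : measurable_fun setT (fun z : H * H => ((hnorm z.2)^-1, z.1)).
    apply/measurable_fun_pairP; split; last exact: measurable_fst.
    exact: (measurableT_comp measurable_hnormV measurable_snd).
  exact: (measurableT_comp measurable_dil m).
under eq_fun do rewrite -exprVn.
apply: measurable_funX.
exact: (measurableT_comp measurable_hnormV measurable_snd).
Qed.

Lemma kernel_weight_ge0 z : 0 <= kernel_weight z.
Proof. by rewrite mulr_ge0// invr_ge0 exprn_ge0// hnorm_ge0. Qed.

Section fixed_function.
Variable f : H -> R[i].
Hypothesis mf : cmeasurable_fun setT f.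

Local Notation K := (hausdorff_integrand Phi Omega f).

Let ReK (x y : H) : complex.Re (K x y) = kernel_weight (x, y) *
  (complex.Re (Omega (ang y)) * complex.Re (f y) -
   complex.Im (Omega (ang y)) * complex.Im (f y)).
Proof.
rewrite /hausdorff_integrand -/(ang y) /kernel_weight /=.
by case: (Omega _) => a b; case: (f y) => c e /=; ring.
Qed.

Let ImK (x y : H) : complex.Im (K x y) = kernel_weight (x, y) *
  (complex.Re (Omega (ang y)) * complex.Im (f y) +
   complex.Im (Omega (ang y)) * complex.Re (f y)).
Proof.
rewrite /hausdorff_integrand -/(ang y) /kernel_weight /=.
by case: (Omega _) => a b; case: (f y) => c e /=; ring.
Qed.

Lemma normcK (x y : H) : Normc.normc (K x y) =
  kernel_weight (x, y) * (normO y * Normc.normc (f y)).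
Proof.
rewrite /hausdorff_integrand !Normc.normcM -/(ang y) mulrA; congr (_ * _ * _).
by rewrite /= expr0n addr0 sqrtr_sqr ger0_norm//; exact: (kernel_weight_ge0 (x, y)).
Qed.

Let mO1 : measurable_fun setT (fun y => complex.Re (Omega (ang y))).
Proof. by case: mOmega => h _; exact: (measurable_comp_ang h). Qed.
Let mO2 : measurable_fun setT (fun y => complex.Im (Omega (ang y))).
Proof. by case: mOmega => _ h; exact: (measurable_comp_ang h). Qed.

Let m2 (g : H -> R) : measurable_fun setT g ->
  measurable_fun setT (fun z : H * H => g z.2).
Proof. by move=> mg; exact: (measurableT_comp mg measurable_snd). Qed.

Lemma measurable_integrand :
  cmeasurable_fun setT (fun z : H * H => K z.1 z.2).
Proof.
case: mf => mf1 mf2; split.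
  under eq_fun do rewrite ReK -surjective_pairing.
  apply: measurable_funM; first exact: measurable_kernel_weight.
  exact: (measurable_funB (measurable_funM (m2 mO1) (m2 mf1))
                          (measurable_funM (m2 mO2) (m2 mf2))).
under eq_fun do rewrite ImK -surjective_pairing.
apply: measurable_funM; first exact: measurable_kernel_weight.
exact: (measurable_funD (measurable_funM (m2 mO1) (m2 mf2))
                        (measurable_funM (m2 mO2) (m2 mf1))).
Qed.

Lemma measurable_integrand_section (x : H) : cmeasurable_fun setT (K x).
Proof.
by case: measurable_integrand => m m'; split;
  [exact: (measurableT_comp m (@measurable_pair1 _ _ _ _ x))
  |exact: (measurableT_comp m' (@measurable_pair1 _ _ _ _ x))].
Qed.

Lemma measurable_hausdorff : cmeasurable_fun setT (hausdorff Phi Omega f).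
Proof.
case: measurable_integrand => m m'; split.
  exact: (@measurable_Rintegral _ _ _ _ _ Leb _ m).
exact: (@measurable_Rintegral _ _ _ _ _ Leb _ m').
Qed.

(** The operator with absolute values inside: it is finite exactly where the
    integral defining the operator converges absolutely. *)
Definition abs_hausdorff (x : H) : \bar R :=
  (\int[Leb]_y (Normc.normc (K x y))%:E)%E.

Lemma abs_hausdorff_ge0 x : (0 <= abs_hausdorff x)%E.
Proof. by apply: integral_ge0 => y _; rewrite lee_fin normc_ge0. Qed.

Lemma measurable_abs_hausdorff : measurable_fun setT abs_hausdorff.
Proof.
apply: (measurable_fun_fubini_tonelli_F (m2 := Leb)
  (fun z => (Normc.normc (K z.1 z.2))%:E)) => [|z].
  by apply/measurable_EFinP; exact: (measurable_normc measurable_integrand).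
by rewrite lee_fin normc_ge0.
Qed.

(** Real and imaginary parts are estimated separately, whence the factor 2. *)
Lemma normc_hausdorff_le (x : H) :
  ((Normc.normc (hausdorff Phi Omega f x))%:E <= 2%:E * abs_hausdorff x)%E.
Proof.
have fine_le (a : \bar R) : (`|fine a|%:E <= `|a|)%E.
  by case: a => [r||] //=; rewrite normr0 leey.
have part (g : R[i] -> R) : (forall z, `|g z| <= Normc.normc z) ->
    measurable_fun setT (g \o K x) ->
    (`|\int[Leb]_y g (K x y)|%:E <= abs_hausdorff x)%E.
  move=> gn mg; apply: le_trans (fine_le _) _.
  have mgE : measurable_fun setT (fun y => (g (K x y))%:E).
    exact/measurable_EFinP.
  apply: le_trans (le_abse_integral _ measurableT mgE) _.
  apply: ge0_le_integral => //.
  - exact: measurableT_comp.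
  - apply/measurable_EFinP.
    exact: (measurable_normc (measurable_integrand_section x)).
  - by move=> y _; rewrite lee_fin.
have [m m'] := measurable_integrand_section x.
rewrite mule_natl mule2n.
apply: (@le_trans _ _ (`|complex.Re (hausdorff Phi Omega f x)| +
                       `|complex.Im (hausdorff Phi Omega f x)|)%:E).
  by rewrite lee_fin normc_le_Re_Im.
rewrite EFinD; apply: leeD.
  by apply: (part (@complex.Re R)) => //; exact: Re_le_normc.
by apply: (part (@complex.Im R)) => //; exact: Im_le_normc.
Qed.

(** All that the operator with absolute values retains of f at radius e^t. *)
Definition sphere_pairing (t : R) : \bar R :=
  (\int[S]_z (normO z * Normc.normc (f (dil (expR t) z)))%:E)%E.

Lemma sphere_pairing_ge0 t : (0 <= sphere_pairing t)%E.
Proof.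
by apply: integral_ge0 => z _; rewrite lee_fin mulr_ge0 ?normc_ge0.
Qed.

Lemma profileE (x : H) : Phi x = profile Phi (hnorm x).
Proof. by apply: rPhi; rewrite hnorm_vert// hnorm_ge0. Qed.

(** In logarithmic polar coordinates the operator is a convolution: the factor
    |y|^(-Q) cancels the volume element e^(Q t) dt, and Phi, being radial, is
    evaluated at the ratio e^(s-t) of the two radii. *)
Lemma abs_hausdorff_polar (s : R) (y : H) : hsphere y ->
  abs_hausdorff (dil (expR s) y) =
  (\int[leb]_t ((profile Phi (expR (s - t)))%:E * sphere_pairing t))%E.
Proof.
move=> y1; have [m m'] := measurable_integrand_section (dil (expR s) y).
have mN := measurable_normc (conj m m').
have mNE : measurable_fun setT (fun z => (Normc.normc (K (dil (expR s) y) z))%:E).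
  exact/measurable_EFinP.
have N0 z : (0 <= (Normc.normc (K (dil (expR s) y) z))%:E)%E.
  by rewrite lee_fin normc_ge0.
rewrite /abs_hausdorff (polar_log hsigma mNE N0).
have mnf := measurable_normc mf.
apply: eq_integral => t _; rewrite /sphere_pairing.
have mG : measurable_fun setT
    (fun z => (normO z * Normc.normc (f (dil (expR t) z)))%:E).
  apply/measurable_EFinP; apply: measurable_funM; first exact: measurable_normO.
  exact: (measurableT_comp mnf (measurable_dilr _)).
have G0 z : (0 <= (normO z * Normc.normc (f (dil (expR t) z)))%:E)%E.
  by rewrite lee_fin mulr_ge0 ?normc_ge0.
have P0 : (0 <= (profile Phi (expR (s - t)))%:E)%E by rewrite lee_fin; exact: Phi0.
have E0 : (0 <= (expR ((hdim n)%:R * t))%:E)%E by rewrite lee_fin expR_ge0.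
have mKt := measurableT_comp mNE (measurable_dilr (expR t)).
rewrite -[RHS](ge0_integralZl S measurableT mG (fun z _ => G0 z) P0).
rewrite -[LHS](ge0_integralZl S measurableT mKt (fun z _ => N0 _) E0).
apply: (eq_integral_sphere hsigma).
- exact: emeasurable_funM.
- by move=> z; apply: mule_ge0 => //; exact: N0.
- exact: emeasurable_funM.
- by move=> z; exact: mule_ge0.
move=> z z1; rewrite /= -!EFinM; congr EFin.
rewrite normcK /kernel_weight /= hnorm_dil_expR// /normO ang_dil ?expR_gt0//.
rewrite profileE hnorm_dil ?invr_ge0 ?expR_ge0// hnorm_dil_expR//.
rewrite -expRN -expRD [- t + s]addrC -expRM_natl.
rewrite (ang_id z1); set E := expR _.
have E1 : E != 0 by rewrite gt_eqF// expR_gt0.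
by field.
Qed.

End fixed_function.
End hausdorff_polar.

(** * Upper bound *)

Section upper_bound.
Context {R : realType} {n : nat}.
Variable sigma : {measure set (heis R n) -> \bar R}.
Hypothesis hsigma : polar_measure sigma.
Variables alpha p q gamma : R.
Hypotheses (hp : 1 <= p) (hq : 1 < q).
Local Notation H := (heis R n).
Local Notation S := (mfrestr measurable_hsphere (sphere_measure_lty hsigma)).
Local Notation beta := (alpha + ((hdim n)%:R + gamma) / q).
Variables (Phi : H -> R) (Omega : H -> R[i]).
Hypotheses (mPhi : measurable_fun setT Phi) (Phi0 : forall x, 0 <= Phi x).
Hypothesis (rPhi : radial Phi).
Hypothesis (mOmega : cmeasurable_fun hsphere Omega).
Hypothesis (finOmega : (sphere_Lnorm sigma (q / (q - 1)) Omega < +oo)%E).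

Let p0 : 0 < p. Proof. exact: lt_le_trans hp. Qed.
Let q0 : 0 < q. Proof. exact: lt_trans hq. Qed.
Let q'0 : 0 < q / (q - 1). Proof. by rewrite divr_gt0// subr_gt0. Qed.

(** The kernel of the convolution after conjugation by e^(beta s), the q-th root
    of the factor in the radial density. *)
Definition log_kernel (t : R) : \bar R :=
  (profile Phi (expR t) * expR (beta * t))%:E.

Let mprofile : measurable_fun setT (profile Phi).
Proof.
apply: (measurableT_comp mPhi).
apply/measurable_fun_pairP; split; first exact: measurable_cst.
exact: exprn_measurable.
Qed.

Lemma measurable_log_kernel : measurable_fun setT log_kernel.
Proof.
apply/measurable_EFinP; apply: measurable_funM.
  exact: (measurableT_comp mprofile (@measurable_expR R)).
by apply: (measurableT_comp (@measurable_expR R)); exact: measurable_funM.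
Qed.

Lemma log_kernel_ge0 t : (0 <= log_kernel t)%E.
Proof. by rewrite lee_fin mulr_ge0 ?expR_ge0//; exact: Phi0. Qed.

(** The substitution t = e^s: the power of t in C_3 has exponent beta - 1. *)
Lemma C3_log_kernel : C3 alpha q gamma Phi = (\int[leb]_t log_kernel t)%E.
Proof.
rewrite /C3 integral_expR; last 2 first.
- apply/measurable_EFinP; apply: measurable_funM; first exact: mprofile.
  by under eq_fun do rewrite -powRN; exact: measurable_powR.
- by move=> x; rewrite lee_fin divr_ge0 ?powR_ge0//; exact: Phi0.
apply: eq_integral => t _; rewrite -EFinM /log_kernel; congr EFin.
rewrite -powRN expR_powR -mulrA -expRD; congr (_ * expR _).
by ring.
Qed.

Let B := sphere_Lnorm sigma (q / (q - 1)) Omega.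

Lemma sphere_normE :
  ((\int[S]_z ((Normc.normc (Omega (ang z)))%:E `^ (q / (q - 1)))) `^
     (q / (q - 1))^-1 = (fine B)%:E)%E.
Proof.
rewrite fineK ?ge0_fin_numE ?poweR_ge0// /B /sphere_Lnorm /cLnorm.
congr (_ `^ _)%E; rewrite integral_sphere.
- apply: eq_integral => z; rewrite inE => z1.
  by rewrite ang_id// poweR_EFin mulr1.
- apply: (measurableT_comp (measurable_poweR _)).
  by apply/measurable_EFinP; exact: measurable_normO.
- by move=> z; exact: poweR_ge0.
Qed.

Section fixed_function.
Variable f : H -> R[i].
Hypothesis mf : cmeasurable_fun setT f.
Let Nf (x : H) : \bar R := (Normc.normc (f x))%:E.
Let D := radial_density hsigma alpha q gamma Nf.
Let b := fine B.

Let mNf : measurable_fun setT Nf.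
Proof. by apply/measurable_EFinP; exact: (measurable_normc mf). Qed.
Let Nf0 x : (0 <= Nf x)%E.
Proof. by rewrite lee_fin normc_ge0. Qed.

(** Hoelder's inequality on the sphere. *)
Lemma sphere_pairing_le (t : R) :
  (sphere_pairing hsigma Omega f t <=
   b%:E * (\int[S]_y (Nf (dil (expR t) y) `^ q)) `^ q^-1)%E.
Proof.
have mO := measurable_normO mOmega.
have mft : measurable_fun setT (fun y => Normc.normc (f (dil (expR t) y))).
  exact: (measurableT_comp (measurable_normc mf) (measurable_dilr _)).
have conj : (q / (q - 1))^-1 + q^-1 = 1.
  by field; rewrite subr_eq0 !gt_eqF.
have := hoelder S mO mft q'0 q0 conj; rewrite Lnorm1 unlock => le.
apply: le_trans (le_trans _ le) _; rewrite le_eqVlt; apply/orP; left; apply/eqP.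
  apply: eq_integral => z _.
  by rewrite /= ger0_norm// mulr_ge0// normc_ge0.
congr (_ * _ `^ _)%E; last first.
  by apply: eq_integral => z _; rewrite /= ger0_norm ?normc_ge0.
rewrite -sphere_normE; congr (_ `^ _)%E.
by apply: eq_integral => z _; rewrite /= ger0_norm ?normc_ge0.
Qed.

(** The image being radial, the integral over the sphere yields the mass of the
    sphere. The factor e^(beta s) splits into e^(beta (s-t)), which completes
    the kernel, and e^(beta t), which turns Hoelder's bound into the density
    of f. *)
Lemma abs_hausdorff_density_le (s : R) :
  (radial_density hsigma alpha q gamma (abs_hausdorff Phi Omega f) s <=
   (fine (sigma hsphere) * b `^ q)%:E *
   (\int[leb]_t (log_kernel t * D (s - t)%R `^ q^-1)) `^ q)%E.
Proof.
have b0 : 0 <= b by apply: fine_ge0; exact: poweR_ge0.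
pose G := sphere_pairing hsigma Omega f.
pose A1 := (\int[leb]_t ((profile Phi (expR (s - t)))%:E * G t))%E.
have A10 : (0 <= A1)%E.
  apply: integral_ge0 => t _; apply: mule_ge0; last exact: sphere_pairing_ge0.
  by rewrite lee_fin; exact: Phi0.
have mA := measurable_abs_hausdorff mPhi mOmega mf.
have A0 x : (0 <= abs_hausdorff Phi Omega f x)%E by exact: abs_hausdorff_ge0.
have -> : radial_density hsigma alpha q gamma (abs_hausdorff Phi Omega f) s =
    ((fine (sigma hsphere))%:E * ((expR (beta * s))%:E * A1) `^ q)%E.
  rewrite /radial_density poweRM ?lee_fin ?expR_ge0// poweR_EFin expR_powR.
  rewrite muleCA [q * _]mulrCA mulrA; congr (_ * _)%E.
  have -> : (\int[S]_y (abs_hausdorff Phi Omega f (dil (expR s) y) `^ q) =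
      \int[S]_y (cst (A1 `^ q) y))%E.
    apply: eq_integral_sphere.
    - apply: (measurableT_comp (measurable_poweR _)).
      exact: (measurableT_comp mA (measurable_dilr _)).
    - by move=> y; exact: poweR_ge0.
    - exact: measurable_cst.
    - by move=> y; exact: poweR_ge0.
    - by move=> y y1; rewrite (abs_hausdorff_polar hsigma mPhi Phi0 rPhi mOmega mf).
  rewrite integral_cst// muleC; congr (_ * _)%E.
  rewrite fineK ?ge0_fin_numE ?(sphere_measure_lty hsigma)//.
  by rewrite /= /mfrestr /mrestr setTI.
rewrite EFinM -muleA; apply: lee_wpmul2l.
  by rewrite lee_fin fine_ge0.
have mD : measurable_fun setT D by exact: measurable_radial_density.
have D0 t : (0 <= D t)%E by exact: radial_density_ge0.
have mDq : measurable_fun setT (fun t => D t `^ q^-1)%E.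
  exact: measurableT_comp (measurable_poweR _) mD.
have mk := measurable_log_kernel; have k0 := log_kernel_ge0.
have mst : measurable_fun setT (fun t : R => s - t) by exact: measurable_funB.
have mks := measurableT_comp mk mst.
have Dq0 t : (0 <= D t `^ q^-1)%E by exact: poweR_ge0.
have -> : (\int[leb]_t (log_kernel t * D (s - t)%R `^ q^-1) =
    \int[leb]_t (log_kernel (s - t)%R * D t `^ q^-1))%E.
  rewrite -(integral_reflect s (emeasurable_funM mk (measurableT_comp mDq mst))
    (fun t => mule_ge0 (k0 _) (Dq0 _))).
  by apply: eq_integral => t _; rewrite /= subKr.
have I0 : (0 <= \int[leb]_t (log_kernel (s - t)%R * D t `^ q^-1))%E.
  by apply: integral_ge0 => t _; exact: mule_ge0 (k0 _) (Dq0 _).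
have E0 : (0 <= (expR (beta * s))%:E)%E by rewrite lee_fin expR_ge0.
have bE0 : (0 <= b%:E)%E by rewrite lee_fin.
rewrite -poweR_EFin -(poweRM _ bE0 I0).
apply: le_poweR; [exact: ltW|exact: mule_ge0|].
have mG : measurable_fun setT G.
  apply: (@measurable_fun_fubini_tonelli_F _ _ _ _ _ S
    (fun z => (Normc.normc (Omega (ang z.2)) * Normc.normc (f (dil (expR z.1) z.2)))%:E)) => [|z].
    apply/measurable_EFinP; apply: measurable_funM.
      exact: (measurableT_comp (measurable_normO mOmega) measurable_snd).
    exact: (measurable_dil_expR (measurable_normc mf)).
  by rewrite lee_fin mulr_ge0// normc_ge0.
have mphi : measurable_fun setT (fun t : R => (profile Phi (expR (s - t)))%:E).
  apply/measurable_EFinP; apply: (measurableT_comp mprofile).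
  exact: (measurableT_comp (@measurable_expR R) mst).
have phi0 t : (0 <= (profile Phi (expR (s - t)))%:E)%E by rewrite lee_fin; exact: Phi0.
have G0 t : (0 <= G t)%E by exact: sphere_pairing_ge0.
have mpG := emeasurable_funM mphi mG.
have mkD := emeasurable_funM mks mDq.
rewrite /A1 -(ge0_integralZl leb measurableT mpG (fun t _ => mule_ge0 (phi0 t) (G0 t)) E0).
rewrite -(ge0_integralZl leb measurableT mkD (fun t _ => mule_ge0 (k0 _) (Dq0 t)) bE0).
apply: ge0_le_integral.
- exact: measurableT.
- by move=> t _; exact: mule_ge0 E0 (mule_ge0 (phi0 t) (G0 t)).
- exact: emeasurable_funM.
- exact: emeasurable_funM.
move=> t _.
have P0 : (0 <= \int[S]_y (Nf (dil (expR t) y) `^ q))%E.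
  by apply: integral_ge0 => y _; exact: poweR_ge0.
have -> : (D t `^ q^-1 = (expR (beta * t))%:E *
    (\int[S]_y (Nf (dil (expR t) y) `^ q)) `^ q^-1)%E.
  rewrite /D /radial_density poweRM ?lee_fin ?expR_ge0// poweR_EFin expR_powR.
  by congr ((expR _)%:E * _)%E; field; rewrite gt_eqF.
have Es : (expR (beta * s))%:E = ((expR (beta * (s - t)))%:E * (expR (beta * t))%:E)%E.
  by rewrite -EFinM -expRD; congr (expR _)%:E; ring.
rewrite Es [(_ \o _) t]/= /log_kernel EFinM.
have := sphere_pairing_le t; rewrite -/G => le.
set E1 := (expR _)%:E; set E2 := (expR _)%:E; set F := (profile _ _)%:E.
rewrite (_ : E1 * E2 * (F * G t) = F * E1 * E2 * G t)%E; last first.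
  by rewrite muleA; congr (_ * _)%E; rewrite muleC muleA.
rewrite (_ : _ * (_ * (E2 * _)) = F * E1 * E2 *
  (b%:E * (\int[S]_y (Nf (dil (expR t) y) `^ q)) `^ q^-1))%E; last first.
  by rewrite muleCA -[RHS]muleA; congr (_ * _)%E; rewrite muleCA.
apply: lee_wpmul2l => //; apply: mule_ge0; last by rewrite lee_fin expR_ge0.
by apply: mule_ge0; rewrite ?phi0// lee_fin expR_ge0.
Qed.

Lemma herz_sum_abs_hausdorff (K : R) : 0 < K -> (\int[leb]_t log_kernel t <= K%:E)%E ->
  (herz_sum alpha p q gamma (abs_hausdorff Phi Omega f) <=
   (2 `^ (`|alpha| * p) * ((fine (sigma hsphere) * b `^ q) `^ (p / q) *
      (2 * 2 `^ (p / q) * K `^ p) * 2 `^ (`|alpha| * p)))%:E *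
   herz_sum alpha p q gamma Nf)%E.
Proof.
move=> K0 kK; have b0 : 0 <= b by apply: fine_ge0; exact: poweR_ge0.
have mA := measurable_abs_hausdorff mPhi mOmega mf.
have A0 x : (0 <= abs_hausdorff Phi Omega f x)%E by exact: abs_hausdorff_ge0.
have [leA _] := herz_sum_amalgam hsigma alpha gamma hp hq mA A0.
have [_ leN] := herz_sum_amalgam hsigma alpha gamma hp hq mNf Nf0.
have mD : measurable_fun setT D by exact: measurable_radial_density.
have D0 t : (0 <= D t)%E by exact: radial_density_ge0.
have mDq : measurable_fun setT (fun t => D t `^ q^-1)%E.
  exact: measurableT_comp (measurable_poweR _) mD.
have DK t : ((D t `^ q^-1) `^ q = D t)%E.
  by rewrite -poweRrM mulVf ?gt_eqF// poweRe1.
have young := amalgam_young hp (ltW hq) K0 measurable_log_kernel log_kernel_ge0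
  mDq (fun t => poweR_ge0 _ _) kK.
pose c := fine (sigma hsphere) * b `^ q.
have c0 : 0 <= c by rewrite mulr_ge0 ?powR_ge0// fine_ge0.
have M0 : (0 <= (2 `^ (`|alpha| * p))%:E)%E by rewrite lee_fin powR_ge0.
have pq0 : 0 <= p / q by rewrite divr_ge0 ?(ltW p0) ?(ltW q0).
have mconv : measurable_fun setT
    (fun s : R => (\int[leb]_t (log_kernel t * D (s - t)%R `^ q^-1)) `^ q)%E.
  apply: (measurableT_comp (measurable_poweR _)).
  exact: (measurable_convolution measurable_log_kernel log_kernel_ge0 mDq
    (fun t => poweR_ge0 _ _)).
have conv0 (s : R) : (0 <= (\int[leb]_t (log_kernel t * D (s - t)%R `^ q^-1)) `^ q)%E.
  exact: poweR_ge0.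
apply: le_trans leA _; rewrite EFinM -muleA; apply: lee_wpmul2l => //.
apply: (@le_trans _ _ ((c `^ (p / q))%:E * \esum_(k in [set: int])
    ((\int[leb]_(s in log_shell k)
      ((\int[leb]_t (log_kernel t * D (s - t)%R `^ q^-1)) `^ q)) `^ (p / q)))%E).
  rewrite -esumZl; [|exact: powR_ge0|by move=> k; exact: poweR_ge0].
  apply: le_esum => k _; rewrite -poweR_EFin -poweRM ?lee_fin//; last first.
    by apply: integral_ge0 => s _; exact: conv0.
  apply: le_poweR => //.
    by apply: integral_ge0 => s _; exact: radial_density_ge0.
  rewrite -ge0_integralZl//; last 2 first.
  - exact: measurable_log_shell.
  - exact: measurable_funTS.
  apply: ge0_le_integral.
  - exact: measurable_log_shell.
  - by move=> s _; exact: radial_density_ge0.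
  - by apply: measurable_funTS; exact: measurable_radial_density.
  - by apply: measurable_funTS; apply: emeasurable_funM.
  - by move=> s _; exact: abs_hausdorff_density_le.
rewrite -/c -mulrA EFinM -muleA; apply: lee_wpmul2l.
  by rewrite lee_fin powR_ge0.
rewrite EFinM -muleA; apply: le_trans young _; apply: lee_wpmul2l.
  by rewrite lee_fin !mulr_ge0 ?powR_ge0.
apply: le_trans leN; rewrite le_eqVlt; apply/orP; left; apply/eqP.
by apply: eq_esum => k _; congr (_ `^ _)%E; apply: eq_integral => s _; exact: DK.
Qed.

End fixed_function.
End upper_bound.

(** * Functions homogeneous on an annulus *)

Section annular_functions.
Context {R : realType} {n : nat}.
Variable sigma : {measure set (heis R n) -> \bar R}.
Hypothesis hsigma : polar_measure sigma.
Variables alpha p q gamma : R.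
Hypotheses (hp : 1 <= p) (hq : 1 < q).
Local Notation H := (heis R n).
Local Notation S := (mfrestr measurable_hsphere (sphere_measure_lty hsigma)).
Local Notation beta := (alpha + ((hdim n)%:R + gamma) / q).
Local Notation L := (ln 2 : R).

Let p0 : 0 < p. Proof. exact: lt_le_trans hp. Qed.
Let q0 : 0 < q. Proof. exact: lt_trans hq. Qed.

Definition log_annulus (N : nat) : set R := `]- (N%:R * L), N%:R * L]%classic.

Lemma measurable_log_annulus N : measurable (log_annulus N).
Proof. exact: measurable_itv. Qed.

(** Homogeneous of degree -beta on the shells C_k with -N < k <= N: the radial
    density is then constant there, and all 2N shells carry the same norm. The
    last factor settles the value at the origin, where ln is meaningless. *)
Definition annular_fun (rho : H -> R) (N : nat) (x : H) : R :=
  rho (ang x) * hnorm x `^ (- beta) * \1_(log_annulus N) (ln (hnorm x)) * (x != 0)%:R.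

Lemma annular_fun_ge0 (rho : H -> R) N x : (forall y, 0 <= rho y) ->
  0 <= annular_fun rho N x.
Proof. by move=> r0; rewrite !mulr_ge0// powR_ge0. Qed.

Lemma measurable_annular_weight N : measurable_fun setT (fun x : H =>
  hnorm x `^ (- beta) * \1_(log_annulus N) (ln (hnorm x)) * (x != 0)%:R).
Proof.
apply: measurable_fun_punctured.
apply: (eq_measurable_fun (fun x : H =>
    hnorm x `^ (- beta) * \1_(log_annulus N) (ln (hnorm x)))).
  by move=> x; rewrite inE /= => /eqP ->; rewrite mulr1.
apply: measurable_funTS; apply: measurable_funM.
  exact: (measurableT_comp (measurable_powR _) measurable_hnorm).
have m : measurable_fun setT (\1_(log_annulus N) : R -> R).
  exact: measurable_indic (measurable_log_annulus N).
apply: (measurableT_comp m).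
exact: (measurableT_comp (@measurable_ln R) measurable_hnorm).
Qed.

Lemma measurable_annular_fun (rho : H -> R) N :
  measurable_fun hsphere rho -> measurable_fun setT (annular_fun rho N).
Proof.
move=> mr; rewrite /annular_fun.
under eq_fun do rewrite -!mulrA [X in _ * X]mulrA.
apply: measurable_funM; first exact: (measurable_comp_ang mr).
exact: measurable_annular_weight.
Qed.

Lemma annular_fun_polar (rho : H -> R) N (s : R) (y : H) : hsphere y ->
  annular_fun rho N (dil (expR s) y) =
  rho y * expR (- beta * s) * \1_(log_annulus N) s.
Proof.
move=> y1; rewrite /annular_fun ang_dil ?expR_gt0// hnorm_dil_expR// expRK.
by rewrite dil_neq0// mulr1 expR_powR.
Qed.

Lemma annular_density (rho : H -> R) N (s : R) :
  measurable_fun hsphere rho -> (forall y, 0 <= rho y) ->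
  radial_density hsigma alpha q gamma (fun x => (annular_fun rho N x)%:E) s =
  ((\1_(log_annulus N) s)%:E * \int[S]_y ((rho (ang y))%:E `^ q))%E.
Proof.
move=> mr r0; have mra := measurable_comp_ang mr.
have mrq : measurable_fun setT (fun y : H => (rho (ang y))%:E `^ q)%E.
  by apply: (measurableT_comp (measurable_poweR _)); exact/measurable_EFinP.
have rq0 y : (0 <= (rho (ang y))%:E `^ q)%E by exact: poweR_ge0.
have c0 (c : R) : 0 <= c -> (0 <= c%:E)%E by rewrite lee_fin.
rewrite /radial_density.
rewrite (_ : \int[S]_y _ = (expR (- beta * q * s) * \1_(log_annulus N) s)%:E *
    \int[S]_y ((rho (ang y))%:E `^ q))%E.
  rewrite muleA -EFinM mulrA -expRD; congr (_ %:E * _)%E.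
  by rewrite (_ : beta * q * s + - beta * q * s = 0) ?expR0 ?mul1r//; ring.
have e0 : (0 <= (expR (- beta * q * s) * \1_(log_annulus N) s)%:E)%E.
  by rewrite lee_fin mulr_ge0// expR_ge0.
rewrite -(ge0_integralZl S measurableT mrq (fun y _ => rq0 y) e0).
apply: eq_integral_sphere.
- apply: (measurableT_comp (measurable_poweR _)); apply/measurable_EFinP.
  exact: (measurableT_comp (measurable_annular_fun N mr) (measurable_dilr _)).
- by move=> y; exact: poweR_ge0.
- exact: emeasurable_funM.
- by move=> y; exact: mule_ge0 e0 (rq0 y).
move=> y y1; rewrite annular_fun_polar// ang_id// !poweR_EFin -EFinM; congr EFin.
rewrite powRM ?mulr_ge0 ?expR_ge0// powRM ?expR_ge0// expR_powR.
have -> : (\1_(log_annulus N) s : R) `^ q = \1_(log_annulus N) s.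
  by rewrite indicE; case: (_ \in _); rewrite ?powR1// powR0 ?gt_eqF.
have -> : q * (- beta * s) = - beta * q * s by ring.
by ring.
Qed.

Lemma esum_interval (c : R) (N : nat) : 0 <= c ->
  (\esum_(k in [set: int]) (if (- N%:Z < k <= N%:Z)%R then c%:E else 0) =
   (N.*2%:R * c)%:E)%E.
Proof.
move=> c0; pose I := [set k : int | - N%:Z < k <= N%:Z].
transitivity (\esum_(k in I) c%:E).
  rewrite [RHS]esum_mkcond; apply: eq_esum => k _.
  by rewrite /I; case: ifPn => h; [rewrite mem_set|rewrite memNset//; exact/negP].
pose e (i : nat) : int := i%:Z + 1 - N%:Z.
rewrite (@reindex_esum _ _ _ `I_(N.*2) _ e).
  rewrite esum_fset => [||i _]; [|exact: finite_II|by rewrite lee_fin].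
  rewrite -(fsbig_ord _ _ (fun=> c%:E)).
  by rewrite sumEFin sumr_const card_ord mulr_natl.
split.
- by move=> i /= iN; rewrite /I /e /=; lia.
- by move=> i j _ _; rewrite /e; lia.
- move=> k; rewrite /I /= => /andP[k1 k2].
  by exists (absz (k - 1 + N%:Z)); rewrite /e /=; lia.
Qed.

Lemma annular_amalgam (rho : H -> R) N (x : R) :
  measurable_fun hsphere rho -> (forall y, 0 <= rho y) -> 0 <= x ->
  (\int[S]_y ((rho (ang y))%:E `^ q) = x%:E)%E ->
  amalgam_sum p q (radial_density hsigma alpha q gamma
    (fun z => (annular_fun rho N z)%:E)) =
  (N.*2%:R * (L * x) `^ (p / q))%:E.
Proof.
move=> mr r0 x0 xE; have L0 : 0 < L by exact: ln2_gt0.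
rewrite -esum_interval ?powR_ge0//; apply: eq_esum => k _.
under eq_integral do rewrite annular_density// xE.
have mk := @measurable_log_shell R k; have mA := measurable_log_annulus N.
rewrite ge0_integralZr//; last exact/measurable_EFinP/measurable_funTS.
rewrite (_ : \int[leb]_(s in _) _ = if (- N%:Z < k <= N%:Z)%R then L%:E else 0)%E.
  case: ifPn => kN; first by rewrite -EFinM poweR_EFin.
  by rewrite mul0e poweR0r// gt_eqF// divr_gt0.
rewrite integral_indic//; case: ifPn => kN.
  rewrite setIC setIidl; first exact: lebesgue_log_shell.
  move=> s; rewrite /log_shell /log_annulus /= !in_itv/= => /andP[h1 h2].
  have [h3 h4] : - N%:R <= k%:~R - 1 :> R /\ k%:~R <= N%:R :> R.
    by rewrite -![N%:R]/((N%:Z)%:~R) -intrN -(intrB _ k 1) !ler_int; lia.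
  by apply/andP; split; nra.
rewrite (_ : _ `&` _ = set0) ?measure0//; apply/seteqP; split => // s.
rewrite /log_shell /log_annulus /= !in_itv/= => -[/andP[h1 h2] /andP[h3 h4]].
have [h|h] : k <= - N%:Z \/ N%:Z <= k - 1 by lia.
  have : k%:~R <= - N%:R :> R by rewrite -[N%:R]/((N%:Z)%:~R) -intrN ler_int.
  nra.
have : N%:R <= k%:~R - 1 :> R by rewrite -[N%:R]/((N%:Z)%:~R) -(intrB _ k 1) ler_int.
nra.
Qed.

End annular_functions.

(** * Consequences of a finite Herz norm *)

Section local_integrability.
Context {R : realType} {n : nat}.
Variables alpha p q gamma : R.
Hypotheses (hp : 1 <= p) (hq : 1 < q).
Local Notation H := (heis R n).
Local Notation Leb := (@lebesgue_heis R n).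

(** Here A can be any set, such as a compact one, for which membership in the
    product sigma-algebra is a separate matter. *)
Lemma ge0_le_integral_restrict d (T : measurableType d)
    (mu : {measure set T -> \bar R}) (A : set T) (f g : T -> \bar R) :
  (forall x, 0 <= f x)%E -> (forall x, 0 <= g x)%E ->
  (forall x, A x -> f x <= g x)%E ->
  (\int[mu]_(x in A) f x <= \int[mu]_x g x)%E.
Proof.
move=> f0 g0 fg; rewrite integral_mkcond.
have fA0 x : (0 <= (f \_ A) x)%E by rewrite patchE; case: ifP.
rewrite ge0_integralE// [leRHS]ge0_integralE//.
apply: le_ereal_sup => _ [h hf <-]; exists h => // x.
apply: le_trans (hf x) _; rewrite patch_setT patchE; case: ifPn => [|_].
  by rewrite inE patch_setT => /fg.
by rewrite patch_setT.
Qed.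

Lemma herz_sum_shell_lty (N : H -> \bar R) (k : int) :
  (herz_sum alpha p q gamma N < +oo)%E ->
  (\int[Leb]_(x in hshell k) (N x `^ q * (hnorm x `^ gamma)%:E) < +oo)%E.
Proof.
have p0 : 0 < p by exact: lt_le_trans hp.
have q0 : 0 < q by exact: lt_trans hq.
move=> Nfin; have tfin : ((2 `^ (k%:~R * alpha * p))%:E *
    (\int[Leb]_(x in hshell k) (N x `^ q * (hnorm x `^ gamma)%:E)) `^ (p / q) < +oo)%E.
  apply: le_lt_trans Nfin; apply: esum_ge; exists [set k].
    by split => //; exact: finite_set1.
  by rewrite fsbig_set1.
apply: (@lty_poweRy _ _ (p / q)); first by rewrite gt_eqF ?divr_gt0.
rewrite ltey; apply/negP => /eqP Iy; move: tfin; rewrite Iy.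
by rewrite gt0_muley ?lte_fin ?powR_gt0// ltxx.
Qed.

(** A compact set that avoids the origin meets only finitely many shells. *)
Lemma Lq_loc_of_herz_sum (f : H -> R[i]) : cmeasurable_fun setT f ->
  (herz_sum alpha p q gamma (fun x => (Normc.normc (f x))%:E) < +oo)%E ->
  Lq_loc (power_weight gamma) q f.
Proof.
move=> mf ffin; split => // K cK K0.
have [m Km] := compact_hnorm_bounds cK K0.
pose F (x : H) : \bar R := (Normc.normc (f x) `^ q * hnorm x `^ gamma)%:E.
have F0 x : (0 <= F x)%E by rewrite lee_fin mulr_ge0 ?powR_ge0.
have mF : measurable_fun setT F.
  apply/measurable_EFinP; apply: measurable_funM.
    exact: (measurableT_comp (measurable_powR _) (measurable_normc mf)).
  exact: (measurableT_comp (measurable_powR _) measurable_hnorm).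
(* the 2m shells that K can meet, those with -m < k <= m *)
pose k (i : nat) : int := i%:Z + 1 - m%:Z.
have shell i : (\int[Leb]_(x in hshell (k i)) F x < +oo)%E.
  exact: herz_sum_shell_lty (k i) ffin.
have mFi i : measurable_fun setT (F \_ (hshell (k i))).
  exact/(measurable_restrictT _ (measurable_hshell (k i)))/measurable_funTS.
have Fi0 i x : (0 <= (F \_ (hshell (k i))) x)%E by rewrite patchE; case: ifP.
apply: (@le_lt_trans _ _ (\int[Leb]_x (\sum_(i < m.*2) (F \_ (hshell (k i))) x))%E).
  apply: ge0_le_integral_restrict => [x|x|x Kx].
  - exact: F0.
  - by apply: sume_ge0.
  have /andP[x1 x2] := Km _ Kx.
  have x0 : x != 0 by apply/eqP => x0; exact/K0/(eq_ind _ K Kx).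
  have [j jx] := hshell_cover x0.
  have := hnorm_gt0 x0 => hx; pose s := ln (hnorm x).
  have xs : hnorm x = expR s by rewrite lnK.
  have /(hshell_expR _ xs) := jx; rewrite /log_shell /= in_itv/= => /andP[j1 j2].
  move: x1 x2; rewrite xs !exp2_expR ltr_expR ler_expR => x1 x2.
  have L0 : 0 < ln 2 :> R by exact: ln2_gt0.
  have jm1 : - m%:Z < j.
    by rewrite -(ltr_int R) -(ltr_pM2r L0); exact: lt_le_trans x1 j2.
  have jm2 : j - 1 < m%:Z.
    by rewrite -(ltr_int R) -(ltr_pM2r L0) intrB; exact: lt_le_trans j1 x2.
  have [im kj] : (absz (j + m%:Z - 1)%R < m.*2)%N /\
      (absz (j + m%:Z - 1)%R)%:Z + 1 - m%:Z = j.
    by move: jm1 jm2; clear; lia.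
  rewrite (bigD1 (Ordinal im))//= patchE (_ : k _ = j); last exact: kj.
  by rewrite mem_set// leeDl// sume_ge0.
rewrite ge0_integral_sum//; apply: lte_sum_pinfty => i _.
by rewrite -integral_mkcond; exact: shell.
Qed.

(** The origin lies in boxes of arbitrarily small measure. *)
Lemma lebesgue_heis0 : {ae Leb, forall x, x != 0}.
Proof.
have m0 : measurable [set 0 : H] by exact: measurable_heis1.
exists [set 0]; split => // [|x /= /negP/negPn/eqP//].
apply/eqP; rewrite eq_le measure_ge0 andbT; apply/lee_addgt0Pr => e e0.
have h0 : (0 : R) < 2^-1 by rewrite invr_gt0.
have -> : (0 + e%:E = (((2 * 2^-1) ^+ (2 * n) * (2 * (2^-1 * e)))%R)%:E)%E.
  by rewrite add0e mulfV ?gt_eqF// expr1n mul1r mulrA mulfV ?gt_eqF// mul1r.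
rewrite -(lebesgue_heis_box h0 (mulr_gt0 h0 e0)).
apply: le_measure; rewrite ?inE//; first exact: measurable_heis_box.
move=> _ -> /=; split => [i|] /=; rewrite ?mxE in_itv/= oppr_le0.
  by rewrite (ltW h0).
by rewrite mulr_ge0// ltW.
Qed.

(** A finite integral over a shell forces N to be finite almost everywhere there,
    the weight being positive, and countably many shells cover everything but
    the origin. *)
Lemma herz_sum_ae_fin (N : H -> \bar R) :
  measurable_fun setT N -> (forall x, 0 <= N x)%E ->
  (herz_sum alpha p q gamma N < +oo)%E -> {ae Leb, forall x, N x < +oo}%E.
Proof.
move=> mN N0 Nfin; have q0 : 0 < q by exact: lt_trans hq.
pose F (x : H) : \bar R := (N x `^ q * (hnorm x `^ gamma)%:E)%E.
have F0 x : (0 <= F x)%E by rewrite mule_ge0 ?poweR_ge0// lee_fin powR_ge0.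
have mF : measurable_fun setT F.
  apply: emeasurable_funM; first exact: measurableT_comp (measurable_poweR _) mN.
  apply/measurable_EFinP.
  exact: (measurableT_comp (measurable_powR _) measurable_hnorm).
have Fk k : {ae Leb, forall x, hshell k x -> F x \is a fin_num}.
  apply: integrable_ae; first exact: measurable_hshell.
  apply/integrableP; split; first exact: measurable_funTS.
  under eq_integral do rewrite gee0_abs//.
  exact: herz_sum_shell_lty k Nfin.
(* the shells, indexed by the integers, are listed as two sequences *)
have Fpos : {ae Leb, forall x, forall i : nat, hshell i%:Z x -> F x \is a fin_num}.
  by apply: ae_foralln => i; exact: Fk.
have Fneg : {ae Leb, forall x, forall i : nat, hshell (Negz i) x -> F x \is a fin_num}.
  by apply: ae_foralln => i; exact: Fk.
apply: filterS3 lebesgue_heis0 Fpos Fneg => x x0 h1 h2.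
have [k xk] := hshell_cover x0.
have Ff : F x \is a fin_num by case: k xk => i; [exact: h1|exact: h2].
rewrite ltey; apply/eqP => Nx; move: Ff; rewrite /F Nx poweRyr ?gt_eqF//.
by rewrite gt0_mulye// lte_fin powR_gt0// hnorm_gt0.
Qed.

End local_integrability.

(** * Lower bound *)

Section lower_bound.
Context {R : realType} {n : nat}.
Variable sigma : {measure set (heis R n) -> \bar R}.
Hypothesis hsigma : polar_measure sigma.
Variables alpha p q gamma : R.
Hypotheses (hp : 1 <= p) (hq : 1 < q).
Local Notation H := (heis R n).
Local Notation Leb := (@lebesgue_heis R n).
Local Notation S := (mfrestr measurable_hsphere (sphere_measure_lty hsigma)).
Local Notation beta := (alpha + ((hdim n)%:R + gamma) / q).
Local Notation q' := (q / (q - 1)).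
Local Notation L := (ln 2 : R).
Variables (Phi : H -> R) (Omega : H -> R[i]).
Hypotheses (mPhi : measurable_fun setT Phi) (Phi0 : forall x, 0 <= Phi x).
Hypothesis (rPhi : radial Phi).
Hypothesis (mOmega : cmeasurable_fun hsphere Omega).
Hypothesis (neqOmega : {ae sigma, forall y, hsphere y -> Omega y != 0}).
Hypothesis (finOmega : (sphere_Lnorm sigma (q / (q - 1)) Omega < +oo)%E).

Let p0 : 0 < p. Proof. exact: lt_le_trans hp. Qed.
Let q0 : 0 < q. Proof. exact: lt_trans hq. Qed.
Let q'0 : 0 < q'. Proof. by rewrite divr_gt0// subr_gt0. Qed.

Let b := fine (sphere_Lnorm sigma q' Omega).
Let b0 : 0 <= b. Proof. by apply: fine_ge0; exact: poweR_ge0. Qed.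

Let normO (y : H) : R := Normc.normc (Omega y).

(** Otherwise Omega would vanish almost everywhere on the sphere, which would
    then be a null set. *)
Lemma sphere_Lnorm_gt0 : (0 < sphere_Lnorm sigma q' Omega)%E.
Proof.
rewrite lt0e poweR_ge0 andbT; apply/negP => /eqP B0.
have mS := measurable_hsphere (R := R) (n := n).
have mF : measurable_fun hsphere (fun y => (normO y `^ q' * cst 1 y)%:E).
  apply/measurable_EFinP; apply: measurable_funM => //.
  exact: (measurableT_comp (measurable_powR _) (measurable_normc mOmega)).
have F0 y : (0 <= (normO y `^ q' * cst 1 y)%:E)%E.
  by rewrite lee_fin mulr_ge0// powR_ge0.
have I0 : (\int[sigma]_(y in hsphere) `|(normO y `^ q' * cst 1 y)%:E| = 0)%E.
  have Ige : (0 <= \int[sigma]_(y in hsphere) (normO y `^ q' * cst 1%R y)%:E)%E.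
    by apply: integral_ge0 => y _; exact: F0.
  rewrite -[RHS](poweR_eq0_eq0 Ige B0).
  by apply: eq_integral => y _; rewrite gee0_abs.
have /(ae_eq_integral_abs sigma mS mF) ae0 := I0.
have : {ae sigma, forall y, ~ hsphere y}.
  apply: filterS2 ae0 neqOmega => y h1 h2 y1.
  move: (h1 y1) => /= [] /eqP; rewrite mulr1 powR_eq0 => /andP[/eqP/Normc.eq0_normc O0 _].
  by move: (h2 y1); rewrite O0 eqxx.
move=> [A [mA A0 SA]].
have : (sigma hsphere <= sigma A)%E.
  by apply: le_measure; rewrite ?inE// => y y1; apply: SA => /=; exact.
by rewrite A0 leNgt sphere_measure_gt0.
Qed.

Let bgt0 : 0 < b.
Proof.
rewrite /b fine_gt0// sphere_Lnorm_gt0; exact: finOmega.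
Qed.

(** The angular factor |Omega|^(q'-1) of the modulus of the test function. *)
Let rho (y : H) : R := normO y * normO y `^ (q' - 2).

Let rho0 y : 0 <= rho y.
Proof. by rewrite mulr_ge0 ?powR_ge0// normc_ge0. Qed.

Let mrho : measurable_fun hsphere rho.
Proof.
have mO := measurable_normc mOmega.
apply: measurable_funM => //.
exact: (measurableT_comp (measurable_powR _) mO).
Qed.

(** The extremal function of Hoelder's inequality on the sphere, extended to an
    annulus with the homogeneity that makes its radial density constant. *)
Definition test_fun (N : nat) (x : H) : R[i] :=
  (Omega (ang x))^*%C *
  (normO (ang x) `^ (q' - 2) *
   (hnorm x `^ (- beta) * \1_(log_annulus N) (ln (hnorm x)) * (x != 0)%:R))%:C%C.

Let weight N (x : H) : R :=
  hnorm x `^ (- beta) * \1_(log_annulus N) (ln (hnorm x)) * (x != 0)%:R.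

Let weight0 N x : 0 <= normO (ang x) `^ (q' - 2) * weight N x.
Proof. by rewrite !mulr_ge0 ?powR_ge0. Qed.

Lemma normc_test_fun N x :
  Normc.normc (test_fun N x) = annular_fun alpha q gamma rho N x.
Proof.
rewrite /test_fun Normc.normcM /annular_fun /rho -!mulrA; congr (_ * _).
  by rewrite /normO; case: (Omega _) => u v /=; rewrite sqrrN.
rewrite /= expr0n addr0 sqrtr_sqr ger0_norm; first by rewrite !mulrA.
by have := weight0 N x; rewrite /weight !mulrA.
Qed.

Lemma measurable_test_fun N : cmeasurable_fun setT (test_fun N).
Proof.
case: mOmega => mRe mIm.
have mw : measurable_fun setT (fun x => normO (ang x) `^ (q' - 2) * weight N x).
  apply: measurable_funM; last exact: measurable_annular_weight.
  apply: (measurableT_comp (measurable_powR _)).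
  exact: (measurable_comp_ang (measurable_normc mOmega)).
split.
  apply: (eq_measurable_fun (fun x => complex.Re (Omega (ang x)) *
      (normO (ang x) `^ (q' - 2) * weight N x))).
    by move=> x _; rewrite /test_fun /weight; case: (Omega _) => u v /=; rewrite mulr0 subr0.
  by apply: measurable_funM => //; exact: (measurable_comp_ang mRe).
apply: (eq_measurable_fun (fun x => - complex.Im (Omega (ang x)) *
    (normO (ang x) `^ (q' - 2) * weight N x))).
  by move=> x _; rewrite /test_fun /weight; case: (Omega _) => u v /=; rewrite mulr0 add0r.
by apply: measurable_funM => //; apply: measurable_funN; exact: (measurable_comp_ang mIm).
Qed.

(** The conjugate of Omega cancels the phase, so the operator and its version
    with absolute values agree on the test function. *)
Lemma Re_integrand_test_fun N x y :
  complex.Re (hausdorff_integrand Phi Omega (test_fun N) x y) =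
  Normc.normc (hausdorff_integrand Phi Omega (test_fun N) x y).
Proof.
rewrite normcK// normc_test_fun /annular_fun /hausdorff_integrand -/(ang y).
rewrite /test_fun /rho /normO.
rewrite (_ : Phi _ / _ = kernel_weight Phi (x, y))//.
case: (Omega (ang y)) => u v /=.
set s := Num.sqrt _; have ss : s * s = u ^+ 2 + v ^+ 2.
  by rewrite -expr2 sqr_sqrtr// addr_ge0 ?sqr_ge0.
set r := s `^ _; set w := kernel_weight Phi (x, y).
set z := _ `^ _; set i := \1__ _; set c := _%:R.
transitivity (w * r * z * i * c * (u ^+ 2 + v ^+ 2)); first by ring.
by rewrite -ss; ring.
Qed.

Lemma abs_hausdorff_test_fun_le N x :
  abs_integrable Leb setT (hausdorff_integrand Phi Omega (test_fun N) x) ->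
  (abs_hausdorff Phi Omega (test_fun N) x <=
   (Normc.normc (hausdorff Phi Omega (test_fun N) x))%:E)%E.
Proof.
move=> [_ fin]; have A0 := abs_hausdorff_ge0 Phi Omega (test_fun N) x.
have := Re_le_normc (hausdorff Phi Omega (test_fun N) x).
rewrite -lee_fin => le; apply: le_trans le.
rewrite /hausdorff /cintegral /= /Rintegral.
under eq_integral do rewrite Re_integrand_test_fun.
rewrite -/(abs_hausdorff Phi Omega (test_fun N) x).
by rewrite ger0_norm ?fine_ge0// fineK// ge0_fin_numE.
Qed.

Let sphere_power (g : H -> R) :
  (forall y, hsphere y -> g y = normO y `^ q') ->
  measurable_fun hsphere g -> (forall y, 0 <= g y) ->
  (\int[S]_y (g (ang y))%:E = (b `^ q')%:E)%E.
Proof.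
move=> gE mg g0.
have mO : measurable_fun setT (fun y => normO (ang y)).
  exact: (measurable_comp_ang (measurable_normc mOmega)).
have Ige : (0 <= \int[S]_z ((normO (ang z))%:E `^ q'))%E.
  by apply: integral_ge0 => z _; exact: poweR_ge0.
transitivity (\int[S]_z ((normO (ang z))%:E `^ q'))%E.
  apply: eq_integral_sphere.
  - by apply/measurable_EFinP; exact: (measurable_comp_ang mg).
  - by move=> y; rewrite lee_fin.
  - by apply: (measurableT_comp (measurable_poweR _)); exact/measurable_EFinP.
  - by move=> y; exact: poweR_ge0.
  - by move=> y y1; rewrite ang_id// gE// poweR_EFin.
rewrite -poweR_EFin -(sphere_normE hsigma mOmega finOmega).
by rewrite -poweRrM mulVf ?gt_eqF// poweRe1.
Qed.

Let powO (y : H) : normO y * (normO y * normO y `^ (q' - 2)) = normO y `^ q'.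
Proof.
have y0 : 0 <= normO y by exact: normc_ge0.
have [->|yn0] := eqVneq (normO y) 0; first by rewrite mul0r powR0// gt_eqF.
rewrite mulrA -expr2 -powR_mulrn// -powRD; last by rewrite yn0 implybT.
by congr (_ `^ _); ring.
Qed.

Let q'E : (q' - 1) * q = q'.
Proof. by field; rewrite subr_eq0 gt_eqF. Qed.

Let rho_power : (\int[S]_y ((rho (ang y))%:E `^ q) = (b `^ q')%:E)%E.
Proof.
under eq_integral do rewrite poweR_EFin.
apply: (@sphere_power (fun y => rho y `^ q)) => [y _||y]; last exact: powR_ge0.
  rewrite /rho; have y0 : 0 <= normO y by exact: normc_ge0.
  have [->|yn0] := eqVneq (normO y) 0.
    by rewrite mul0r !powR0 ?gt_eqF.
  rewrite -{1}(powRr1 y0) -powRD; last by rewrite yn0 implybT.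
  have -> : 1 + (q' - 2) = q' - 1 by ring.
  by rewrite -powRrM q'E.
exact: (measurableT_comp (measurable_powR _) mrho).
Qed.

Let sphere_pairing_test_fun N t :
  sphere_pairing hsigma Omega (test_fun N) t =
  (expR (- beta * t) * \1_(log_annulus N) t * b `^ q')%:E.
Proof.
rewrite EFinM -(sphere_power (g := fun y => normO y * rho y)).
- have mO := measurable_comp_ang (measurable_normc mOmega).
  have mr := measurable_comp_ang mrho.
  have mOr : measurable_fun setT (fun y => (normO (ang y) * rho (ang y))%:E).
    by apply/measurable_EFinP; exact: measurable_funM mO mr.
  have Or0 y : (0 <= (normO (ang y) * rho (ang y))%:E)%E.
    by rewrite lee_fin mulr_ge0// normc_ge0.
  have e0 : (0 <= (expR (- beta * t) * \1_(log_annulus N) t)%:E)%E.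
    by rewrite lee_fin mulr_ge0// expR_ge0.
  rewrite -(ge0_integralZl S measurableT mOr (fun y _ => Or0 y) e0).
  apply: eq_integral_sphere.
  + apply/measurable_EFinP; apply: measurable_funM => //.
    exact: (measurableT_comp (measurable_normc (measurable_test_fun N)) (measurable_dilr _)).
  + by move=> y; rewrite lee_fin mulr_ge0// normc_ge0.
  + exact: emeasurable_funM.
  + by move=> y; exact: mule_ge0 e0 (Or0 y).
  move=> y y1; rewrite normc_test_fun annular_fun_polar// ang_id// -EFinM.
  by congr EFin; rewrite /normO; ring.
- by move=> y _; rewrite /rho powO.
- exact: measurable_funM (measurable_normc mOmega) mrho.
- by move=> y; rewrite mulr_ge0// normc_ge0.
Qed.

(** For |s| <= M ln 2 and |t| <= M ln 2 the point s - t stays in the range of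
    radii of the test function, hence the convolution includes all of the
    kernel over the latter interval. *)
Lemma annular_le_abs_hausdorff (M : nat) (l : R) (x : H) : 0 <= l ->
  (l%:E <= \int[leb]_(t in log_annulus M) log_kernel alpha q gamma Phi t)%E ->
  ((annular_fun alpha q gamma (cst (l * b `^ q')%R) M x)%:E <=
   abs_hausdorff Phi Omega (test_fun (M + M)) x)%E.
Proof.
move=> l0 lM; have L0 : 0 < L by exact: ln2_gt0.
have [->|x0] := eqVneq x 0.
  by rewrite /annular_fun eqxx mulr0 abs_hausdorff_ge0.
have hx := hnorm_gt0 x0; pose s := ln (hnorm x).
have -> : x = dil (expR s) (ang x).
  by rewrite lnK// /ang dilM divff ?gt_eqF// dil1.
have y1 := hsphere_ang x0; set y := ang x in y1 *.
rewrite annular_fun_polar// indicE; case: (boolP (_ \in _)) => /=; last first.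
  by rewrite mulr0 abs_hausdorff_ge0.
rewrite inE /log_annulus/= in_itv/= mulr1 => /andP[s1 s2].
have mN := measurable_test_fun (M + M).
rewrite (abs_hausdorff_polar hsigma mPhi Phi0 rPhi mOmega mN)//.
under eq_integral do rewrite sphere_pairing_test_fun.
have mk := @measurable_log_kernel _ _ alpha q gamma _ mPhi.
have k0 := @log_kernel_ge0 _ _ alpha q gamma _ Phi0.
have mA := measurable_log_annulus (R := R) (M + M).
pose c := expR (- beta * s) * b `^ q'.
have c0 : (0 <= c%:E)%E by rewrite lee_fin mulr_ge0 ?expR_ge0 ?powR_ge0.
pose F t : \bar R := (log_kernel alpha q gamma Phi t * (\1_(log_annulus (M + M)) (s - t))%:E)%E.
have mI : measurable_fun setT (fun t : R => (\1_(log_annulus (M + M)) (s - t))%:E : \bar R).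
  apply/measurable_EFinP.
  have m1 : measurable_fun setT (\1_(log_annulus (M + M)) : R -> R).
    exact: measurable_indic mA.
  by apply: (measurableT_comp m1); exact: measurable_funB.
have mF : measurable_fun setT F by exact: emeasurable_funM.
have F0 t : (0 <= F t)%E by apply: mule_ge0 => //; rewrite lee_fin.
have mst : measurable_fun setT (fun t : R => s - t) by exact: measurable_funB.
have -> : (\int[leb]_t ((profile Phi (expR (s - t)))%:E *
    (expR (- beta * t) * \1_(log_annulus (M + M)) t * b `^ q')%:E) =
    c%:E * \int[leb]_t F t)%E.
  rewrite -(integral_reflect s mF F0).
  rewrite -(ge0_integralZl leb measurableT (measurableT_comp mF mst) (fun t _ => F0 _) c0).
  apply: eq_integral => t _; rewrite /F /= subKr /log_kernel -!EFinM; congr EFin.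
  have -> : expR (- beta * t) = expR (- beta * s) * expR (beta * (s - t)).
    by rewrite -expRD; congr expR; ring.
  by rewrite /c; ring.
apply: (@le_trans _ _ (c%:E * l%:E)%E).
  by rewrite -EFinM lee_fin /c le_eqVlt; apply/orP; left; apply/eqP => /=; ring.
apply: lee_wpmul2l => //; apply: le_trans lM _.
rewrite integral_mkcond; apply: ge0_le_integral => //.
- by move=> t _; rewrite patchE; case: ifP.
- exact/(measurable_restrictT _ (measurable_log_annulus M))/measurable_funTS.
move=> t _; rewrite patchE; case: ifPn => // tM.
rewrite /F indicE mem_set ?mule1//; move: tM.
rewrite inE /log_annulus/= !in_itv/= natrD => /andP[t1 t2].
by apply/andP; split; nra.
Qed.

Let le_of_le_powR (u v : R) : 0 <= v -> u `^ p <= v `^ p -> u <= v.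
Proof.
move=> v0 uv; rewrite leNgt; apply/negP => vu.
have u0 : 0 <= u by exact: ltW (le_lt_trans v0 vu).
by have := gt0_ltr_powR p0 v0 u0 vu; rewrite ltNge uv.
Qed.

(** The test function occupies 4M shells and its image is bounded below on 2M of
    them. All shells contribute equally, so the number of shells enters only
    through the ratio 2 and the constant does not depend on M. *)
Lemma annular_lower_bound (M : nat) (l C : R) : (0 < M)%N -> 0 <= l ->
  (l%:E <= \int[leb]_(t in log_annulus M) log_kernel alpha q gamma Phi t)%E ->
  hausdorff_bound Phi Omega alpha p q (power_weight gamma) C ->
  l * b <= (2 * (2 `^ (`|alpha| * p)) ^+ 2) `^ p^-1 *
    fine (sigma hsphere) `^ (- q^-1) * C.
Proof.
move=> M0 l0 lM [C0 bound].
have L0 : 0 < L by exact: ln2_gt0.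
have Sfin : sigma hsphere \is a fin_num.
  by rewrite ge0_fin_numE// sphere_measure_lty.
set sg := fine (sigma hsphere); set A := 2 `^ (`|alpha| * p).
have A0 : 0 < A by rewrite powR_gt0.
have sg0 : 0 < sg by rewrite fine_gt0// sphere_measure_gt0// sphere_measure_lty.
pose x := b `^ q'; have x0 : 0 <= x by exact: powR_ge0.
pose N (z : H) : \bar R := (Normc.normc (test_fun (M + M) z))%:E.
pose NH (z : H) : \bar R := (Normc.normc (hausdorff Phi Omega (test_fun (M + M)) z))%:E.
pose V (z : H) : \bar R := (annular_fun alpha q gamma (cst (l * x)) M z)%:E.
have mt := measurable_test_fun (M + M).
have mN : measurable_fun setT N by apply/measurable_EFinP; exact: measurable_normc.
have mH := measurable_hausdorff mPhi mOmega mt.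
have mNH : measurable_fun setT NH by apply/measurable_EFinP; exact: measurable_normc.
have mcst : measurable_fun hsphere (cst (l * x) : H -> R) by exact: measurable_cst.
have mV : measurable_fun setT V.
  by apply/measurable_EFinP; exact: measurable_annular_fun.
have N0 z : (0 <= N z)%E by rewrite lee_fin normc_ge0.
have NH0 z : (0 <= NH z)%E by rewrite lee_fin normc_ge0.
have lx0 : 0 <= l * x by exact: mulr_ge0.
have V0 z : (0 <= V z)%E by rewrite lee_fin annular_fun_ge0.
have [leN _] := herz_sum_amalgam hsigma alpha gamma hp hq mN N0.
have [_ leV] := herz_sum_amalgam hsigma alpha gamma hp hq mV V0.
have NE : N = fun z => (annular_fun alpha q gamma rho (M + M) z)%:E.
  by apply/funext => z; rewrite /N normc_test_fun.
rewrite {2}NE (annular_amalgam alpha gamma hp hq _ mrho rho0 x0 rho_power) in leN.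
have cst_power : (\int[S]_y ((cst (l * x) (ang y))%:E `^ q) = ((l * x) `^ q * sg)%:E)%E.
  rewrite -[LHS]/(\int[S]_y cst ((l * x)%:E `^ q) y)%E integral_cst//.
  by rewrite poweR_EFin EFinM /sg fineK// /= /mfrestr /mrestr setTI.
have V1 : 0 <= (l * x) `^ q * sg by rewrite mulr_ge0 ?powR_ge0// ltW.
rewrite (annular_amalgam alpha gamma hp hq _ mcst (fun=> lx0) V1 cst_power) in leV.
have Nfin : (herz_sum alpha p q gamma N < +oo)%E.
  by apply: le_lt_trans leN _; rewrite -EFinM ltry.
have [|ae _ le] := bound (test_fun (M + M)).
  split; first exact: (Lq_loc_of_herz_sum hp hq mt Nfin).
  by rewrite herz_normE//; exact: poweR_lty.
have leH := herz_norm_bound_sum hp hq C0 le.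
have leVH : (herz_sum alpha p q gamma V <= herz_sum alpha p q gamma NH)%E.
  apply: le_herz_sum => //; apply: filterS ae => z abs_z.
  apply: le_trans (abs_hausdorff_test_fun_le abs_z).
  exact: annular_le_abs_hausdorff.
have A0E : (0 <= A%:E)%E by rewrite lee_fin ltW.
have Cp0E : (0 <= (C `^ p)%:E)%E by rewrite lee_fin powR_ge0.
have := le_trans leV (lee_wpmul2l A0E (le_trans leVH
  (le_trans leH (lee_wpmul2l Cp0E leN)))).
rewrite -!EFinM lee_fin -/A.
(* b^q' = b w, where w^p is the power of b on the right-hand side; dividing by
   it leaves b^p on the left *)
pose w := b `^ (q' - 1); have w0 : 0 < w by rewrite powR_gt0.
have xE : x = b * w.
  rewrite /x /w -{2}(powRr1 b0) -powRD; last by rewrite (gt_eqF bgt0) implybT.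
  by congr (_ `^ _); ring.
have qn0 : q != 0 by rewrite gt_eqF.
have xpE : x `^ (p / q) = w `^ p.
  rewrite /x /w -!powRrM; congr (_ `^ _).
  by field; rewrite qn0 subr_eq0 gt_eqF.
have vE : ((l * x) `^ q * sg) `^ (p / q) = (l * b) `^ p * w `^ p * sg `^ (p / q).
  rewrite powRM ?powR_ge0 ?(ltW sg0)// -powRrM mulrC.
  rewrite (_ : q * (p / q) = p); last by field.
  by rewrite xE mulrA powRM ?mulr_ge0 ?(ltW w0)// mulrC.
rewrite powRM ?(ltW L0)// vE (powRM _ (ltW L0) x0) xpE.
have -> : (M + M).*2%:R = 2 * M.*2%:R :> R by rewrite addnn -(mul2n M.*2) natrM.
have X0 : 0 < M.*2%:R :> R by rewrite ltr0n double_gt0.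
have L1 : 0 < L `^ (p / q) by exact: powR_gt0.
have W1 : 0 < w `^ p by exact: powR_gt0.
have D0 := mulr_gt0 (mulr_gt0 X0 L1) W1.
move=> ineq; have {}ineq : (l * b) `^ p * sg `^ (p / q) <= 2 * A ^+ 2 * C `^ p.
  rewrite -(ler_pM2l D0); apply: le_trans (le_trans _ ineq) _.
    by rewrite le_eqVlt; apply/orP; left; apply/eqP; ring.
  by rewrite le_eqVlt; apply/orP; left; apply/eqP; ring.
apply: le_of_le_powR.
  by rewrite mulr_ge0// mulr_ge0// powR_ge0.
have A2 : 0 <= 2 * A ^+ 2 by rewrite mulr_ge0// sqr_ge0.
have -> : ((2 * A ^+ 2) `^ p^-1 * sg `^ (- q^-1) * C) `^ p =
    2 * A ^+ 2 * (sg `^ (p / q))^-1 * C `^ p.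
  have pw := powR_ge0 (2 * A ^+ 2) p^-1; have sw := powR_ge0 sg (- q^-1).
  rewrite (powRM _ (mulr_ge0 pw sw) C0) (powRM _ pw sw) -!powRrM.
  rewrite mulVf ?gt_eqF// powRr1//; congr (_ * _ * _).
  by rewrite -powRN; congr (_ `^ _); ring.
have S1 : 0 < sg `^ (p / q) by exact: powR_gt0.
rewrite -(ler_pM2r S1); apply: le_trans ineq _.
by rewrite le_eqVlt; apply/orP; left; apply/eqP; field; rewrite gt_eqF.
Qed.

End lower_bound.

(** * Boundedness and the constant *)

Section herz_bounds.
Context {R : realType} {n : nat}.
Variable sigma : {measure set (heis R n) -> \bar R}.
Hypothesis hsigma : polar_measure sigma.
Variables alpha p q gamma : R.
Hypotheses (hp : 1 <= p) (hq : 1 < q).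
Local Notation H := (heis R n).
Local Notation Leb := (@lebesgue_heis R n).

Let p0 : 0 < p. Proof. exact: lt_le_trans hp. Qed.
Let q0 : 0 < q. Proof. exact: lt_trans hq. Qed.

Variables (Phi : H -> R) (Omega : H -> R[i]).
Hypotheses (mPhi : measurable_fun setT Phi) (Phi0 : forall x, 0 <= Phi x).
Hypothesis (rPhi : radial Phi).
Hypothesis (mOmega : cmeasurable_fun hsphere Omega).
Hypothesis (finOmega : (sphere_Lnorm sigma (q / (q - 1)) Omega < +oo)%E).

Let b := fine (sphere_Lnorm sigma (q / (q - 1)) Omega).
Let b0 : 0 <= b. Proof. by apply: fine_ge0; exact: poweR_ge0. Qed.

(** The exact value C_3 is not always admissible for K, since it can be 0. *)
Lemma hausdorff_bound_of_C3 (K : R) : 0 < K -> (C3 alpha q gamma Phi <= K%:E)%E ->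
  hausdorff_bound Phi Omega alpha p q (power_weight gamma)
    (2 * ((2 `^ (`|alpha| * p)) ^+ 2 *
          (fine (sigma hsphere) `^ (p / q) * (2 * 2 `^ (p / q)))) `^ p^-1 *
     K * b).
Proof.
move=> K0 C3K; set A := 2 `^ (`|alpha| * p); set sg := fine (sigma hsphere).
have A0 : 0 <= A by rewrite powR_ge0.
have sg0 : 0 <= sg by apply: fine_ge0.
set D := A ^+ 2 * _.
have D0 : 0 <= D by rewrite mulr_ge0 ?sqr_ge0// mulr_ge0 ?powR_ge0// mulr_ge0 ?powR_ge0.
split; first by rewrite !mulr_ge0 ?powR_ge0// ltW.
move=> f [[mf _] ffin].
pose N (x : H) : \bar R := (Normc.normc (f x))%:E.
pose Ab := abs_hausdorff Phi Omega f.
pose NH (x : H) : \bar R := (Normc.normc (hausdorff Phi Omega f x))%:E.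
have Ab0 x : (0 <= Ab x)%E by exact: abs_hausdorff_ge0.
have mAb : measurable_fun setT Ab by exact: measurable_abs_hausdorff.
have mH := measurable_hausdorff mPhi mOmega mf.
have mNH : measurable_fun setT NH by apply/measurable_EFinP; exact: measurable_normc.
have NH0 x : (0 <= NH x)%E by rewrite lee_fin normc_ge0.
have Nfin : (herz_sum alpha p q gamma N < +oo)%E.
  apply: (@lty_poweRy _ _ p^-1); first by rewrite gt_eqF ?invr_gt0.
  by rewrite herz_normE in ffin.
have leAb : (herz_sum alpha p q gamma Ab <=
    (D * (K * b) `^ p)%:E * herz_sum alpha p q gamma N)%E.
  rewrite (C3_log_kernel alpha q gamma mPhi Phi0) in C3K.
  apply: le_trans (herz_sum_abs_hausdorff hsigma hp hq mPhi Phi0 rPhi mOmega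
    finOmega mf K0 C3K) _.
  rewrite le_eqVlt; apply/orP; left; apply/eqP; congr (_%:E * _)%E.
  rewrite -/A -/sg -/b /D (powRM _ (ltW K0) b0) powRM ?powR_ge0// -powRrM.
  by rewrite (_ : q * (p / q) = p); [ring | field; rewrite gt_eqF].
have Abfin : (herz_sum alpha p q gamma Ab < +oo)%E.
  apply: le_lt_trans leAb _; apply: lte_mul_pinfty => //.
  by rewrite lee_fin mulr_ge0 ?powR_ge0.
have leNH : (herz_sum alpha p q gamma NH <=
    (2 `^ p)%:E * ((D * (K * b) `^ p)%:E * herz_sum alpha p q gamma N))%E.
  apply: (@le_trans _ _ (herz_sum alpha p q gamma (fun x => 2%:E * Ab x)%E)).
    have m2 : measurable_fun setT (fun x => 2%:E * Ab x)%E.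
      exact: emeasurable_funM.
    apply: (le_herz_sum alpha gamma hp hq mNH NH0 m2) => [x|]; first exact: mule_ge0.
    by apply: aeW => x; exact: normc_hausdorff_le.
  by rewrite herz_sumZ//; apply: lee_wpmul2l => //; rewrite lee_fin powR_ge0.
have NHfin : (herz_sum alpha p q gamma NH < +oo)%E.
  apply: le_lt_trans leNH _; apply: lte_mul_pinfty; rewrite ?lee_fin ?powR_ge0//.
  by apply: lte_mul_pinfty => //; rewrite lee_fin mulr_ge0 ?powR_ge0.
split.
- have Abae := herz_sum_ae_fin hp hq mAb Ab0 Abfin.
  apply: filterS Abae => x Abx; split => //.
  exact: measurable_integrand_section.
- split; first exact: (Lq_loc_of_herz_sum hp hq mH NHfin).
  by rewrite herz_normE//; exact: poweR_lty.
rewrite !herz_normE//.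
have pV0 : 0 <= p^-1 by rewrite invr_ge0 ltW.
apply: (le_trans (le_poweR pV0 (herz_sum_ge0 _ _ _ _ _) leNH)).
have e1 : (0 <= (2 `^ p)%:E)%E by rewrite lee_fin powR_ge0.
have e2 : 0 <= D * (K * b) `^ p by rewrite mulr_ge0 ?powR_ge0.
rewrite muleA -EFinM.
have e3 : (0 <= (2 `^ p * (D * (K * b) `^ p))%:E)%E by rewrite lee_fin mulr_ge0 ?powR_ge0.
rewrite (poweRM _ e3 (herz_sum_ge0 _ _ _ _ N)) poweR_EFin.
rewrite le_eqVlt; apply/orP; left; apply/eqP; congr (_%:E * _)%E.
have kb0 : 0 <= K * b by rewrite mulr_ge0// ltW.
have pinv (x : R) : 0 <= x -> (x `^ p) `^ p^-1 = x.
  by move=> x0; rewrite -powRrM mulfV ?gt_eqF// powRr1.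
rewrite (powRM _ (powR_ge0 _ _) e2) (powRM _ D0 (powR_ge0 _ _)) !pinv//.
by ring.
Qed.

Hypothesis (neqOmega : {ae sigma, forall y, hsphere y -> Omega y != 0}).

(** The truncated integrals of the kernel are bounded uniformly in the truncation,
    and increase to C_3. *)
Lemma C3_le_of_hausdorff_bound (C : R) :
  hausdorff_bound Phi Omega alpha p q (power_weight gamma) C ->
  (C3 alpha q gamma Phi * sphere_Lnorm sigma (q / (q - 1)) Omega <=
   ((2 * (2 `^ (`|alpha| * p)) ^+ 2) `^ p^-1 *
     fine (sigma hsphere) `^ (- q^-1) * C)%:E)%E.
Proof.
move=> bound; set CL := (_ * C : R).
have bfin : sphere_Lnorm sigma (q / (q - 1)) Omega = b%:E.
  by rewrite fineK// ge0_fin_numE//; exact: poweR_ge0.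
have bgt0 : 0 < b by rewrite -lte_fin -bfin sphere_Lnorm_gt0.
have L0 : 0 < ln 2 :> R by exact: ln2_gt0.
have mk := @measurable_log_kernel _ _ alpha q gamma _ mPhi.
have k0 := @log_kernel_ge0 _ _ alpha q gamma _ Phi0.
have lower M l : 0 <= l ->
    (l%:E <= \int[leb]_(t in log_annulus M.+1) log_kernel alpha q gamma Phi t)%E ->
    l * b <= CL.
  move=> l0 lM; exact: (annular_lower_bound hsigma hp hq mPhi Phi0 rPhi mOmega
    neqOmega finOmega (ltn0Sn M) l0 lM bound).
have CL0 : 0 <= CL.
  have := lower 0 0 (lexx _); rewrite mul0r; apply.
  by apply: integral_ge0 => t _; exact: k0.
have kM M : (\int[leb]_(t in log_annulus M.+1) log_kernel alpha q gamma Phi t <=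
    (CL / b)%:E)%E.
  have := lower M; have : (0 <= \int[leb]_(t in log_annulus M.+1)
    log_kernel alpha q gamma Phi t)%E by apply: integral_ge0 => t _; exact: k0.
  case: (\int[leb]_(t in _) _)%E => [r||] //.
    rewrite !lee_fin => r0 /(_ r r0 (lexx _)) rb.
    by rewrite ler_pdivlMr.
  (* an infinite truncated integral would exceed any real number, such as one
     for which the lower bound is false *)
  move=> _ /(_ ((CL + 1) / b)); rewrite leey divfK ?gt_eqF// => h.
  have : CL + 1 <= CL by apply: h => //; rewrite divr_ge0 ?addr_ge0// ltW.
  by rewrite gerDl ler10.
have homo : {homo (fun M => log_annulus (R := R) M.+1) : i j / (i <= j)%N >-> (i <= j)%O}.
  move=> i j ij; apply/subsetPset => t; rewrite /log_annulus/= !in_itv/= => /andP[t1 t2].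
  have ijR : i.+1%:R * ln 2 <= j.+1%:R * ln 2 :> R by rewrite ler_pM2r// ler_nat.
  by rewrite (le_lt_trans _ t1) ?lerN2// (le_trans t2).
have cvg := ge0_nondecreasing_set_cvg_integral (f := log_kernel alpha q gamma Phi) (mu := leb) homo
  (fun M => measurable_log_annulus M.+1) (fun M => measurable_funTS mk)
  (fun M t _ => k0 t).
rewrite (_ : \bigcup_i _ = setT) in cvg; last first.
  apply/seteqP; split => // t _; exists (Num.truncn (`|t| / ln 2)) => //.
  rewrite /log_annulus/= in_itv/=.
  have := truncnS_gt (`|t| / ln 2); rewrite ltr_pdivrMr// ltr_norml => /andP[t1 t2].
  by rewrite t1 ltW.
rewrite (C3_log_kernel alpha q gamma mPhi Phi0) bfin.
rewrite -(@lee_pdivlMr _ b)// -EFinM.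
rewrite -(cvg_lim _ cvg)//; apply: lime_le; first by apply/cvg_ex; eexists; exact: cvg.
by apply: nearW => M; exact: kM.
Qed.

End herz_bounds.

Unset Implicit Arguments.
Set Strict Implicit.

Theorem theorem3p3 (R : realType) (n : nat)
    (sigma : {measure set (heis R n) -> \bar R})
    (hsigma : polar_measure sigma)
    (alpha p q gamma : R) (hp : 1 <= p) (hq : 1 < q) :
  exists2 C : R, 0 < C &
  forall (Phi : heis R n -> R) (Omega : heis R n -> R[i]),
    measurable_fun setT Phi -> (forall x, 0 <= Phi x) -> radial Phi ->
    cmeasurable_fun hsphere Omega ->
    {ae sigma, forall y, hsphere y -> Omega y != 0} ->
    (sphere_Lnorm sigma (q / (q - 1)) Omega < +oo)%E ->
    let w := power_weight gamma in
    let Omega_norm := sphere_Lnorm sigma (q / (q - 1)) Omega in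
    let opnorm := hausdorff_opnorm Phi Omega alpha p q w in
    (hausdorff_bounded Phi Omega alpha p q w
       <-> (C3 alpha q gamma Phi < +oo)%E) /\
    (hausdorff_bounded Phi Omega alpha p q w ->
      (C^-1%:E * (C3 alpha q gamma Phi * Omega_norm) <= opnorm /\
       opnorm <= C%:E * (C3 alpha q gamma Phi * Omega_norm))%E).
Proof.
pose upper := 2 * ((2 `^ (`|alpha| * p)) ^+ 2 *
  (fine (sigma hsphere) `^ (p / q) * (2 * 2 `^ (p / q)))) `^ p^-1.
pose lower := (2 * (2 `^ (`|alpha| * p)) ^+ 2) `^ p^-1 *
  fine (sigma hsphere) `^ (- q^-1).
have upper0 : 0 <= upper by rewrite mulr_ge0 ?powR_ge0.
have lower0 : 0 <= lower by rewrite mulr_ge0 ?powR_ge0.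
have C0 : 0 < upper + lower + 1 by rewrite ltr_wpDl ?addr_ge0.
exists (upper + lower + 1) => // Phi Omega mPhi Phi0 rPhi mOmega neqOmega finOmega /=.
set B := sphere_Lnorm _ _ _ in finOmega *.
have B0 : (0 < B)%E by exact: (sphere_Lnorm_gt0 hsigma).
have Bfin : B \is a fin_num by rewrite ge0_fin_numE// ltW.
set b := fine B; have BE : B = b%:E by rewrite fineK.
have b0 : 0 < b by rewrite -lte_fin -BE.
have C3_ge0 : (0 <= C3 alpha q gamma Phi)%E.
  by apply: integral_ge0 => t _; rewrite lee_fin divr_ge0 ?powR_ge0//; exact: Phi0.
have C3_le C : hausdorff_bound Phi Omega alpha p q (power_weight gamma) C ->
    (C3 alpha q gamma Phi * B <= (lower * C)%:E)%E.
  exact: C3_le_of_hausdorff_bound.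
have bound_C3 K : 0 < K -> (C3 alpha q gamma Phi <= K%:E)%E ->
    hausdorff_bound Phi Omega alpha p q (power_weight gamma) (upper * K * b).
  exact: hausdorff_bound_of_C3.
have C3_fin : hausdorff_bounded Phi Omega alpha p q (power_weight gamma) ->
    (C3 alpha q gamma Phi < +oo)%E.
  move=> [C /C3_le]; rewrite ltey BE; apply: contraTN => /eqP ->.
  by rewrite gt0_mulye ?lte_fin// -ltNge ltry.
split.
  split; first exact: C3_fin.
  move=> fin; have fn : C3 alpha q gamma Phi \is a fin_num by rewrite ge0_fin_numE.
  exists (upper * (fine (C3 alpha q gamma Phi) + 1) * b); apply: bound_C3.
    by rewrite ltr_wpDl// fine_ge0.
  by rewrite EFinD fineK// leeDl.
move=> bounded; have fin := C3_fin bounded.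
have fn : C3 alpha q gamma Phi \is a fin_num by rewrite ge0_fin_numE.
set c := fine (C3 alpha q gamma Phi); have c0 : 0 <= c by exact: fine_ge0.
have cE : C3 alpha q gamma Phi = c%:E by rewrite fineK.
split.
  apply: le_ereal_inf_tmp => _ [C bC <-]; have [Cge0 _] := bC.
  have := C3_le C bC; rewrite cE BE -!EFinM !lee_fin => cbC.
  rewrite ler_pdivrMl//; apply: le_trans cbC _.
  by apply: ler_wpM2r => //; rewrite addrAC lerDr addr_ge0.
(* the bounds for K > C_3 give the one for C_3 in the limit; K - C_3 is chosen so
   that the excess is at most e *)
apply/lee_addgt0Pr => e e0.
have d0 : 0 < upper * b + 1 by rewrite ltr_wpDl// mulr_ge0// ltW.
have ed0 : 0 < e / (upper * b + 1) by exact: divr_gt0.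
apply: ge_ereal_inf; exists (upper * (c + e / (upper * b + 1)) * b)%:E.
  eexists; last reflexivity; apply: bound_C3; first by rewrite ltr_wpDl.
  by rewrite cE lee_fin lerDl ltW.
rewrite cE BE -!EFinM -EFinD lee_fin.
rewrite (_ : _ * b = upper * (c * b) + upper * b * (e / (upper * b + 1))); last by ring.
apply: lerD.
  apply: ler_wpM2r; first by rewrite mulr_ge0// ltW.
  by rewrite -addrA lerDl addr_ge0.
rewrite mulrA ler_pdivrMr// mulrC ler_pM2l//.
by rewrite lerDl.
Qed.
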